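(* Let $\gamma\in\mathbb{R}$, and let $c>0$ if $\gamma\ge0$ and $c>\gamma^2/4$ if $\gamma<0$. Then every even solution $\varphi\in H^1(\mathbb{R})$ of $$c\varphi-\varphi''-\gamma\mathcal{H}\varphi'=\tfrac12\varphi^2$$ satisfies $$|x^2\varphi|+|x^3\varphi'|+|x^3\varphi''|\in L^\infty(\mathbb{R}).$$
   Context: All functions are real-valued. $\mathcal{H}$ is the Hilbert transform $\mathcal{H}v(x)=\mathrm{p.v.}\,\frac1\pi\int_{\mathbb{R}}\frac{v(y)}{y-x}\,dy$, i.e. $\widehat{\mathcal{H}v}(\xi)=i\,\mathrm{sgn}(\xi)\hat v(\xi)$, so that $-\mathcal{H}\partial_x$ has Fourier symbol $|\xi|$. *)

(* Defs.v *)
From HB Require Import structures.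
From mathcomp Require Import all_boot all_order all_algebra.
From mathcomp Require Import all_classical all_reals all_analysis.
Set Implicit Arguments.
Unset Strict Implicit.
Unset Printing Implicit Defensive.
Import Order.TTheory GRing.Theory Num.Theory.
Import numFieldNormedType.Exports.
Local Open Scope classical_set_scope.
Local Open Scope ring_scope.

Section Defs.
Context {R : realType}.
Local Notation mu := (@lebesgue_measure R).
Implicit Types (f g h v psi phi : R -> R).

Definition test_function psi : Prop :=
  (forall (n : nat) (x : R), derivable (derive1n n psi) x 1) /\
  (exists M : R, forall x : R, M < `|x| -> psi x = 0).

Definition distr_pairing f psi : R := \int[mu]_(x in setT) (f x * psi x).

Definition weak_derivative f g : Prop :=
  [/\ locally_integrable setT f, locally_integrable setT g &
      forall psi, test_function psi ->
        distr_pairing g psi = - distr_pairing f (derive1 psi)].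

Definition in_L2 f : Prop := f \in Lfun mu 2%:E.
Definition in_Linfty f : Prop := f \in Lfun mu +oo%E.

(* Elements of L^2 and H^1 are handled through Borel representatives. *)
Definition in_H1 phi : Prop :=
  in_L2 phi /\ exists2 dphi, in_L2 dphi & weak_derivative phi dphi.

Definition hilbert_trunc v (x e : R) : R :=
  pi^-1 * \int[mu]_(y in [set y | e < `|y - x|]) (v y / (y - x)).

(* [h] represents the Hilbert transform of [v]: for v in L^2 the principal
   value exists for almost every x, which is the sense given to it here. *)
Definition is_hilbert v h : Prop :=
  measurable_fun setT h /\
  {ae mu, forall x : R, hilbert_trunc v x e @[e --> 0^'+] --> h x}.

Definition even_ae phi : Prop := {ae mu, forall x : R, phi (- x) = phi x}.

(* c phi - phi'' - gamma H(phi') = phi^2 / 2 in the sense of distributions; phi''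
   is the distribution psi |-> <phi, psi''>. *)
Definition is_solution (c gamma : R) phi : Prop :=
  exists dphi h,
    [/\ weak_derivative phi dphi,
        is_hilbert dphi h &
        forall psi, test_function psi ->
          c * distr_pairing phi psi - distr_pairing phi (derive1n 2 psi)
            - gamma * distr_pairing h psi
          = 2^-1 * distr_pairing (fun x => phi x ^+ 2) psi].

End Defs.

(* Main.v *)
Require Import Defs.
From HB Require Import structures.
From mathcomp Require Import all_boot all_order all_algebra.
From mathcomp Require Import all_classical all_reals all_analysis.
From mathcomp Require Import measurable_realfun ring lra.
Set Implicit Arguments.
Unset Strict Implicit.
Unset Printing Implicit Defensive.
Import Order.TTheory GRing.Theory Num.Theory.
Import numFieldNormedType.Exports.
Local Open Scope classical_set_scope.
Local Open Scope ring_scope.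

(** The proof is an energy method in physical space.  The Hilbert transform is regularized by the
    convolution [T_t = cv (qk t)] with the conjugate Poisson kernel [z / (pi (z^2 + t^2))].  It is
    an [L^2] contraction, because the convolution square of that kernel is minus the Poisson kernel
    [Pk (t + t)]; the quadratic form of [T_t d/dx] is at most [O(t)]; and [T_t phi'] converges
    almost everywhere to [H phi'].  Hence [c - d^2/dx^2 - gamma T_t d/dx] is coercive on [H^1],
    uniformly as [t] tends to [0], under the stated condition on [c].

    Moments are gained by testing with [m w], [m = x a], [a = r^2 / (x^2 + r^2)], and letting [r]
    tend to infinity.  With [b = r x / (x^2 + r^2)] one has
    [m (x + z) - m x = z (a x * a (x + z) - b x * b (x + z))], so commuting [m] with [T_t] only
    costs the rank two term [pi^-1 (<a, f> a - <b, f> b)].  For the first moment this is bounded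
    uniformly in [r].  For the second one the [a] part is not, and it is compensated by
    subtracting a multiple of [a] from the unknown: this is the [x^-2] tail of the solution.
    One obtains [x phi] and [x^2 phi - k] in [H^1], so [x^2 phi] is bounded.

    The function [v = x phi'] solves a linear equation of the same kind with potential [phi] and
    right-hand side [phi^2 - 2 c phi + gamma H phi'], whose moments are now known.  Therefore
    [x^2 v = x^3 phi'] is bounded and Lipschitz (the latter by testing with trapezoids), and
    Lebesgue's differentiation theorem bounds [x^3 phi'']. *)

(** * Integrals over the line *)

(** [is_hilbert] only gives an almost everywhere principal value, so boundedness, antisymmetry and
    commutation with [d/dx] are proved for smooth kernels and passed to the limit. The a priori
    estimates see the equation only through [WE], where no Hilbert transform occurs. The limits do
    not commute: regularization errors have size [sqrt (r t)], so [t] tends to 0 at fixed [r], and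
    only then [r] tends to infinity. [evle] records bounds that hold in the first limit. The weights
    come from a resolvent: [a + i b = r / (r - i x)] and [m = r b], so the formula for
    [m (x + z) - m x] is a resolvent identity, and this makes the commutator of finite rank. The
    bounds are uniform in [r] because the potential vanishes at infinity: far out it is absorbed by
    coercivity, and on the remaining segment the weight is at most its half-length. The condition on
    [c] for negative [gamma] is positive definiteness of [c X^2 - |gamma| X Y + Y^2]. The argument
    gains two powers of [x]. To reach [x^3 phi'], one power is put into the unknown [x phi']; its
    equation has no [phi''] in the source, since the wave equation eliminates it. *)

Section Toolkit.
Context {R : realType}.
Local Notation mu := (@lebesgue_measure R).
Local Notation I := (Rintegral mu setT).
Implicit Types (f g h u v w : R -> R) (a b c s t x y z : R).

Definition summ f := mu.-integrable setT (EFin \o f).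

Lemma aeS (P Q : R -> Prop) : (forall x, P x -> Q x) ->
  {ae mu, forall x, P x} -> {ae mu, forall x, Q x}.
Proof. by move=> PQ; apply: filterS => //; exact: (ae_filter_ringOfSetsType mu). Qed.

Lemma aeS2 (P Q S : R -> Prop) : (forall x, P x -> Q x -> S x) ->
  {ae mu, forall x, P x} -> {ae mu, forall x, Q x} -> {ae mu, forall x, S x}.
Proof. by move=> PQS; apply: filterS2 => //; exact: (ae_filter_ringOfSetsType mu). Qed.

Lemma measurable_norm f : measurable_fun setT f ->
  measurable_fun setT (fun x => `|f x|).
Proof. by move=> mf; apply: measurableT_comp. Qed.

Lemma measurable_EFin f : measurable_fun setT f ->
  measurable_fun setT (fun x => (f x)%:E).
Proof. by move=> mf; apply/measurable_EFinP. Qed.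

Lemma measurable_EFin_norm f : measurable_fun setT f ->
  measurable_fun setT (fun x => `|(f x)%:E|%E).
Proof. by move=> mf; apply: (measurable_EFin (measurable_norm mf)). Qed.

Lemma summ_mf f : summ f -> measurable_fun setT f.
Proof. by move=> /integrableP[/measurable_EFinP]. Qed.

Lemma summD f g : summ f -> summ g -> summ (fun x => f x + g x).
Proof. by move=> hf hg; exact: (integrableD measurableT hf hg). Qed.

Lemma summZ c f : summ f -> summ (fun x => c * f x).
Proof. by move=> hf; exact: (integrableZl measurableT c hf). Qed.

Lemma summN f : summ f -> summ (fun x => - f x).
Proof.
move=> hf; rewrite (_ : (fun x => - f x) = (fun x => -1 * f x)); first exact: summZ.
by apply/funext => x; rewrite mulN1r.
Qed.

Lemma summB f g : summ f -> summ g -> summ (fun x => f x - g x).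
Proof. by move=> hf hg; exact/summD/summN. Qed.

Lemma summ_norm f : summ f -> summ (fun x => `|f x|).
Proof. by move=> hf; exact: integrable_norm. Qed.

Lemma summ_dom g f : measurable_fun setT f -> (forall x, `|f x| <= g x) ->
  summ g -> summ f.
Proof.
move=> mf fg hg; apply: (le_integrable measurableT _ _ hg).
  exact/measurable_EFinP.
move=> x _ /=; rewrite lee_fin (le_trans (fg x))// ler_norm//.
Qed.

Lemma I_D f g : summ f -> summ g -> I (fun x => f x + g x) = I f + I g.
Proof. by move=> *; apply: RintegralD. Qed.
Lemma I_B f g : summ f -> summ g -> I (fun x => f x - g x) = I f - I g.
Proof. by move=> *; apply: RintegralB. Qed.
Lemma I_Z c f : summ f -> I (fun x => c * f x) = c * I f.
Proof. by move=> *; apply: RintegralZl. Qed.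
Lemma I_N f : summ f -> I (fun x => - f x) = - I f.
Proof.
move=> hf; rewrite -[RHS]mulN1r -I_Z//; congr fine.
by apply: eq_integral => x _; rewrite mulN1r.
Qed.
Lemma I_le f g : summ f -> summ g -> (forall x, f x <= g x) -> I f <= I g.
Proof. by move=> hf hg fg; apply: le_Rintegral. Qed.
Lemma I_ge0 f : (forall x, 0 <= f x) -> 0 <= I f.
Proof. by move=> f0; apply: Rintegral_ge0. Qed.
Lemma I_norm f : summ f -> `|I f| <= I (fun x => `|f x|).
Proof. by move=> hf; apply: le_normr_Rintegral. Qed.
Lemma I_ext f g : (forall x, f x = g x) -> I f = I g.
Proof. by move=> fg; congr (Rintegral _ _ _); apply/funext. Qed.
Lemma I_0 : I (fun=> 0) = 0.
Proof. by rewrite /Rintegral integral0. Qed.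
Lemma summ0 : summ (fun=> 0).
Proof. exact: integrable0. Qed.

Lemma I_dom f g : measurable_fun setT f -> (forall x, `|f x| <= g x) ->
  summ g -> `|I f| <= I g.
Proof.
move=> mf fg hg; have hf := summ_dom mf fg hg.
apply: le_trans (I_norm hf) _; apply: I_le => //; exact: summ_norm.
Qed.

Lemma EFinI f : summ f -> ((I f)%:E = \int[mu]_x (f x)%:E)%E.
Proof.
move=> hf; rewrite /Rintegral fineK//.
exact: (integrable_fin_num measurableT hf).
Qed.

Lemma summ_fin f : measurable_fun setT f ->
  (\int[mu]_x `|(f x)%:E| < +oo)%E -> summ f.
Proof. by move=> mf hf; apply/integrableP; split => //; apply/measurable_EFinP. Qed.

Lemma I_eq_ae f g : measurable_fun setT f -> measurable_fun setT g ->
  {ae mu, forall x, f x = g x} -> I f = I g.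
Proof.
move=> mf mg fg; congr fine; apply: ae_eq_integral => //.
- exact/measurable_EFinP.
- exact/measurable_EFinP.
- by apply: aeS fg => x /= -> .
Qed.

Lemma summ_ae f g : measurable_fun setT g ->
  {ae mu, forall x, f x = g x} -> summ f -> summ g.
Proof.
move=> mg fg hf; apply: summ_fin => //.
case/integrableP: (hf) => _; congr (_ < _)%E.
apply: ae_eq_integral => //.
- by apply: measurable_EFin_norm (summ_mf hf).
- exact: measurable_EFin_norm.
- by apply: aeS fg => x /= -> .
Qed.

(** Summability of the limit is part of the conclusion: this is how functions known only as almost
    everywhere limits, such as a Hilbert transform, are shown to be square integrable. *)
Lemma fatou_I (F : nat -> R -> R) f C : (forall n, summ (F n)) ->
  (forall n x, 0 <= F n x) -> (forall n, I (F n) <= C) ->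
  measurable_fun setT f ->
  {ae mu, forall x, F n x @[n --> \oo] --> f x} ->
  [/\ summ f, {ae mu, forall x, 0 <= f x} & I f <= C].
Proof.
move=> sF F0 FC mf Ff.
have f0 : {ae mu, forall x, 0 <= f x}.
  apply: aeS Ff => x Ffx; rewrite -(cvg_lim _ Ffx)//.
  by apply: limr_ge; [exact: cvgP Ffx|exact: nearW].
have ff : (\int[mu]_x `|(f x)%:E| <= C%:E)%E.
  have -> : (\int[mu]_x `|(f x)%:E| = \int[mu]_x limn_einf (fun n => (F n x)%:E))%E.
    apply: ae_eq_integral => //.
    - exact: measurable_EFin_norm.
    - rewrite (_ : (fun x => _) =
        (fun x => - limn_esup ((fun n (x : R) => - (F n x)%:E) ^~ x))%E); last first.
        by apply/funext => x; rewrite -limn_einfN; congr limn_einf; apply/funext => n /=; rewrite opprK.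
      apply: measurableT_comp => //; apply: measurable_fun_limn_esup => n.
      by apply: measurableT_comp => //; apply: measurable_EFin; exact: summ_mf.
    - apply: aeS2 f0 Ff => x f0x Ffx _.
      have h : (F n x)%:E @[n --> \oo] --> (f x)%:E by apply: cvg_EFin => //; exact: nearW.
      by rewrite (cvg_limn_einf_sup h).1/= ger0_norm.
  apply: le_trans (fatou _ measurableT _ _) _.
  - by move=> n; apply/measurable_EFinP; exact: summ_mf.
  - by move=> n x _; rewrite lee_fin.
  - apply: (@le_trans _ _ (limn_einf (fun n => C%:E))).
      rewrite !limn_einf_lim; apply: lee_lim; [exact: is_cvg_einfs|exact: is_cvg_einfs|].
      apply: nearW => n; apply: le_ereal_inf_tmp => _ [k /= nk <-].
      apply: (@le_trans _ _ (\int[mu]_x (F k x)%:E)%E).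
        by apply: ereal_inf_lbound; exists k.
      by rewrite -EFinI// lee_fin.
    by rewrite (cvg_limn_einf_sup (cvg_cst _)).1.
have sf : summ f by apply: summ_fin => //; apply: le_lt_trans ff _; rewrite ltry.
split=> //; rewrite -lee_fin EFinI//; apply: le_trans ff.
apply: le_trans (le_abse_integral _ _ _) => //; last first.
  exact/measurable_EFinP.
exact: lee_abs.
Qed.

Lemma dct_I (F : nat -> R -> R) f g : (forall n, measurable_fun setT (F n)) ->
  measurable_fun setT f -> summ g ->
  {ae mu, forall x, F n x @[n --> \oo] --> f x} ->
  (forall n x, `|F n x| <= g x) ->
  I (F n) @[n --> \oo] --> I f.
Proof.
move=> mF mf sg Ff Fg.
have [] := @dominated_convergence _ _ _ mu setT measurableT
  (fun n x => (F n x)%:E) (EFin \o f) (EFin \o g).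
- by move=> n; apply: measurable_EFin.
- exact/measurable_EFinP.
- apply: aeS Ff => x Ffx _; apply: cvg_EFin => //; exact: nearW.
- exact: sg.
- by apply: aeW => x n _ /=; rewrite lee_fin.
move=> sf _ cv.
have sF n : summ (F n) by apply: summ_dom sg.
apply: (fine_cvg (f := fun n => (\int[mu]_x (F n x)%:E)%E)).
by rewrite -/(I f) EFinI.
Qed.

(** * Translations and reflections *)

Lemma measurable_shift s : measurable_fun setT (fun x : R => x + s).
Proof. by apply: measurable_funD => //; exact: measurable_id. Qed.
Lemma measurable_opp : measurable_fun setT (fun x : R => - x).
Proof. exact: oppr_measurable. Qed.

Lemma measurable_fshift s f : measurable_fun setT f ->
  measurable_fun setT (fun x => f (x + s)).
Proof. by move=> mf; exact: (measurableT_comp mf (measurable_shift s)). Qed.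
Lemma measurable_fopp f : measurable_fun setT f ->
  measurable_fun setT (fun x => f (- x)).
Proof. by move=> mf; exact: (measurableT_comp mf measurable_opp). Qed.

(** Uniqueness of Lebesgue measure: the image measure gives half-open intervals the same length. *)
Lemma lebesgue_measure_shift s (A : set R) : measurable A ->
  mu A = pushforward mu (fun x : R => x + s) A.
Proof.
move=> mA; have mphi : @measurable_fun _ _ (measurableTypeR R) (measurableTypeR R) setT
  (fun x : R => x + s) := measurable_shift s.
pose m : {measure set (measurableTypeR R) -> \bar R} :=
  measure_function_pushforward__canonical__measure_function_Measure mu mphi.
apply: (@lebesgue_measure_unique R m) => // _ [[a b] _ <-] /=.
rewrite /pushforward.
have -> : (fun x : R => x + s) @^-1` `]a, b]%classic = `]a - s, b - s]%classic.
  by apply/seteqP; split => x /=; rewrite !in_itv/= ltrBlDr lerBrDr.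
rewrite !lebesgue_measure_itv/= !lte_fin ltrD2r.
by case: ifP => // _; rewrite -!EFinB; congr (_%:E); ring.
Qed.

Lemma lebesgue_measure_opp (A : set R) : measurable A ->
  mu A = pushforward mu (fun x : R => - x) A.
Proof.
move=> mA; have mphi : @measurable_fun _ _ (measurableTypeR R) (measurableTypeR R) setT
  (fun x : R => - x) := measurable_opp.
pose m : {measure set (measurableTypeR R) -> \bar R} :=
  measure_function_pushforward__canonical__measure_function_Measure mu mphi.
apply: (@lebesgue_measure_unique R m) => // _ [[a b] _ <-] /=.
rewrite /pushforward.
(* The reflected interval is half-open on the other side, but its length is unchanged. *)
have -> : (fun x : R => - x) @^-1` `]a, b]%classic = `[- b, - a[%classic.
  by apply/seteqP; split => x /=; rewrite !in_itv/= ltrNr lerNl andbC.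
rewrite !lebesgue_measure_itv/= !lte_fin ltrN2.
by case: ifP => // _; rewrite -!EFinB; congr (_%:E); ring.
Qed.

Lemma integral_shift s (f : R -> \bar R) : measurable_fun setT f ->
  (forall x, 0 <= f x)%E ->
  (\int[mu]_x f (x + s)%R = \int[mu]_x f x)%E.
Proof.
move=> mf f0; have mphi : @measurable_fun _ _ (measurableTypeR R) (measurableTypeR R) setT
  (fun x : R => x + s) := measurable_shift s.
have := @ge0_integral_pushforward _ _ _ _ _ _ mphi mu setT f measurableT mf
  (fun x _ => f0 x).
rewrite preimage_setT => <-.
by apply: eq_measure_integral => A mA _; symmetry; exact: lebesgue_measure_shift.
Qed.

Lemma integral_opp (f : R -> \bar R) : measurable_fun setT f ->
  (forall x, 0 <= f x)%E ->
  (\int[mu]_x f (- x)%R = \int[mu]_x f x)%E.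
Proof.
move=> mf f0; have mphi : @measurable_fun _ _ (measurableTypeR R) (measurableTypeR R) setT
  (fun x : R => - x) := measurable_opp.
have := @ge0_integral_pushforward _ _ _ _ _ _ mphi mu setT f measurableT mf
  (fun x _ => f0 x).
rewrite preimage_setT => <-.
by apply: eq_measure_integral => A mA _; symmetry; exact: lebesgue_measure_opp.
Qed.

Lemma I_shift s f : measurable_fun setT f -> I (fun x => f (x + s)) = I f.
Proof.
move=> mf; congr fine; rewrite [LHS]integralE [RHS]integralE; congr (_ - _)%E.
  rewrite -[RHS](@integral_shift s _ (measurable_funepos (measurable_EFin mf)) (funepos_ge0 _)).
  by apply: eq_integral => x _; rewrite !funeposE.
rewrite -[RHS](@integral_shift s _ (measurable_funeneg (measurable_EFin mf)) (funeneg_ge0 _)).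
  by apply: eq_integral => x _; rewrite !funenegE.
Qed.

Lemma I_opp f : measurable_fun setT f -> I (fun x => f (- x)) = I f.
Proof.
move=> mf; congr fine; rewrite [LHS]integralE [RHS]integralE; congr (_ - _)%E.
  rewrite -[RHS](@integral_opp _ (measurable_funepos (measurable_EFin mf)) (funepos_ge0 _)).
  by apply: eq_integral => x _; rewrite !funeposE.
rewrite -[RHS](@integral_opp _ (measurable_funeneg (measurable_EFin mf)) (funeneg_ge0 _)).
  by apply: eq_integral => x _; rewrite !funenegE.
Qed.

Lemma summ_shift s f : summ f -> summ (fun x => f (x + s)).
Proof.
move=> sf; have mf := summ_mf sf; apply: summ_fin; first exact: measurable_fshift.
rewrite (@integral_shift s (fun x => `|(f x)%:E|%E))//; first by case/integrableP: sf.
exact: measurable_EFin_norm.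
Qed.

Lemma summ_opp f : summ f -> summ (fun x => f (- x)).
Proof.
move=> sf; have mf := summ_mf sf; apply: summ_fin; first exact: measurable_fopp.
rewrite (@integral_opp (fun x => `|(f x)%:E|%E))//; first by case/integrableP: sf.
exact: measurable_EFin_norm.
Qed.

(** A summable bound on the inner integrals of the absolute value gives integrability on the
    product. The sections in the other variable are then summable only almost everywhere, which is
    recorded separately. *)
Lemma fubini_I (F : R -> R -> R) g :
  measurable_fun setT (fun p : R * R => F p.1 p.2) ->
  (forall x, summ (F x)) -> (forall x, I (fun y => `|F x y|) <= g x) -> summ g ->
  [/\ summ (fun x => I (F x)), summ (fun y => I (fun x => F x y)),
     {ae mu, forall y, summ (fun x => F x y)} &
     I (fun x => I (F x)) = I (fun y => I (fun x => F x y))].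
Proof.
move=> mF sF Fg sg.
have mEF : measurable_fun setT (fun p : R * R => (F p.1 p.2)%:E).
  by apply/measurable_EFinP.
have mEF' : measurable_fun setT (fun p : R * R => (F p.2 p.1)%:E).
  have h : measurable_fun setT (fun p : R * R => (p.2, p.1)).
    exact: (measurable_fun_pair measurable_snd measurable_fst).
  exact: (measurableT_comp mEF h).
have mG := @measurable_fun_fubini_tonelli_F _ _ _ _ R mu
  (fun p : R * R => `|(F p.1 p.2)%:E|%E)
  (measurableT_comp (@abse_measurable _ _) mEF) (fun=> abse_ge0 _).
have lty : (\int[mu]_x \int[mu]_y `|(F x y)%:E| < +oo)%E.
  case/integrableP: (sg) => mg; apply: le_lt_trans.
  apply: ge0_le_integral => //=.
  - by move=> x _; apply: integral_ge0.
  - exact: measurable_EFin (measurable_norm (summ_mf sg)).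
  - move=> x _; rewrite -[leLHS](EFinI (summ_norm (sF x))) lee_fin.
    exact: le_trans (Fg x) (ler_norm _).
have iF : (mu \x mu)%E.-integrable setT (fun p : R * R => (F p.1 p.2)%:E).
  by apply/integrable12ltyP => //.
have h1 : summ (fun x => I (F x)).
  have := integrable_fubini_F iF; apply: eq_integrable => // x _ /=.
  by rewrite EFinI.
have iF' : (mu \x mu)%E.-integrable setT (fun p : R * R => (F p.2 p.1)%:E).
  apply/integrable21ltyP.
    exact: mEF'.
  exact: lty.
have h3 : {ae mu, forall y, summ (fun x => F x y)} by exact: ae_integrable2 iF.
have h2 : summ (fun y => I (fun x => F x y)).
  have sG := integrable_fubini_F iF'.
  apply: summ_fin.
    apply: (measurableT_comp (f := fine)) => //.
    exact: (measurable_fubini_F iF').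
  case/integrableP: (sG) => _; apply: le_lt_trans; apply: ge0_le_integral => //.
  - apply: measurableT_comp => //; apply/measurable_EFinP.
    apply: (measurableT_comp (f := fine)) => //.
    exact: (measurable_fubini_F iF').
  - apply: measurableT_comp => //; exact: (measurable_fubini_F iF').
  (* [fine] sends an infinite inner integral to [0], so the comparison holds for every [y],
     exceptional ones included. *)
  - move=> y _; rewrite /Rintegral /fubini_F /=.
    by case: (\int[mu]_x _)%E => [r| |]//=; rewrite ?normr0 ?leey.
split; [exact: h1|exact: h2|exact: h3|].
apply: EFin_inj; rewrite (EFinI h1) (EFinI h2).
have h : (\int[mu]_x \int[mu]_y (F x y)%:E = \int[mu]_y \int[mu]_x (F x y)%:E)%E.
  exact: Fubini iF.
transitivity (\int[mu]_x \int[mu]_y (F x y)%:E)%E.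
  by apply: eq_integral => x _; rewrite EFinI.
rewrite h; apply: ae_eq_integral => //=.
- exact: (measurable_fubini_F iF').
- exact: measurable_EFin (summ_mf h2).
- by apply: aeS h3 => y sy _; rewrite EFinI.
Qed.

End Toolkit.

(** * The space L^2 and weak limits *)

Section L2Theory.
Context {R : realType}.
Local Notation mu := (@lebesgue_measure R).
Local Notation I := (Rintegral mu setT).
Implicit Types (f g h u v w m : R -> R) (a b c s t x y z M : R).

Definition L2 f := measurable_fun setT f /\ summ (fun x => f x ^+ 2).
Definition ip f g := I (fun x => f x * g x).
Definition nm f := Num.sqrt (I (fun x => f x ^+ 2)).

Lemma summ_scale_dom f g c : measurable_fun setT f ->
  (forall x, `|f x| <= c * `|g x|) -> summ g -> summ f.
Proof.
move=> mf fg sg; apply: (@summ_dom _ (fun x => c * `|g x|)) => //.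
exact/summZ/summ_norm.
Qed.

Lemma measurable_sqr f : measurable_fun setT f ->
  measurable_fun setT (fun x => f x ^+ 2).
Proof. by move=> mf; apply: measurable_funX. Qed.

Lemma L2_dom f g : measurable_fun setT f -> (forall x, `|f x| <= `|g x|) ->
  L2 g -> L2 f.
Proof.
move=> mf fg [mg sg]; split=> //; apply: summ_dom sg; first exact: measurable_sqr.
by move=> x; rewrite normrX -[leRHS]real_normK ?num_real// lerXn2r// nnegrE.
Qed.

Lemma L2Z c f : L2 f -> L2 (fun x => c * f x).
Proof.
move=> [mf sf]; split; first exact: measurable_funM.
rewrite (_ : (fun x => _) = (fun x => c ^+ 2 * f x ^+ 2)); first exact: summZ.
by apply/funext => x; rewrite exprMn.
Qed.

Lemma L2M f g : L2 f -> L2 g -> summ (fun x => f x * g x).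
Proof.
move=> [mf sf] [mg sg]; apply: (@summ_dom _ (fun x => f x ^+ 2 + g x ^+ 2)).
- exact: measurable_funM.
- by move=> x; rewrite ler_norml; apply/andP; split; nra.
- exact: summD.
Qed.

Lemma L2D f g : L2 f -> L2 g -> L2 (fun x => f x + g x).
Proof.
move=> hf hg; have [mf sf] := hf; have [mg sg] := hg.
split; first exact: measurable_funD.
rewrite (_ : (fun x => _) = (fun x => f x ^+ 2 + g x ^+ 2 + 2 * (f x * g x))).
  by apply: summD; [exact: summD|apply: summZ; exact: L2M].
by apply/funext => x; ring.
Qed.

Lemma L2N f : L2 f -> L2 (fun x => - f x).
Proof.
move=> /(L2Z (-1)); rewrite (_ : (fun x => -1 * f x) = (fun x => - f x))//.
by apply/funext => x; rewrite mulN1r.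
Qed.

Lemma L2B f g : L2 f -> L2 g -> L2 (fun x => f x - g x).
Proof. by move=> hf hg; apply/L2D/L2N. Qed.

Lemma L2_0 : L2 (fun=> 0).
Proof.
split; first exact: measurable_cst.
rewrite (_ : (fun x => _) = (fun=> 0)); first exact: summ0.
by apply/funext => x; rewrite expr0n.
Qed.

Lemma L2_norm f : L2 f -> L2 (fun x => `|f x|).
Proof.
move=> hf; apply: L2_dom (hf) => [|x]; first exact: measurable_norm hf.1.
by rewrite normr_id.
Qed.

Lemma L2_bmul m M f : measurable_fun setT m -> (forall x, `|m x| <= M) ->
  L2 f -> L2 (fun x => m x * f x).
Proof.
move=> mm mM hf; apply: (@L2_dom _ (fun x => M * f x)).
- by apply: measurable_funM => //; exact: hf.1.
- move=> x; rewrite !normrM ler_wpM2r// (le_trans (mM x))//.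
  by rewrite ger0_norm// (le_trans _ (mM x)).
- exact: L2Z.
Qed.

Lemma L2_shift s f : L2 f -> L2 (fun x => f (x + s)).
Proof.
by move=> [mf sf]; split; [exact: measurable_fshift|exact: (summ_shift s sf)].
Qed.

Lemma L2_opp f : L2 f -> L2 (fun x => f (- x)).
Proof. by move=> [mf sf]; split; [exact: measurable_fopp|exact: (summ_opp sf)]. Qed.

Lemma L2_ae f g : measurable_fun setT g -> {ae mu, forall x, f x = g x} ->
  L2 f -> L2 g.
Proof.
move=> mg fg [mf sf]; split=> //; apply: summ_ae sf; first exact: measurable_sqr.
by apply: aeS fg => x ->.
Qed.

Lemma nm_ge0 f : 0 <= nm f. Proof. exact: sqrtr_ge0. Qed.
Lemma nm_sqr f : nm f ^+ 2 = I (fun x => f x ^+ 2).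
Proof. by rewrite sqr_sqrtr// I_ge0// => x; exact: sqr_ge0. Qed.
Lemma ipff f : ip f f = nm f ^+ 2.
Proof. by rewrite nm_sqr; apply: I_ext => x; rewrite expr2. Qed.
Lemma ipC f g : ip f g = ip g f.
Proof. by apply: I_ext => x; rewrite mulrC. Qed.

Lemma nm_ext f g : (forall x, f x = g x) -> nm f = nm g.
Proof. by move=> fg; congr nm; apply/funext. Qed.

Lemma nm_dom f g : L2 f -> L2 g -> (forall x, `|f x| <= `|g x|) -> nm f <= nm g.
Proof.
move=> hf hg fg; rewrite ler_wsqrtr// I_le//; [exact: hf.2|exact: hg.2|].
by move=> x; rewrite -(real_normK (num_real (f x))) -(real_normK (num_real (g x))) lerXn2r// nnegrE.
Qed.

Lemma nmZ c f : L2 f -> nm (fun x => c * f x) = `|c| * nm f.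
Proof.
move=> hf; rewrite /nm -sqrtr_sqr -sqrtrM ?sqr_ge0// -I_Z; last exact: hf.2.
by congr Num.sqrt; apply: I_ext => x; rewrite exprMn.
Qed.

Lemma nmN f : L2 f -> nm (fun x => - f x) = nm f.
Proof. by move=> hf; congr Num.sqrt; apply: I_ext => x; rewrite sqrrN. Qed.

Lemma nm_norm f : nm (fun x => `|f x|) = nm f.
Proof. by congr Num.sqrt; apply: I_ext => x; rewrite real_normK// num_real. Qed.

Lemma nm_shift s f : measurable_fun setT f -> nm (fun x => f (x + s)) = nm f.
Proof.
by move=> mf; congr Num.sqrt; rewrite (I_shift s (f := fun x => f x ^+ 2))//; exact: measurable_sqr.
Qed.

Lemma nm_opp f : measurable_fun setT f -> nm (fun x => f (- x)) = nm f.
Proof.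
by move=> mf; congr Num.sqrt; rewrite (I_opp (f := fun x => f x ^+ 2))//; exact: measurable_sqr.
Qed.

Lemma nm_bmul m M f : measurable_fun setT m -> 0 <= M -> (forall x, `|m x| <= M) ->
  L2 f -> nm (fun x => m x * f x) <= M * nm f.
Proof.
move=> mm M0 mM hf; rewrite -[X in X * _](ger0_norm M0) -nmZ//; apply: nm_dom.
- exact: L2_bmul mM hf.
- exact: L2Z.
- by move=> x; rewrite !normrM ler_wpM2r// (ger0_norm M0).
Qed.

(** The quadratic polynomial [key] in [s] is nonnegative, and its minimizer [- B / nm g ^+ 2] gives
    the inequality. Having the absolute value under the integral is what the Fubini bounds
    require. *)
Lemma CS_norm f g : L2 f -> L2 g -> I (fun x => `|f x * g x|) <= nm f * nm g.
Proof.
move=> hf hg; set B := I _.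
have B0 : 0 <= B by apply: I_ge0.
have key s : 0 <= nm f ^+ 2 + 2 * s * B + s ^+ 2 * nm g ^+ 2.
  have hs1 : summ (fun x => `|f x * g x|) by apply: summ_norm; exact: L2M.
  have := I_ge0 (f := fun x => f x ^+ 2 + (2 * s) * `|f x * g x| + s ^+ 2 * g x ^+ 2).
  rewrite !I_D; last 4 first.
  - exact: hf.2.
  - exact: summZ.
  - by apply: summD; [exact: hf.2|exact: summZ].
  - by apply: summZ; exact: hg.2.
  rewrite !I_Z//; last exact: hg.2.
  rewrite !nm_sqr; apply => x.
  rewrite (_ : _ + _ = (`|f x| + s * `|g x|) ^+ 2) ?sqr_ge0//.
  by rewrite sqrrD exprMn !real_normK ?num_real// normrM; ring.
have [g0|g0] := eqVneq (nm g) 0.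
  (* With [nm g = 0] the polynomial is affine in [s]; if [B] were positive, this [s] would give it
     the value [-1]. *)
  rewrite g0 mulr0 leNgt; apply/negP => Bp.
  have := key (- (nm f ^+ 2 + 1) / (2 * B)); rewrite g0.
  have -> : 2 * (- (nm f ^+ 2 + 1) / (2 * B)) * B = - (nm f ^+ 2 + 1).
    by field; rewrite gt_eqF.
  by rewrite expr0n/= mulr0; lra.
have gp : 0 < nm g by rewrite lt_neqAle eq_sym g0 nm_ge0.
have := key (- (B / nm g ^+ 2)).
have -> : nm f ^+ 2 + 2 * - (B / nm g ^+ 2) * B + (- (B / nm g ^+ 2)) ^+ 2 * nm g ^+ 2
  = nm f ^+ 2 - (B / nm g) ^+ 2 by field; rewrite gt_eqF.
rewrite subr_ge0 ler_pXn2r// ?nnegrE ?nm_ge0 ?divr_ge0 ?nm_ge0//.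
by rewrite ler_pdivrMr.
Qed.

Lemma CS f g : L2 f -> L2 g -> `|ip f g| <= nm f * nm g.
Proof.
by move=> hf hg; apply: le_trans (CS_norm hf hg); apply: I_norm; exact: L2M.
Qed.

Lemma nmD f g : L2 f -> L2 g -> nm (fun x => f x + g x) <= nm f + nm g.
Proof.
move=> hf hg; rewrite -(ler_pXn2r (n := 2))// ?nnegrE ?addr_ge0 ?nm_ge0//.
rewrite nm_sqr.
rewrite (_ : (fun x => _) = (fun x => f x ^+ 2 + g x ^+ 2 + 2 * (f x * g x))); last first.
  by apply/funext => x; ring.
rewrite !I_D ?I_Z//; last 5 first.
- exact: L2M.
- exact: hf.2.
- exact: hg.2.
- by apply: summD; [exact: hf.2|exact: hg.2].
- by apply: summZ; exact: L2M.
rewrite -!nm_sqr; have := CS hf hg; rewrite ler_norml /ip => /andP[_].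
by set i := I _; nra.
Qed.

Lemma nmB f g : L2 f -> L2 g -> nm (fun x => f x - g x) <= nm f + nm g.
Proof. by move=> hf hg; rewrite -[X in _ + X]nmN//; apply: nmD => //; exact: L2N. Qed.

Lemma ipDl f g h : L2 f -> L2 g -> L2 h -> ip (fun x => f x + g x) h = ip f h + ip g h.
Proof.
move=> hf hg hh; rewrite -I_D; try exact: L2M.
by apply: I_ext => x; rewrite mulrDl.
Qed.
Lemma ipBl f g h : L2 f -> L2 g -> L2 h -> ip (fun x => f x - g x) h = ip f h - ip g h.
Proof.
move=> hf hg hh; rewrite -I_B; try exact: L2M.
by apply: I_ext => x; rewrite mulrBl.
Qed.
Lemma ipZl c f h : L2 f -> L2 h -> ip (fun x => c * f x) h = c * ip f h.
Proof.
move=> hf hh; rewrite -I_Z; try exact: L2M.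
by apply: I_ext => x; rewrite mulrA.
Qed.
Lemma ipDr f g h : L2 f -> L2 g -> L2 h -> ip h (fun x => f x + g x) = ip h f + ip h g.
Proof. by move=> *; rewrite ipC ipDl// ![ip h _]ipC. Qed.
Lemma ipBr f g h : L2 f -> L2 g -> L2 h -> ip h (fun x => f x - g x) = ip h f - ip h g.
Proof. by move=> *; rewrite ipC ipBl// ![ip h _]ipC. Qed.

(* Pointwise bounds give a weak limit without any compactness: split the
   domain according to whether [|r x| <= K |w x|]. *)
Lemma weak_cvg (F : nat -> R -> R) f w M : (forall n, L2 (F n)) ->
  (forall n, nm (F n) <= M) -> L2 f -> L2 w ->
  {ae mu, forall x, F n x @[n --> \oo] --> f x} ->
  ip (F n) w @[n --> \oo] --> ip f w.
Proof.
move=> hF FM hf hw Ff; pose r n x := F n x - f x.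
have hr n : L2 (r n) by exact: L2B.
pose N := M + nm f.
have N0 : 0 <= N by rewrite addr_ge0 ?nm_ge0// (le_trans (nm_ge0 (F 0%N)) (FM 0%N)).
have rN n : nm (r n) <= N by apply: le_trans (nmB _ _) _ => //; rewrite lerD.
have mrw n : measurable_fun setT (fun x => `|r n x * w x|).
  by apply: measurable_norm; apply: measurable_funM; [exact: (hr n).1|exact: hw.1].
have cvgK (K : R) : 0 < K -> I (fun x => Num.min `|r n x * w x| (K * w x ^+ 2)) @[n --> \oo] --> 0.
  move=> K0; rewrite -[X in _ --> X](I_0 (R := R)).
  apply: (@dct_I _ _ _ (fun x => K * w x ^+ 2)).
  - move=> n; apply: measurable_minr => //.
    by apply: measurable_funM => //; exact: measurable_sqr hw.1.
  - exact: measurable_cst.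
  - apply: summZ; exact: hw.2.
  - apply: aeS Ff => x Fx.
    apply: (@squeeze_cvgr _ _ _ _ (cst 0) (fun n => `|r n x * w x|)).
    + apply: nearW => n; rewrite le_min normr_ge0/= mulr_ge0 ?sqr_ge0 ?(ltW K0)//=.
      by rewrite ge_min lexx.
    + exact: cvg_cst.
    + rewrite -(normr0 R); apply: cvg_norm; rewrite -(mul0r (w x)); apply: cvgMl.
      by rewrite -(subrr (f x)); apply: cvgB => //; exact: cvg_cst.
  - move=> n x; rewrite ger0_norm; first by rewrite ge_min lexx orbT.
    by rewrite le_min normr_ge0/= mulr_ge0 ?sqr_ge0 ?(ltW K0).
apply/cvgrPdist_le => e e0.
(* [K^-1 * N ^+ 2] must be at most [e / 2]; the [+ 1] keeps [K] positive when [N] vanishes. *)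
pose K := 2 * (N ^+ 2 + 1) / e.
have K0 : 0 < K by rewrite divr_gt0// mulr_gt0// ltr_pwDr// sqr_ge0.
have e2 : 0 < e / 2 by rewrite divr_gt0.
have /cvgrPdist_le /(_ _ e2) := cvgK K K0.
apply: filterS => n; rewrite sub0r normrN => hn.
rewrite distrC -ipBl//.
apply: le_trans (I_norm (L2M (hr n) hw)) _.
have : I (fun x => `|r n x * w x|) <=
  I (fun x => Num.min `|r n x * w x| (K * w x ^+ 2) + K^-1 * r n x ^+ 2).
  apply: I_le.
  - by apply: summ_norm; exact: L2M.
  - apply: summD; last by apply: summZ; exact: (hr n).2.
    apply: (@summ_dom _ (fun x => K * w x ^+ 2)).
    + apply: measurable_minr => //.
      by apply: measurable_funM => //; exact: measurable_sqr hw.1.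
    + move=> x; rewrite ger0_norm; first by rewrite ge_min lexx orbT.
      by rewrite le_min normr_ge0/= mulr_ge0 ?sqr_ge0 ?(ltW K0).
    + by apply: summZ; exact: hw.2.
  - move=> x; rewrite minElt; case: ifPn => [_|].
      by rewrite lerDl mulr_ge0 ?sqr_ge0// invr_ge0 ltW.
    rewrite -leNgt normrM => h.
    have : 0 <= K^-1 * (`|r n x| - K * `|w x|) ^+ 2.
      by rewrite mulr_ge0 ?sqr_ge0// invr_ge0 ltW.
    have -> : K^-1 * (`|r n x| - K * `|w x|) ^+ 2 =
      K^-1 * r n x ^+ 2 - 2 * (`|r n x| * `|w x|) + K * w x ^+ 2.
      rewrite -(real_normK (num_real (r n x))) -(real_normK (num_real (w x))).
      by field; rewrite gt_eqF.
    have := mulr_ge0 (normr_ge0 (r n x)) (normr_ge0 (w x)).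
    have : 0 <= K^-1 * r n x ^+ 2 by rewrite mulr_ge0 ?sqr_ge0// invr_ge0 ltW.
    by lra.
rewrite I_D; last 2 first.
- apply: (@summ_dom _ (fun x => K * w x ^+ 2)).
  + apply: measurable_minr => //.
    by apply: measurable_funM => //; exact: measurable_sqr hw.1.
  + move=> x; rewrite ger0_norm; first by rewrite ge_min lexx orbT.
    by rewrite le_min normr_ge0/= mulr_ge0 ?sqr_ge0 ?(ltW K0).
  + by apply: summZ; exact: hw.2.
- by apply: summZ; exact: (hr n).2.
rewrite I_Z; last exact: (hr n).2.
rewrite -nm_sqr => /le_trans; apply.
have h1 : K^-1 * nm (r n) ^+ 2 <= e / 2.
  rewrite /K invf_div mulrAC ler_pdivrMr; last by rewrite mulr_gt0// ltr_pwDr// sqr_ge0.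
  have : nm (r n) ^+ 2 <= N ^+ 2 by rewrite lerXn2r// nnegrE nm_ge0.
  by have := e0; nra.
have := le_trans (ler_norm _) hn; lra.
Qed.

End L2Theory.
#[global] Opaque summ.

(** * Absolutely continuous functions and H^1 *)

Section AbsCont.
Context {R : realType}.
Local Notation mu := (@lebesgue_measure R).
Local Notation I := (Rintegral mu setT).
Implicit Types (f g h u v w m F G : R -> R) (a b c s t x y z M e : R).

(** A factor under the integral sign, so that every integral stays on the whole line and shifts,
    Fubini and Cauchy-Schwarz apply to it directly. It vanishes identically if [b < a]. *)
Definition chi a b x : R := if (a <= x) && (x <= b) then 1 else 0.

Lemma chiE a b : chi a b = \1_(`[a, b]%classic : set R).
Proof.
by apply/funext => x; rewrite indicE /chi mem_setE in_itv/=; case: ifP.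
Qed.

Lemma measurable_chi a b : measurable_fun setT (chi a b).
Proof. by rewrite chiE; exact: measurable_indic. Qed.

Lemma chi_ge0 a b x : 0 <= chi a b x. Proof. by rewrite /chi; case: ifP. Qed.
Lemma chi_le1 a b x : `|chi a b x| <= 1.
Proof. by rewrite /chi; case: ifP => _; rewrite ?normr1 ?normr0. Qed.
Lemma chi_sqr a b x : chi a b x ^+ 2 = chi a b x.
Proof. by rewrite /chi; case: ifP => _; rewrite ?expr1n ?expr0n. Qed.
Lemma chi_in a b x : a <= x -> x <= b -> chi a b x = 1.
Proof. by rewrite /chi => -> ->. Qed.

Lemma I_chi a b f : I (fun x => chi a b x * f x) = \int[mu]_(x in `[a, b]) f x.
Proof.
rewrite Rintegral_mkcond; apply: I_ext => x; rewrite /patch mem_setE /chi in_itv/=.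
by case: ifP => _; rewrite ?mul1r ?mul0r.
Qed.

Lemma summ_chi a b : summ (chi a b).
Proof. by rewrite chiE; exact: integrable_indic_itv. Qed.

Lemma L2_chi a b : L2 (chi a b).
Proof.
split; first exact: measurable_chi.
rewrite (_ : (fun x => _) = chi a b); first exact: summ_chi.
by apply/funext => x; rewrite chi_sqr.
Qed.

Lemma summ_chi_mul a b f : L2 f -> summ (fun x => chi a b x * f x).
Proof. by move=> hf; apply: L2M => //; exact: L2_chi. Qed.

Lemma summ_bmul m M f : measurable_fun setT m -> (forall x, `|m x| <= M) ->
  summ f -> summ (fun x => m x * f x).
Proof.
move=> mm mM sf; apply: (@summ_scale_dom _ _ f M) => //.
  by apply: measurable_funM => //; exact: summ_mf.
by move=> x; rewrite normrM ler_wpM2r.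
Qed.

(** The fundamental theorem of calculus, taken as the definition of local absolute continuity: in
    this form it passes easily through shifts, linear combinations and, by Fubini, products. *)
Definition abscont F f := forall a b, a <= b ->
  summ (fun x => chi a b x * f x) /\ F b - F a = I (fun x => chi a b x * f x).

Lemma AC_C1 F f : (forall x, is_derive x 1 F (f x)) -> continuous f -> abscont F f.
Proof.
move=> dF cf a b ab; split.
  have h : mu.-integrable `[a, b] (EFin \o f).
    by apply: continuous_compact_integrable; [exact: segment_compact|exact: continuous_subspaceT].
  have {h} := (@integrable_mkcond _ (measurableTypeR R) R mu `[a, b]%classic (EFin \o f) (measurable_itv _)).1 h.
  apply: eq_integrable => // x _; rewrite /patch mem_setE /chi in_itv/=.
  by case: ifP => _; rewrite ?mul1r ?mul0r.
move: ab; rewrite I_chi le_eqVlt => /predU1P[->|ab].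
  by rewrite subrr set_itv1 Rintegral_set1.
rewrite /Rintegral (@continuous_FTC2 _ f F)//.
- exact: continuous_subspaceT.
- split.
  + by move=> x _; exact: ex_derive.
  + apply: cvg_at_right_filter; apply: differentiable_continuous.
    by apply/derivable1_diffP; exact: ex_derive.
  + apply: cvg_at_left_filter; apply: differentiable_continuous.
    by apply/derivable1_diffP; exact: ex_derive.
- by move=> x _; rewrite derive1E derive_val.
Qed.

Lemma I_chi1 a b : a <= b -> I (chi a b) = b - a.
Proof.
move=> ab; have c1 : continuous (fun _ : R => 1 : R) by move=> x; exact: cvg_cst.
have [_ ->] := @AC_C1 id (fun=> 1) (fun x => is_derive_id x 1) c1 a b ab.
by apply: I_ext => x; rewrite mulr1.
Qed.

Lemma nm_chi a b : a <= b -> nm (chi a b) = Num.sqrt (b - a).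
Proof.
move=> ab; rewrite /nm -(I_chi1 ab); congr Num.sqrt.
by apply: I_ext => x; rewrite chi_sqr.
Qed.

Lemma AC_ext F G f g : (forall x, F x = G x) -> (forall x, f x = g x) -> abscont F f -> abscont G g.
Proof. by move=> /funext -> /funext ->. Qed.

Lemma ACD F G f g : abscont F f -> abscont G g -> abscont (fun x => F x + G x) (fun x => f x + g x).
Proof.
move=> hF hG a b ab; have [sf eF] := hF _ _ ab; have [sg eG] := hG _ _ ab.
have -> : (fun x => chi a b x * (f x + g x)) = (fun x => chi a b x * f x + chi a b x * g x).
  by apply/funext => x; rewrite mulrDr.
by split; [exact: summD|rewrite I_D// -eF -eG; ring].
Qed.

Lemma ACZ c F f : abscont F f -> abscont (fun x => c * F x) (fun x => c * f x).
Proof.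
move=> hF a b ab; have [sf eF] := hF _ _ ab.
have -> : (fun x => chi a b x * (c * f x)) = (fun x => c * (chi a b x * f x)).
  by apply/funext => x; ring.
by split; [exact: summZ|rewrite I_Z// -eF -mulrBr].
Qed.

Lemma AC_shift s F f : measurable_fun setT f -> abscont F f ->
  abscont (fun x => F (x + s)) (fun x => f (x + s)).
Proof.
move=> mf hF a b ab.
have [sf eF] := hF (a + s) (b + s) (lerD ab (lexx _)).
have E : (fun x => chi a b x * f (x + s)) =
    (fun x => (fun y => chi (a + s) (b + s) y * f y) (x + s)).
  by apply/funext => x; rewrite /chi !lerD2r.
rewrite E; split; first exact: (summ_shift s sf).
rewrite eF (I_shift s (f := (fun y => chi (a + s) (b + s) y * f y)))//.
exact: summ_mf.
Qed.

Lemma AC_bound F f a b : abscont F f -> a <= b -> exists M, 0 <= M /\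
  forall x, `|chi a b x * F x| <= M.
Proof.
move=> hF ab; exists (`|F a| + I (fun x => `|chi a b x * f x|)).
split; first by rewrite addr_ge0//; apply: I_ge0.
move=> x; rewrite /chi; case: ifP => [/andP[ax xb]|_]; last first.
  by rewrite mul0r normr0 addr_ge0//; apply: I_ge0.
rewrite mul1r -[X in `|X|](subrK (F a)) addrC.
apply: le_trans (ler_normD _ _) _; rewrite lerD2l.
have [sf ->] := hF _ _ ax; apply: I_dom; first exact: summ_mf.
  move=> y; rewrite !normrM ler_wpM2r//.
  rewrite (ger0_norm (chi_ge0 _ _ _)) (ger0_norm (chi_ge0 _ _ _)) /chi.
  case: (a <= y) => //=; case: (leP y x) => [yx|_]; last by case: ifP.
  by rewrite (le_trans yx xb).
by apply: summ_norm; have [] := hF _ _ ab.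
Qed.

(** Fubini on the triangle [x <= y] for [f x * g y]: integrating in [y] first gives
    [f x * (G b - G x)], in [x] first [g y * (F y - F a)], and equating the two is the product
    rule. *)
Lemma ACM F G f g : measurable_fun setT F -> measurable_fun setT G ->
  measurable_fun setT f -> measurable_fun setT g -> abscont F f -> abscont G g ->
  abscont (fun x => F x * G x) (fun x => f x * G x + F x * g x).
Proof.
move=> mF mG mf mg hF hG a b ab.
have [sf eF] := hF _ _ ab; have [sg eG] := hG _ _ ab.
have [MF [MF0 bF]] := AC_bound hF ab; have [MG [MG0 bG]] := AC_bound hG ab.
have sfG : summ (fun x => chi a b x * f x * G x).
  apply: (@summ_scale_dom _ _ (fun x => chi a b x * f x) MG) => //.
    by do 2 (apply: measurable_funM => //); exact: measurable_chi.
  move=> x; rewrite (_ : _ * G x = chi a b x * G x * (chi a b x * f x)).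
    by rewrite normrM ler_wpM2r.
  by rewrite -[in LHS]chi_sqr; ring.
have sgF : summ (fun x => chi a b x * g x * F x).
  apply: (@summ_scale_dom _ _ (fun x => chi a b x * g x) MF) => //.
    by do 2 (apply: measurable_funM => //); exact: measurable_chi.
  move=> x; rewrite (_ : _ * F x = chi a b x * F x * (chi a b x * g x)).
    by rewrite normrM ler_wpM2r.
  by rewrite -[in LHS]chi_sqr; ring.
have E : (fun x => chi a b x * (f x * G x + F x * g x)) =
  (fun x => chi a b x * f x * G x + chi a b x * g x * F x).
  by apply/funext => x; ring.
rewrite E; split; first exact: summD.
rewrite I_D//.
pose K x y := chi a b x * f x * (chi a b y * g y) * (if x <= y then 1 else 0).
have mK : measurable_fun setT (fun p : R * R => K p.1 p.2).
  have m1 (k : R -> R) : measurable_fun setT k -> measurable_fun setT (fun p : R * R => k p.1).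
    by move=> mk; exact: (measurableT_comp mk measurable_fst).
  have m2 (k : R -> R) : measurable_fun setT k -> measurable_fun setT (fun p : R * R => k p.2).
    by move=> mk; exact: (measurableT_comp mk measurable_snd).
  apply: measurable_funM.
    apply: measurable_funM; first exact: m1 (summ_mf sf).
    exact: m2 (summ_mf sg).
  apply: measurable_fun_if => //.
  by apply: measurable_fun_ler; [exact: measurable_fst|exact: measurable_snd].
have Kle x y : `|K x y| <= `|chi a b x * f x| * `|chi a b y * g y|.
  by rewrite /K; case: ifP => _; rewrite ?mulr1 ?mulr0 ?normrM ?normr0// mulr_ge0.
have sK x : summ (K x).
  apply: (@summ_scale_dom _ _ (fun y => chi a b y * g y) `|chi a b x * f x|) => //.
  exact: (measurableT_comp mK (measurable_pair1 x)).
have Kb x : I (fun y => `|K x y|) <=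
    I (fun y => `|chi a b y * g y|) * `|chi a b x * f x|.
  rewrite mulrC -I_Z; last exact: summ_norm.
  by apply: I_le => //; [exact: summ_norm|apply: summZ; exact: summ_norm].
have [_ _ _] := fubini_I mK sK Kb (summZ _ (summ_norm sf)).
have -> : (fun x => I (K x)) = (fun x => G b * (chi a b x * f x) - chi a b x * f x * G x).
  apply/funext => x; rewrite /K /chi; case: ifP => [/andP[ax xb]|_]; last first.
    rewrite (_ : (fun y => _) = fun=> 0) ?I_0; first by rewrite !mul0r mulr0 subrr.
    by apply/funext => y; rewrite !mul0r.
  have [sgx eGx] := hG _ _ xb.
  rewrite !mul1r -[f x * G x]mulrC -mulrBl eGx mulrC -I_Z//; apply: I_ext => y.
  rewrite /chi; case: (leP x y) => xy /=; last by rewrite mulr0 mul0r mulr0.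
  by rewrite (le_trans ax xy) /= mulr1.
have -> : (fun y => I (K^~ y)) = (fun y => chi a b y * g y * F y - F a * (chi a b y * g y)).
  apply/funext => y; have [/andP[ay yb]|nab] := boolP (a <= y <= b); last first.
    have cy : chi a b y = 0 by rewrite /chi (negbTE nab).
    rewrite /K cy !mul0r mulr0 subrr -[RHS](I_0 (R := R)); apply: I_ext => z.
    by rewrite mulr0 mul0r.
  rewrite /K (chi_in ay yb).
  have [sfy eFy] := hF _ _ ay.
  rewrite !mul1r [g y * F y]mulrC -mulrBl eFy mulrC -I_Z//; apply: I_ext => x.
  rewrite /chi; case: (leP x y) => xy /=; last by rewrite andbF mulr0 mul0r mulr0.
  by rewrite (le_trans xy yb) /= andbT mulr1; ring.
rewrite !I_B//; try exact: summZ.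
rewrite !I_Z// -eF -eG; lra.
Qed.

Lemma L2_mf f : L2 f -> measurable_fun setT f. Proof. by case. Qed.

(* [v] is the absolutely continuous representative and [dv] its density, a fixed Borel function. *)
Definition H1 v dv := [/\ L2 v, L2 dv & abscont v dv].

Lemma chi_cvg f x : chi (- n%:R) n%:R x * f x @[n --> \oo] --> f x.
Proof.
apply: cvg_near_cst; near=> n; rewrite chi_in ?mul1r//.
  by rewrite lerNl (le_trans (ler_norm _))// normrN; near: n; exact: nbhs_infty_ger.
by rewrite (le_trans (ler_norm _))//; near: n; exact: nbhs_infty_ger.
Unshelve. all: by end_near. Qed.

Lemma I_chi_cvg f : summ f -> I (fun x => chi (- n%:R) n%:R x * f x) @[n --> \oo] --> I f.
Proof.
move=> sf; apply: (@dct_I _ _ _ (fun x => `|f x|)).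
- by move=> n; apply: measurable_funM; [exact: measurable_chi|exact: summ_mf].
- exact: summ_mf.
- exact: summ_norm.
- by apply: aeW => x; exact: chi_cvg.
- by move=> n x; rewrite normrM ler_piMl// chi_le1.
Qed.

Lemma AC_integral F f l1 l2 : abscont F f -> summ f ->
  F n%:R @[n --> \oo] --> l1 -> F (- n%:R) @[n --> \oo] --> l2 -> I f = l1 - l2.
Proof.
move=> hF sf F1 F2; apply/eqP; rewrite eq_sym; apply/eqP.
apply: (cvg_unique _ (cvgB F1 F2)) => //.
have -> : (fun n : nat => F n%:R) - (fun n : nat => F (- n%:R)) =
  (fun n => I (fun x => chi (- n%:R) n%:R x * f x)).
  apply/funext => n; have [|_ <-//] := hF (- n%:R) n%:R.
  by rewrite (@le_trans _ _ 0)// oppr_le0.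
exact: I_chi_cvg.
Qed.

Lemma AC_summ_ge0 F f M : abscont F f -> measurable_fun setT f -> (forall x, 0 <= f x) ->
  (forall x, `|F x| <= M) -> summ f.
Proof.
move=> hF mf f0 FM.
have h n := hF (- n%:R) n%:R (le_trans (eqbRL (oppr_le0 _) (ler0n R n)) (ler0n R n)).
have [] := @fatou_I _ (fun n x => chi (- n%:R) n%:R x * f x) f (M + M) => //.
- by move=> n; have [] := h n.
- by move=> n x; rewrite mulr_ge0// chi_ge0.
- move=> n; have [_ <-] := h n; rewrite (le_trans (ler_norm _))//.
  by rewrite (le_trans (ler_normB _ _))// lerD.
- by apply: aeW => x; exact: chi_cvg.
Qed.

Lemma H1_incr v dv x y : H1 v dv -> `|v y - v x| <= Num.sqrt `|y - x| * nm dv.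
Proof.
move=> [hv hdv ac]; wlog xy : x y / x <= y.
  move=> H; have [/H//|/ltW/H] := leP x y.
  by rewrite distrC [`|x - y|]distrC.
have [_ ->] := ac _ _ xy; rewrite (ger0_norm (_ : 0 <= y - x)) ?subr_ge0//.
by rewrite -nm_chi//; apply: CS => //; exact: L2_chi.
Qed.

(** Average over [y] in the unit window the bound of |v x| by |v y| plus the increment from [x] to
    [y]. Only the norms on that window enter, so decay at infinity follows as well as
    boundedness. *)
Lemma H1_loc v dv x : H1 v dv ->
  `|v x| <= nm (fun y => chi x (x + 1) y * v y) + nm (fun y => chi x (x + 1) y * dv y).
Proof.
move=> [hv hdv ac]; have x1 : x <= x + 1 by rewrite lerDl.
set A := nm _; set B := nm _.
have hc := L2_chi x (x + 1).
have hcv : L2 (fun y => chi x (x + 1) y * v y).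
  exact: L2_bmul (measurable_chi _ _) (chi_le1 _ _) hv.
have hcdv : L2 (fun y => chi x (x + 1) y * dv y).
  exact: L2_bmul (measurable_chi _ _) (chi_le1 _ _) hdv.
have nc1 : nm (chi x (x + 1)) = 1 by rewrite nm_chi// addrC addKr sqrtr1.
have key y : chi x (x + 1) y * `|v x| <= `|chi x (x + 1) y * v y| + chi x (x + 1) y * B.
  rewrite /chi; case: ifP => [/andP[xy yx]|_]; last by rewrite !mul0r normr0 addr0.
  rewrite !mul1r -[X in `|X| <= _](subrK (v y)) addrC.
  apply: le_trans (ler_normD _ _) _; rewrite lerD2l distrC.
  have [_ ->] := ac _ _ xy.
  rewrite (_ : I _ = ip (chi x y) (fun z => chi x (x + 1) z * dv z)).
    apply: le_trans (CS (L2_chi _ _) hcdv) _.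
    rewrite -[leRHS]mul1r ler_wpM2r ?nm_ge0// nm_chi// -[leRHS]sqrtr1 ler_wsqrtr//.
    by rewrite lerBlDl.
  apply: I_ext => z; rewrite mulrA; congr (_ * _); rewrite /chi.
  case: (x <= z) => //=; last by rewrite mul0r.
  by case: (leP z y) => zy; rewrite ?mul0r// (le_trans zy yx) mul1r.
have := @I_le _ (fun y => `|v x| * chi x (x + 1) y)
  (fun y => `|chi x (x + 1) y * v y| + B * chi x (x + 1) y).
have s1 := summ_chi x (x + 1).
have s2 : summ (fun y => `|chi x (x + 1) y * v y|) by apply: summ_norm; exact: summ_chi_mul.
move=> /(_ (summZ _ s1) (summD s2 (summZ _ s1))).
rewrite I_D//; last exact: summZ.
rewrite !I_Z// I_chi1// addrAC subrr add0r !mulr1 => H.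
apply: le_trans (H _) _; first by move=> y; rewrite mulrC [B * _]mulrC.
rewrite lerD2r (_ : I _ = I (fun y => `|chi x (x + 1) y * (chi x (x + 1) y * v y)|)).
  by apply: le_trans (CS_norm hc hcv) _; rewrite nc1 mul1r.
by apply: I_ext => y; rewrite mulrA -expr2 chi_sqr.
Qed.

Lemma H1_sup v dv x : H1 v dv -> `|v x| <= nm v + nm dv.
Proof.
move=> h; apply: le_trans (H1_loc x h) _; case: h => hv hdv _.
have H f : L2 f -> nm (fun y => chi x (x + 1) y * f y) <= nm f.
  move=> hf; rewrite -[leRHS]mul1r; apply: nm_bmul => //; first exact: measurable_chi.
  exact: chi_le1.
by apply: lerD; exact: H.
Qed.

(** Quantified over all [g] dominated by [f], so that one [M] serves every unit window in
    [H1_vanish] and the truncation in [L2_approx]. *)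
Lemma nm_tail f e : L2 f -> 0 < e -> exists M, 0 < M /\
  forall g, L2 g -> (forall x, `|g x| <= `|f x|) -> (forall x, `|x| <= M -> g x = 0) ->
  nm g <= e.
Proof.
move=> [mf sf] e0.
have /cvgrPdist_le /(_ _ (exprn_gt0 2 e0)) [n _ hn] := I_chi_cvg sf.
exists n.+1%:R; split; first by rewrite ltr0n.
move=> g hg gf g0; rewrite -(ler_pXn2r (n := 2))// ?nnegrE ?nm_ge0 ?(ltW e0)//.
rewrite nm_sqr; apply: le_trans (hn n.+1 _) => //=.
apply: le_trans (ler_norm _); rewrite -I_B//; last first.
  apply: summ_bmul sf; [exact: measurable_chi|exact: chi_le1].
apply: I_le; first exact: hg.2.
  by apply: summB => //; apply: summ_bmul sf; [exact: measurable_chi|exact: chi_le1].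
move=> x; rewrite /chi; case: ifP => [/andP[x1 x2]|_].
  by rewrite mul1r subrr g0 ?expr0n// ler_norml x1.
rewrite mul0r subr0 -(real_normK (num_real (g x))) -(real_normK (num_real (f x))).
by rewrite lerXn2r// nnegrE.
Qed.

Lemma H1_vanish v dv e : H1 v dv -> 0 < e -> exists M, 0 < M /\
  forall x, M <= `|x| -> `|v x| <= e.
Proof.
move=> h e0; have [hv hdv _] := h.
have e2 : 0 < e / 2 by rewrite divr_gt0.
have [M1 [M10 H1']] := nm_tail hv e2; have [M2 [M20 H2]] := nm_tail hdv e2.
(* The whole window [[x, x + 1]] has to miss both [[-M1, M1]] and [[-M2, M2]], also for negative
   [x]; the additive constant leaves room for its length. *)
exists (M1 + M2 + 2); split; first by rewrite ltr_wpDr// addr_gt0.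
move=> x Mx; apply: le_trans (H1_loc x h) _.
rewrite [leRHS]splitr; apply: lerD; [apply: H1'|apply: H2].
1,4: exact: L2_bmul (measurable_chi _ _) (chi_le1 _ _) _.
1,3: by move=> y; rewrite normrM ler_piMl// chi_le1.
all: move=> y yM; rewrite /chi; case: ifP => [/andP[]|]; rewrite ?mul0r// => xy yx; exfalso;
  move: Mx; rewrite leNgt => /negP; apply; move: yM; rewrite ler_norml => /andP[? ?];
  rewrite ltr_norml; apply/andP; split; lra.
Qed.

Lemma H1_cvg v dv : H1 v dv ->
  v n%:R @[n --> \oo] --> 0 /\ v (- n%:R) @[n --> \oo] --> 0.
Proof.
move=> h; split; apply/cvgrPdist_le => e e0; have [M [M0 HM]] := H1_vanish h e0.
  near=> n; rewrite sub0r normrN; apply: HM.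
  by rewrite normr_nat; near: n; exact: nbhs_infty_ger.
near=> n; rewrite sub0r normrN; apply: HM.
by rewrite normrN normr_nat; near: n; exact: nbhs_infty_ger.
Unshelve. all: by end_near. Qed.

Lemma H1_ibp v dv w dw : H1 v dv -> H1 w dw -> ip dv w = - ip v dw.
Proof.
move=> hv hw; have [lv ldv av] := hv; have [lw ldw aw] := hw.
have A := ACM (L2_mf lv) (L2_mf lw) (L2_mf ldv) (L2_mf ldw) av aw.
have s1 := L2M ldv lw; have s2 := L2M lv ldw.
have [v1 v2] := H1_cvg hv; have [w1 w2] := H1_cvg hw.
have : I (fun x => dv x * w x + v x * dw x) = 0 * 0 - 0 * 0.
  by apply: (AC_integral A (summD s1 s2)); apply: cvgM.
rewrite I_D// mulr0 subrr => /eqP; by rewrite addr_eq0 => /eqP.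
Qed.

Lemma H1_int0 v dv : H1 v dv -> summ dv -> I dv = 0.
Proof.
move=> hv sdv; have [_ _ av] := hv; have [v1 v2] := H1_cvg hv.
by rewrite (AC_integral av sdv v1 v2) subrr.
Qed.

Lemma H1D u du v dv : H1 u du -> H1 v dv ->
  H1 (fun x => u x + v x) (fun x => du x + dv x).
Proof. by move=> [? ? ?] [? ? ?]; split; [exact: L2D|exact: L2D|exact: ACD]. Qed.

Lemma H1Z c v dv : H1 v dv -> H1 (fun x => c * v x) (fun x => c * dv x).
Proof. by move=> [? ? ?]; split; [exact: L2Z|exact: L2Z|exact: ACZ]. Qed.

Lemma H1_shift s v dv : H1 v dv -> H1 (fun x => v (x + s)) (fun x => dv (x + s)).
Proof.
move=> [hv hdv ac]; split; [exact: L2_shift|exact: L2_shift|].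
by apply: AC_shift => //; exact: L2_mf.
Qed.

Lemma H1_ext u du v dv : (forall x, u x = v x) -> (forall x, du x = dv x) ->
  H1 u du -> H1 v dv.
Proof. by move=> /funext -> /funext ->. Qed.

Lemma H1_mul m dm M v dv : abscont m dm -> measurable_fun setT m -> measurable_fun setT dm ->
  (forall x, `|m x| <= M) -> (forall x, `|dm x| <= M) -> H1 v dv ->
  H1 (fun x => m x * v x) (fun x => dm x * v x + m x * dv x).
Proof.
move=> am mm mdm bm bdm [hv hdv av]; split.
- exact: L2_bmul bm hv.
- by apply: L2D; [exact: L2_bmul bdm hv|exact: L2_bmul bm hdv].
- by apply: ACM => //; exact: L2_mf.
Qed.

End AbsCont.

(** * The conjugate Poisson kernel *)

Section Calculus.
Context {R : realType}.
Implicit Types (f g : R -> R) (x c d df dg : R).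

Lemma contC c : continuous (fun _ : R => c). Proof. by move=> x; exact: cvg_cst. Qed.
Lemma cont_id : continuous (fun x : R => x). Proof. by move=> x; exact: cvg_id. Qed.
Lemma contD f g : continuous f -> continuous g -> continuous (fun x => f x + g x).
Proof. by move=> cf cg x; apply: cvgD; [exact: cf|exact: cg]. Qed.
Lemma contN f : continuous f -> continuous (fun x => - f x).
Proof. by move=> cf x; apply: cvgN; exact: cf. Qed.
Lemma contB f g : continuous f -> continuous g -> continuous (fun x => f x - g x).
Proof. by move=> cf cg; exact/contD/contN. Qed.
Lemma contM f g : continuous f -> continuous g -> continuous (fun x => f x * g x).
Proof. by move=> cf cg x; apply: cvgM; [exact: cf|exact: cg]. Qed.
Lemma contX n f : continuous f -> continuous (fun x => f x ^+ n).
Proof.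
move=> cf; elim: n => [|n IH].
  by rewrite (_ : (fun x => _) = fun=> 1); [exact: contC|apply/funext => x; rewrite expr0].
rewrite (_ : (fun x => _) = fun x => f x * f x ^+ n); first exact: contM.
by apply/funext => x; rewrite exprS.
Qed.
Lemma contV f : (forall x, f x != 0) -> continuous f -> continuous (fun x => (f x)^-1).
Proof. by move=> f0 cf x; apply: cvgV; [exact: f0|exact: cf]. Qed.

Lemma derC c x : is_derive x 1 (fun _ : R => c) 0. Proof. exact: is_derive_cst. Qed.
Lemma der_id x : is_derive x 1 (fun x : R => x) 1. Proof. exact: is_derive_id. Qed.
Lemma derD f g x df dg : is_derive x 1 f df -> is_derive x 1 g dg ->
  is_derive x 1 (fun x => f x + g x) (df + dg).
Proof. by move=> hf hg; exact: is_deriveD. Qed.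
Lemma derN f x df : is_derive x 1 f df -> is_derive x 1 (fun x => - f x) (- df).
Proof. by move=> hf; exact: is_deriveN. Qed.
Lemma der_eq f x d df : is_derive x 1 f d -> d = df -> is_derive x 1 f df.
Proof. by move=> hf <-. Qed.
Lemma derB f g x df dg : is_derive x 1 f df -> is_derive x 1 g dg ->
  is_derive x 1 (fun x => f x - g x) (df - dg).
Proof. by move=> hf hg; exact: derD hf (derN hg). Qed.
Lemma derM f g x df dg : is_derive x 1 f df -> is_derive x 1 g dg ->
  is_derive x 1 (fun x => f x * g x) (df * g x + f x * dg).
Proof.
move=> hf hg; have h := is_deriveM hf hg.
by apply: (der_eq h); rewrite addrC; congr (_ + _); rewrite mulrC.
Qed.
Lemma derX n f x df : is_derive x 1 f df ->
  is_derive x 1 (fun x => f x ^+ n.+1) (n.+1%:R * f x ^+ n * df).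
Proof.
move=> hf; elim: n => [|n IH].
  apply: (der_eq hf); first by rewrite expr0; ring.
rewrite (_ : (fun x => _) = (fun x => f x * f x ^+ n.+1)); last by apply/funext => y; rewrite exprS.
by apply: (der_eq (derM hf IH)); rewrite -(natr1 n.+1) exprS; ring.
Qed.
Lemma derV f x df : f x != 0 -> is_derive x 1 f df ->
  is_derive x 1 (fun x => (f x)^-1) (- (f x) ^- 2 * df).
Proof. by move=> f0 hf; exact: is_deriveV. Qed.
Lemma der_comp f g x df dg : is_derive (g x) 1 f df -> is_derive x 1 g dg ->
  is_derive x 1 (fun x => f (g x)) (df * dg).
Proof. by move=> hf hg; exact: (is_derive1_comp hf hg). Qed.
Lemma der_cont f (f' : R -> R) : (forall x, is_derive x 1 f (f' x)) -> continuous f.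
Proof.
move=> hf x; apply: differentiable_continuous; apply/derivable1_diffP.
exact: ex_derive.
Qed.

End Calculus.

Ltac cont_tac := cbv beta; lazymatch goal with
  | |- continuous (fun _ => ?c) => exact (@contC _ c)
  | |- continuous (fun x => x) => exact (@cont_id _)
  | |- continuous (fun x => (@?f x + - @?g x)%R) => apply (@contB _ f g); cont_tac
  | |- continuous (fun x => (@?f x + @?g x)%R) => apply (@contD _ f g); cont_tac
  | |- continuous (fun x => (- @?f x)%R) => apply (@contN _ f); cont_tac
  | |- continuous (fun x => (@?f x * @?g x)%R) => apply (@contM _ f g); cont_tac
  | |- continuous (fun x => (@?f x ^+ ?n)%R) => apply (@contX _ n f); cont_tac
  | |- continuous (fun x => ((@?f x)^-1)%R) => apply (@contV _ f); [|cont_tac]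
  | |- _ => idtac
  end.
Ltac der_tac := lazymatch goal with
  | |- is_derive ?y _ (fun _ => ?c) _ => exact (@derC _ c y)
  | |- is_derive ?y _ (fun x => x) _ => exact (@der_id _ y)
  | |- is_derive ?y _ (fun x => (@?f x + - @?g x)%R) _ => notypeclasses refine (@derB _ f g y _ _ _ _); cbv beta; der_tac
  | |- is_derive ?y _ (fun x => (@?f x + @?g x)%R) _ => notypeclasses refine (@derD _ f g y _ _ _ _); cbv beta; der_tac
  | |- is_derive ?y _ (fun x => (- @?f x)%R) _ => notypeclasses refine (@derN _ f y _ _); cbv beta; der_tac
  | |- is_derive ?y _ (fun x => (@?f x * @?g x)%R) _ => notypeclasses refine (@derM _ f g y _ _ _ _); cbv beta; der_tac
  | |- is_derive ?y _ (fun x => (@?f x ^+ ?n.+1)%R) _ => notypeclasses refine (@derX _ n f y _ _); cbv beta; der_tac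
  | |- is_derive ?y _ (fun x => ((@?f x)^-1)%R) _ => notypeclasses refine (@derV _ f y _ _ _); cbv beta; [|der_tac]
  | |- _ => idtac
  end.

Section Kernels.
Context {R : realType}.
Local Notation mu := (@lebesgue_measure R).
Local Notation I := (Rintegral mu setT).
Implicit Types (f g h u v w m F G : R -> R) (a b c s t x y z M e : R).

(** In the convention of [cv], convolution with [qk t] has Fourier symbol [i sgn(xi) exp(-t|xi|)]
    and convolution with [Pk t] has symbol [exp(-t|xi|)]. *)
Definition qk t z : R := pi^-1 * (z / (z ^+ 2 + t ^+ 2)).
Definition Pk t z : R := pi^-1 * (t / (z ^+ 2 + t ^+ 2)).
Definition dq t z : R := pi^-1 * ((t ^+ 2 - z ^+ 2) / (z ^+ 2 + t ^+ 2) ^+ 2).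
(** The defect [1 - pi * z * qk t z] of the regularized kernel from [1 / (pi z)]; every
    regularization error in the commutators is a convolution with it. *)
Definition sk t z : R := t ^+ 2 / (z ^+ 2 + t ^+ 2).

Lemma den_gt0 t z : 0 < t -> 0 < z ^+ 2 + t ^+ 2.
Proof. by move=> t0; rewrite ltr_wpDl ?sqr_ge0// exprn_gt0. Qed.
Lemma den_neq0 t z : 0 < t -> z ^+ 2 + t ^+ 2 != 0.
Proof. by move=> t0; rewrite gt_eqF// den_gt0. Qed.
Lemma pi_neq0 : (pi : R) != 0. Proof. by rewrite gt_eqF// pi_gt0. Qed.
Lemma piV_gt0 : 0 < (pi : R)^-1. Proof. by rewrite invr_gt0 pi_gt0. Qed.

Lemma cont_den t : continuous (fun z : R => z ^+ 2 + t ^+ 2).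
Proof. by cont_tac. Qed.
Lemma der_den t z : is_derive z 1 (fun z : R => z ^+ 2 + t ^+ 2) (2 * z).
Proof. by eapply der_eq; [der_tac|rewrite /= ?expr1; ring]. Qed.

Lemma cont_Pk t : 0 < t -> continuous (Pk t).
Proof. by move=> t0; rewrite /Pk; cont_tac => // x; exact: den_neq0. Qed.
Lemma cont_qk t : 0 < t -> continuous (qk t).
Proof. by move=> t0; rewrite /qk; cont_tac => // x; exact: den_neq0. Qed.
Lemma cont_sk t : 0 < t -> continuous (sk t).
Proof. by move=> t0; rewrite /sk; cont_tac => // x; exact: den_neq0. Qed.
Lemma cont_dq t : 0 < t -> continuous (dq t).
Proof. by move=> t0; rewrite /dq; cont_tac => // x; rewrite expf_neq0// den_neq0. Qed.

Lemma measurable_Pk t : 0 < t -> measurable_fun setT (Pk t).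
Proof. by move=> t0; apply: continuous_measurable_fun; exact: cont_Pk. Qed.
Lemma measurable_qk t : 0 < t -> measurable_fun setT (qk t).
Proof. by move=> t0; apply: continuous_measurable_fun; exact: cont_qk. Qed.

Lemma der_qk t z : 0 < t -> is_derive z 1 (qk t) (dq t z).
Proof.
move=> t0; have d0 := den_neq0 z t0; rewrite /qk; eapply der_eq; first by der_tac.
rewrite /dq /= ?expr1; move: pi_neq0; move: (@pi R) => p p0; 
by field; rewrite d0 p0.
Qed.

Lemma AC_qk t : 0 < t -> abscont (qk t) (dq t).
Proof. by move=> t0; apply: AC_C1; [move=> z; exact: der_qk|exact: cont_dq]. Qed.

Lemma der_atan s t x : is_derive x 1 (fun z => atan ((z - s) / t)) ((1 + ((x - s) / t) ^+ 2)^-1 * t^-1).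
Proof.
have h1 := is_derive1_atan ((x - s) / t).
have h2 : is_derive x 1 (fun z => (z - s) / t) t^-1.
  by eapply der_eq; [der_tac|rewrite /= ?expr1; ring].
exact: (@der_comp _ atan (fun z => (z - s) / t) _ _ _ h1 h2).
Qed.

Lemma AC_Pk t : 0 < t -> abscont (fun z => pi^-1 * atan ((z - 0) / t)) (Pk t).
Proof.
move=> t0; apply: AC_C1; last exact: cont_Pk.
move=> z; apply: (der_eq (derM (derC _ _) (der_atan _ _ _))).
have h := den_neq0 z t0; have h' : t != 0 by rewrite gt_eqF.
rewrite subr0 /Pk mul0r add0r; move: pi_neq0; move: (@pi R) => p p0; 
by field; rewrite p0 h h'.
Qed.

Lemma Pk_ge0 t z : 0 < t -> 0 <= Pk t z.
Proof.
move=> t0; rewrite mulr_ge0 ?invr_ge0 ?pi_ge0// divr_ge0 ?ltW// den_gt0//.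
Qed.

Lemma atan_bnd x : `|atan x| <= pi / 2 :> R.
Proof. by rewrite ler_norml; apply/andP; split; rewrite ltW ?atan_ltpi2 ?atan_gtNpi2. Qed.

Lemma summ_Pk t : 0 < t -> summ (Pk t).
Proof.
move=> t0; apply: (AC_summ_ge0 (AC_Pk t0) (M := pi^-1 * (pi / 2))).
- exact: measurable_Pk.
- by move=> z; exact: Pk_ge0.
- move=> z; rewrite normrM ger0_norm ?ler_wpM2l ?atan_bnd ?invr_ge0 ?pi_ge0//.
Qed.

Lemma cvgn_affine s t : 0 < t -> (n%:R - s) / t @[n --> \oo] --> +oo.
Proof.
move=> t0; apply/cvgryPge => M; near=> n.
rewrite ler_pdivlMr// lerBrDr; near: n; exact: nbhs_infty_ger.
Unshelve. all: by end_near. Qed.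

Lemma cvgn_atan s t : 0 < t -> atan ((n%:R - s) / t) @[n --> \oo] --> (pi / 2 : R).
Proof. by move=> t0; exact: (cvg_comp _ _ (cvgn_affine s t0) (cvgy_atan (R := R))). Qed.

Lemma cvgn_atanN s t : 0 < t -> atan ((- n%:R - s) / t) @[n --> \oo] --> (- (pi / 2) : R).
Proof.
move=> t0; have -> : (fun n : nat => atan ((- n%:R - s) / t)) =
    (fun n : nat => - atan ((n%:R - - s) / t)).
  by apply/funext => n; rewrite -atanN; congr atan; ring.
by apply: cvgN; exact: cvgn_atan.
Qed.

Lemma I_Pk t : 0 < t -> I (Pk t) = 1.
Proof.
move=> t0; have h (u : nat -> R) l : u n @[n --> \oo] --> l ->
  pi^-1 * u n @[n --> \oo] --> pi^-1 * l by move=> ul; apply: cvgM => //; exact: cvg_cst.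
rewrite (AC_integral (AC_Pk t0) (summ_Pk t0)
  (h _ _ (cvgn_atan 0 t0)) (h _ _ (cvgn_atanN 0 t0))).
move: pi_neq0; move: (@pi R) => p p0; by field; exact: p0.
Qed.

Lemma Pk_le t z : 0 < t -> Pk t z <= (pi * t)^-1.
Proof.
move=> t0; rewrite /Pk invfM ler_wpM2l ?invr_ge0 ?pi_ge0//.
rewrite ler_pdivrMr ?den_gt0// mulrDr expr2 mulKf ?gt_eqF// lerDr.
by rewrite mulr_ge0 ?sqr_ge0// invr_ge0 ltW.
Qed.

(** [qk t z ^+ 2 + Pk t z ^+ 2 = (pi * t)^-1 * Pk t z], so the square is dominated by the summable
    Poisson kernel although [qk t] itself decays only like [1 / z]. *)
Lemma L2_qk t : 0 < t -> L2 (qk t).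
Proof.
move=> t0; split; first exact: measurable_qk.
apply: (@summ_dom _ (fun z => (pi * t)^-1 * Pk t z)).
- by apply: measurable_sqr; exact: measurable_qk.
- move=> z; rewrite ger0_norm ?sqr_ge0// /qk /Pk -subr_ge0.
  have d0 := den_gt0 z t0.
  have -> : (pi * t)^-1 * (pi^-1 * (t / (z ^+ 2 + t ^+ 2))) -
      (pi^-1 * (z / (z ^+ 2 + t ^+ 2))) ^+ 2 = (pi^-1 * (t / (z ^+ 2 + t ^+ 2))) ^+ 2.
    move: pi_neq0; move: (@pi R) => p p0; 
    by field; rewrite p0 !gt_eqF.
  exact: sqr_ge0.
- by apply: summZ; exact: summ_Pk.
Qed.

Lemma dq_le t z : 0 < t -> `|dq t z| <= t^-1 * Pk t z.
Proof.
move=> t0; have d0 := den_gt0 z t0; rewrite /dq /Pk normrM ger0_norm ?invr_ge0 ?pi_ge0//.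
rewrite mulrCA ler_wpM2l ?invr_ge0 ?pi_ge0// mulKf ?gt_eqF// normrM normfV.
rewrite (ger0_norm (_ : 0 <= (_ + _) ^+ 2)) ?sqr_ge0// ler_pdivrMr ?exprn_gt0//.
rewrite expr2 mulKf ?gt_eqF// ler_norml; apply/andP; split.
  by have := sqr_ge0 t; lra.
by have := sqr_ge0 z; lra.
Qed.

Lemma measurable_dq t : 0 < t -> measurable_fun setT (dq t).
Proof. by move=> t0; apply: continuous_measurable_fun; exact: cont_dq. Qed.

Lemma summ_dq t : 0 < t -> summ (dq t).
Proof.
move=> t0; apply: (@summ_dom _ (fun z => t^-1 * Pk t z)).
- exact: measurable_dq.
- by move=> z; exact: dq_le.
- by apply: summZ; exact: summ_Pk.
Qed.

Lemma L2_bounded f M : measurable_fun setT f -> (forall x, `|f x| <= M) -> summ f -> L2 f.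
Proof.
move=> mf fM sf; split=> //.
rewrite (_ : (fun x => _) = (fun x => f x * f x)); last by apply/funext => x; rewrite expr2.
exact: summ_bmul fM sf.
Qed.

Lemma L2_Pk t : 0 < t -> L2 (Pk t).
Proof.
move=> t0; apply: (@L2_bounded _ (pi * t)^-1); [exact: measurable_Pk| |exact: summ_Pk].
by move=> z; rewrite ger0_norm ?Pk_ge0// Pk_le.
Qed.

Lemma L2_dq t : 0 < t -> L2 (dq t).
Proof.
move=> t0; apply: (@L2_bounded _ (t^-1 * (pi * t)^-1)); [exact: measurable_dq| |exact: summ_dq].
by move=> z; apply: le_trans (dq_le z t0) _; apply: ler_wpM2l; [rewrite invr_ge0 ltW|exact: Pk_le].
Qed.

Lemma H1_qk t : 0 < t -> H1 (qk t) (dq t).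
Proof. by move=> t0; split; [exact: L2_qk|exact: L2_dq|exact: AC_qk]. Qed.

Lemma I_dq t : 0 < t -> I (dq t) = 0.
Proof. by move=> t0; apply: (H1_int0 (H1_qk t0)); exact: summ_dq. Qed.

Lemma skE t z : 0 < t -> sk t z = pi * t * Pk t z.
Proof. move=> t0; rewrite /sk /Pk; move: pi_neq0; move: (@pi R) => p p0; 
by field; rewrite p0 den_neq0. Qed.

Lemma sk_bnd t z : 0 < t -> 0 <= sk t z <= 1.
Proof.
move=> t0; rewrite /sk ler_pdivrMr ?den_gt0// mul1r lerDr sqr_ge0 andbT.
by rewrite divr_ge0 ?sqr_ge0// ltW// den_gt0.
Qed.

Lemma measurable_sk t : 0 < t -> measurable_fun setT (sk t).
Proof. by move=> t0; apply: continuous_measurable_fun; exact: cont_sk. Qed.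

Lemma summ_sk t : 0 < t -> summ (sk t).
Proof.
move=> t0; rewrite (_ : sk t = fun z => pi * t * Pk t z); last by apply/funext => z; exact: skE.
by apply: summZ; exact: summ_Pk.
Qed.

Lemma L2_sk t : 0 < t -> L2 (sk t).
Proof.
move=> t0; apply: (@L2_bounded _ 1); [exact: measurable_sk| |exact: summ_sk].
by move=> z; have /andP[? ?] := sk_bnd z t0; rewrite ger0_norm.
Qed.

(** As [0 <= sk t <= 1], its square is at most [sk t], whose integral is [pi * t]. All the factors
    [Num.sqrt (pi * t)] and [Num.sqrt (pi * r)] below originate here. *)
Lemma nm_sk t : 0 < t -> nm (sk t) <= Num.sqrt (pi * t).
Proof.
move=> t0; rewrite ler_wsqrtr//.
have <- : I (fun z => pi * t * Pk t z) = pi * t by rewrite I_Z ?I_Pk ?mulr1//; exact: summ_Pk.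
apply: I_le; [by case: (L2_sk t0)|by apply: summZ; exact: summ_Pk|].
move=> z; rewrite -skE// expr2; have /andP[? ?] := sk_bnd z t0.
by rewrite ler_piMl.
Qed.

Lemma qk_opp t z : qk t (- z) = - qk t z. Proof. by rewrite /qk sqrrN; ring. Qed.
Lemma dq_opp t z : dq t (- z) = dq t z. Proof. by rewrite /dq sqrrN. Qed.

Lemma qk_id t z : 0 < t -> qk t z * z = pi^-1 * (1 - sk t z).
Proof. move=> t0; rewrite /qk /sk; move: pi_neq0; move: (@pi R) => p p0; 
by field; rewrite p0 den_neq0. Qed.

End Kernels.

(** * The regularized Hilbert transform *)

Section Convolution.
Context {R : realType}.
Local Notation mu := (@lebesgue_measure R).
Local Notation I := (Rintegral mu setT).
Implicit Types (f g h u v w m K F G : R -> R) (a b c r s t x y z M e : R).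

(** Tonelli on the positive and negative parts; divergent inner integrals are covered because [fine]
    is measurable. *)
Lemma measurable_I2 (F : R -> R -> R) :
  measurable_fun setT (fun p : R * R => F p.1 p.2) ->
  measurable_fun setT (fun x => I (F x)).
Proof.
move=> mF.
have mEF : measurable_fun setT (fun p : R * R => (F p.1 p.2)%:E).
  by apply/measurable_EFinP.
apply: (measurableT_comp (f := fine)) => //.
have m1 := @measurable_fun_fubini_tonelli_F _ _ _ _ R mu _
  (measurable_funepos mEF) (funepos_ge0 _).
have m2 := @measurable_fun_fubini_tonelli_F _ _ _ _ R mu _
  (measurable_funeneg mEF) (funeneg_ge0 _).
have := emeasurable_funB m1 m2.
congr (measurable_fun _ _); apply/funext => x /=.
rewrite [RHS]integralE /fubini_F; congr (_ - _)%E.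
  by apply: eq_integral => y _; rewrite !funeposE.
by apply: eq_integral => y _; rewrite !funenegE.
Qed.

Lemma measurable_add2 f : measurable_fun setT f ->
  measurable_fun setT (fun p : R * R => f (p.1 + p.2)).
Proof.
move=> mf; apply: (measurableT_comp mf).
by apply: measurable_funD; [exact: measurable_fst|exact: measurable_snd].
Qed.
Lemma measurable_sub2 f : measurable_fun setT f ->
  measurable_fun setT (fun p : R * R => f (p.2 - p.1)).
Proof.
move=> mf; apply: (measurableT_comp mf).
by apply: measurable_funB; [exact: measurable_snd|exact: measurable_fst].
Qed.
Lemma measurable_p1 f : measurable_fun setT f ->
  measurable_fun setT (fun p : R * R => f p.1).
Proof. by move=> mf; exact: (measurableT_comp mf measurable_fst). Qed.
Lemma measurable_p2 f : measurable_fun setT f ->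
  measurable_fun setT (fun p : R * R => f p.2).
Proof. by move=> mf; exact: (measurableT_comp mf measurable_snd). Qed.

Lemma L2_shiftl s f : L2 f -> L2 (fun x => f (s + x)).
Proof. by move=> /(L2_shift s); congr L2; apply/funext => x; rewrite addrC. Qed.
Lemma nm_shiftl s f : measurable_fun setT f -> nm (fun x => f (s + x)) = nm f.
Proof. by move=> /(nm_shift s) <-; apply: nm_ext => x; rewrite addrC. Qed.
Lemma summ_shiftl s f : summ f -> summ (fun x => f (s + x)).
Proof. by move=> /(summ_shift s); congr summ; apply/funext => x; rewrite addrC. Qed.
Lemma I_shiftl s f : measurable_fun setT f -> I (fun x => f (s + x)) = I f.
Proof. by move=> /(I_shift s) <-; apply: I_ext => x; rewrite addrC. Qed.

(** Written with [x + z], so that the singular kernel [1 / (pi (y - x))] of the Hilbert transform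
    corresponds to [K z = 1 / (pi z)] and the adjoint is given by the reflected kernel. *)
Definition cv K f x := I (fun z => K z * f (x + z)).

Lemma cvE K f x : measurable_fun setT K -> measurable_fun setT f ->
  cv K f x = I (fun y => K (y - x) * f y).
Proof.
move=> mK mf; rewrite -(I_shift x (f := fun y => K (y - x) * f y)).
  by apply: I_ext => z; rewrite addrK [x + z]addrC.
by apply: measurable_funM => //; exact: measurable_fshift.
Qed.

Lemma measurable_cv K f : measurable_fun setT K -> measurable_fun setT f ->
  measurable_fun setT (cv K f).
Proof.
move=> mK mf; apply: (@measurable_I2 (fun x z => K z * f (x + z))).
by apply: measurable_funM; [exact: measurable_p2|exact: measurable_add2].
Qed.

Lemma cv_le K f x : L2 K -> L2 f -> `|cv K f x| <= nm K * nm f.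
Proof.
move=> hK hf; rewrite -(nm_shiftl x (L2_mf hf)).
by apply: CS => //; exact: L2_shiftl.
Qed.

Lemma cvD K f g x : L2 K -> L2 f -> L2 g ->
  cv K (fun y => f y + g y) x = cv K f x + cv K g x.
Proof. by move=> hK hf hg; apply: ipDr; (exact: L2_shiftl || done). Qed.
Lemma cvB K f g x : L2 K -> L2 f -> L2 g ->
  cv K (fun y => f y - g y) x = cv K f x - cv K g x.
Proof. by move=> hK hf hg; apply: ipBr; (exact: L2_shiftl || done). Qed.

Lemma L2_kshift K x : L2 K -> L2 (fun y => K (y - x)).
Proof. exact: L2_shift. Qed.

Lemma L2_krefl K x : L2 K -> L2 (fun y => K (x - y)).
Proof.
by move=> /(L2_shiftl x) /L2_opp.
Qed.

Lemma nm_krefl K x : L2 K -> nm (fun y => K (x - y)) = nm K.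
Proof.
move=> hK; rewrite -(nm_shiftl x (L2_mf hK)) -[RHS]nm_opp//.
exact: L2_mf (L2_shiftl x hK).
Qed.

(** With a kernel merely in [L^2], the inner integral is bounded by [nm K * nm f], so Fubini needs
    the outer factor [g] to be summable. [cv_qk_skew] reaches all of [L^2] by density. *)
Lemma cv_adj K f g : L2 K -> L2 f -> L2 g -> summ g ->
  [/\ summ (fun x => cv K f x * g x), summ (fun y => f y * cv (fun z => K (- z)) g y) &
    ip (cv K f) g = ip f (cv (fun z => K (- z)) g)].
Proof.
move=> hK hf hg sg; have mK := L2_mf hK; have mf := L2_mf hf; have mg := L2_mf hg.
pose F x y := g x * (K (y - x) * f y).
have mF : measurable_fun setT (fun p : R * R => F p.1 p.2).
  apply: measurable_funM; first exact: measurable_p1.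
  by apply: measurable_funM; [exact: measurable_sub2|exact: measurable_p2].
have sK x : summ (fun y => K (y - x) * f y) by apply: L2M => //; exact: L2_kshift.
have sF x : summ (F x) by exact: summZ.
have Fb x : I (fun y => `|F x y|) <= (nm K * nm f) * `|g x|.
  rewrite (_ : I _ = `|g x| * I (fun y => `|K (y - x) * f y|)); last first.
    by rewrite -I_Z; [apply: I_ext => y; rewrite normrM|exact: summ_norm].
  rewrite mulrC ler_wpM2r// -(nm_shift (- x) mK); apply: CS_norm => //.
  exact: L2_kshift.
have FUB := fubini_I mF sF Fb (summZ _ (summ_norm sg)); have [s1 s2 _ _] := FUB.
have E1 : (fun x => I (F x)) = (fun x => cv K f x * g x).
  by apply/funext => x; rewrite (I_Z _ (sK x)) (cvE x mK mf) mulrC.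
have mKo : measurable_fun setT (fun z => K (- z)) by exact: measurable_fopp.
have E2 : (fun y => I (F^~ y)) = (fun y => f y * cv (fun z => K (- z)) g y).
  apply/funext => y; rewrite (cvE y mKo mg) -I_Z.
    by apply: I_ext => x; rewrite /F opprB; ring.
  apply: L2M hg; rewrite (_ : (fun x => _) = (fun x => K (y - x))); first exact: L2_krefl.
  by apply/funext => x; rewrite opprB.
by have [_ _ _] := FUB; rewrite E1 E2 => E; rewrite E1 in s1; rewrite E2 in s2; split.
Qed.

(* The quadratic inequality behind the weighted Cauchy-Schwarz inequality. *)
Lemma weighted_quad w g s : summ w -> (forall x, 0 <= w x) -> measurable_fun setT g ->
  summ (fun x => w x * g x ^+ 2) ->
  summ (fun x => w x * `|g x|) /\
  0 <= s ^+ 2 * I w - 2 * s * I (fun x => w x * `|g x|) + I (fun x => w x * g x ^+ 2).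
Proof.
move=> sw w0 mg sg.
have s1 : summ (fun x => w x * `|g x|).
  apply: (@summ_dom _ (fun x => w x + w x * g x ^+ 2)).
  - by apply: measurable_funM; [exact: summ_mf|exact: measurable_norm].
  - move=> x; rewrite ger0_norm ?mulr_ge0// -[X in _ <= X + _]mulr1 -mulrDr ler_wpM2l//.
    by rewrite -(real_normK (num_real (g x))); have := normr_ge0 (g x); nra.
  - exact: summD.
split=> //; rewrite -!I_Z// -I_B; try exact: summZ.
rewrite -I_D//; last by apply: summB; exact: summZ.
apply: I_ge0 => x; rewrite (_ : _ + _ = w x * (s - `|g x|) ^+ 2).
  by rewrite mulr_ge0// sqr_ge0.
by rewrite sqrrB real_normK ?num_real//; ring.
Qed.

(** Jensen's inequality for the probability density [K], integrated by Fubini. It serves both the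
    Poisson kernel and, for translation estimates, the uniform density on a segment. *)
Lemma cv_mean K b f : (forall z, 0 <= K z <= b) -> summ K -> I K = 1 -> L2 f ->
  L2 (cv K (fun x => `|f x|)) /\ nm (cv K (fun x => `|f x|)) <= nm f.
Proof.
move=> Kb sK IK hf; have mf := L2_mf hf; have mP := summ_mf sK.
have K0 z : 0 <= K z by case/andP: (Kb z).
have mc : measurable_fun setT (cv (K) (fun x => `|f x|)).
  by apply: measurable_cv => //; exact: measurable_norm.
pose F z x := K z * f (x + z) ^+ 2.
have mF : measurable_fun setT (fun p : R * R => F p.1 p.2).
  apply: measurable_funM; first exact: measurable_p1.
  apply: measurable_funX; rewrite (_ : (fun p => _) = (fun p : R * R => f (p.1 + p.2))).
    exact: measurable_add2.
  by apply/funext => p; rewrite addrC.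
have sf := hf.2.
have sfz z : summ (fun x => f (x + z) ^+ 2) by exact: (summ_shift z sf).
have IF z : I (F z) = K z * nm f ^+ 2.
  by rewrite I_Z// -(nm_shift z mf) nm_sqr.
have IFn z : I (fun x => `|F z x|) <= nm f ^+ 2 * K z.
  rewrite mulrC -IF le_eqVlt; apply/orP; left; apply/eqP; apply: I_ext => x.
  by rewrite ger0_norm// mulr_ge0 ?sqr_ge0// K0.
have FUB := fubini_I mF (fun z => summZ _ (sfz z)) IFn (summZ _ (sK)); have [s1 s2 _ _] := FUB.
have key x : cv (K) (fun x => `|f x|) x ^+ 2 <= I (F^~ x).
  have bP z : `|K z| <= b by rewrite ger0_norm ?K0//; case/andP: (Kb z).
  have sx : summ (fun z => K z * f (x + z) ^+ 2).
    exact: summ_bmul mP bP (summ_shiftl x sf).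
  have mfx : measurable_fun setT (fun z => f (x + z)) by exact: L2_mf (L2_shiftl x hf).
  (* Taking [s] equal to the mean [C] turns the quadratic inequality into [C ^+ 2 <= J]. *)
  set C := cv _ _ x; have [_] := weighted_quad C (sK) K0 mfx sx.
  have -> : I (fun z => K z * `|f (x + z)|) = C by [].
  have -> : I (fun z => K z * f (x + z) ^+ 2) = I (F^~ x) by [].
  by rewrite IK; set J := I (F^~ x); move: C J => C J; lra.
have sc : summ (fun x => cv (K) (fun x => `|f x|) x ^+ 2).
  apply: (@summ_dom _ (fun x => I (F^~ x))) => //; first exact: measurable_sqr.
  by move=> x; rewrite ger0_norm ?sqr_ge0.
split; first by split.
rewrite -(ler_pXn2r (n := 2))// ?nnegrE ?nm_ge0// [leLHS]nm_sqr.
apply: le_trans (I_le sc s2 key) _; have [_ _ _ <-] := FUB; rewrite (I_ext (g := fun z => nm f ^+ 2 * K z)).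
  by rewrite I_Z// IK mulr1.
by move=> z; rewrite IF mulrC.
Qed.

Lemma cv_Pk t f : 0 < t -> L2 f ->
  L2 (cv (Pk t) (fun x => `|f x|)) /\ nm (cv (Pk t) (fun x => `|f x|)) <= nm f.
Proof.
move=> t0; apply: (@cv_mean _ (pi * t)^-1); [|exact: summ_Pk|exact: I_Pk].
by move=> z; rewrite Pk_ge0// Pk_le.
Qed.

(** * The convolution square of the conjugate Poisson kernel *)

Lemma ln_le_sub1 x : 0 < x -> ln x <= x - 1.
Proof.
by move=> x0; rewrite -[x in X in _ <= X]lnK ?posrE// lerBrDl; exact: expR_ge1Dx.
Qed.

(** The logarithmic part of a primitive of [qk t z * qk t (r - z)]. Each logarithm diverges at
    infinity; their difference tends to [0]. *)
Definition lnden t r z : R := ln (z ^+ 2 + t ^+ 2) - ln ((z - r) ^+ 2 + t ^+ 2).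

(** [ln X - ln Y <= (X - Y) / Y], where the two denominators differ by at most [5/2 |z| |r|] and are
    both at least [z ^+ 2 / 4]; the quotient is [10 |r| / |z|]. *)
Lemma lnden_bound t r z : 0 < t -> 2 * `|r| <= `|z| -> 0 < `|z| ->
  `|lnden t r z| <= 10 * `|r| / `|z|.
Proof.
move=> t0 rz z0; rewrite /lnden.
have A0 := den_gt0 z t0; have B0 := den_gt0 (z - r) t0.
set A := z ^+ 2 + _ in A0 *; set B := (z - r) ^+ 2 + _ in B0 *.
have zz : z ^+ 2 = `|z| ^+ 2 by rewrite real_normK// num_real.
have rr : r ^+ 2 = `|r| ^+ 2 by rewrite real_normK// num_real.
have zr : `|z * r| = `|z| * `|r| by rewrite normrM.
have d : `|A - B| <= 5 / 2 * (`|z| * `|r|).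
  have -> : A - B = 2 * (z * r) - r ^+ 2 by rewrite /A /B; ring.
  rewrite (le_trans (ler_normB _ _))// normrM zr ger0_norm// (ger0_norm (sqr_ge0 r)) rr.
  by have := normr_ge0 r; nra.
have Az : z ^+ 2 / 4 <= A by rewrite /A; have := sqr_ge0 z; have := sqr_ge0 t; lra.
have Bz : z ^+ 2 / 4 <= B.
  rewrite /B sqrrB rr zz; have := ler_norm (z * r); rewrite zr => h.
  have := normr_ge0 r; have := sqr_ge0 t; nra.
have q0 : 0 < z ^+ 2 / 4 by rewrite zz divr_gt0// exprn_gt0.
have main X Y : 0 < X -> 0 < Y -> z ^+ 2 / 4 <= Y -> `|X - Y| <= 5 / 2 * (`|z| * `|r|) ->
    ln X - ln Y <= 10 * `|r| / `|z|.
  move=> X0 Y0 hY hXY; rewrite -ln_div ?posrE//.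
  apply: le_trans (ln_le_sub1 _) _; first exact: divr_gt0.
  have -> : X / Y - 1 = (X - Y) / Y by field; rewrite gt_eqF.
  rewrite ler_pdivrMr//.
  apply: (@le_trans _ _ (10 * `|r| / `|z| * (z ^+ 2 / 4))); last first.
    by rewrite ler_wpM2l// divr_ge0// mulr_ge0.
  have -> : 10 * `|r| / `|z| * (z ^+ 2 / 4) = 5 / 2 * (`|z| * `|r|).
    by rewrite zz; field; rewrite gt_eqF.
  exact: le_trans (ler_norm _) hXY.
rewrite ler_norml; apply/andP; split; last exact: main.
by rewrite lerNl opprB; apply: main => //; rewrite distrC.
Qed.

Lemma lnden_cvg t r (e : nat -> R) : 0 < t -> (forall n, `|e n| = n%:R) ->
  lnden t r (e n) @[n --> \oo] --> 0.
Proof.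
move=> t0 he; apply/cvgrPdist_le => d d0; near=> n.
rewrite sub0r normrN; have hn : `|e n| = n%:R := he n.
have n0 : 0 < n%:R :> R by rewrite ltr0n; near: n; exact: nbhs_infty_gt.
apply: le_trans (lnden_bound t0 _ _) _; rewrite ?hn//.
  by near: n; exact: nbhs_infty_ger.
rewrite ler_pdivrMr// -ler_pdivrMl//; near: n; exact: nbhs_infty_ger.
Unshelve. all: by end_near. Qed.

Lemma der_lnden t r z : 0 < t ->
  is_derive z 1 (lnden t r) (2 * z / (z ^+ 2 + t ^+ 2) - 2 * (z - r) / ((z - r) ^+ 2 + t ^+ 2)).
Proof.
move=> t0; rewrite /lnden.
have h1 := is_derive1_ln (den_gt0 z t0).
have h2 := is_derive1_ln (den_gt0 (z - r) t0).
have k1 := der_den t z.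
have k2 : is_derive z 1 (fun z => (z - r) ^+ 2 + t ^+ 2) (2 * (z - r)).
  by eapply der_eq; [der_tac|rewrite /= ?expr1; ring].
have l1 := @der_comp _ (@ln R) (fun z => z ^+ 2 + t ^+ 2) _ _ _ h1 k1.
have l2 := @der_comp _ (@ln R) (fun z => (z - r) ^+ 2 + t ^+ 2) _ _ _ h2 k2.
by apply: (der_eq (derB l1 l2)); rewrite ![_^-1 * _]mulrC.
Qed.

(** An explicit primitive: the logarithmic part vanishes at both ends and each of the two
    arctangents contributes [pi]. The constant [be] has a pole at [r = 0], whence the hypothesis on
    [r]. *)
Lemma I_qq t r : 0 < t -> r != 0 ->
  I (fun z => qk t z * qk t (r - z)) = - Pk (t + t) r.
Proof.
move=> t0 r0.
(* Partial fraction coefficients of the product of the two kernels: [al / t] multiplies the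
   arctangents, [be / 2] the difference of logarithms. *)
pose al := - t ^+ 2 / (r ^+ 2 + 4 * t ^+ 2); pose be := (r ^+ 2 + 2 * t ^+ 2) / (r * (r ^+ 2 + 4 * t ^+ 2)).
pose F z := pi^-1 ^+ 2 * (al / t * (atan ((z - 0) / t) + atan ((z - r) / t)) + be / 2 * lnden t r z).
have nt : t != 0 by rewrite gt_eqF.
have nD : r ^+ 2 + 4 * t ^+ 2 != 0.
  by rewrite gt_eqF// ltr_wpDl ?sqr_ge0// mulr_gt0// exprn_gt0.
have sq : summ (fun z => qk t z * qk t (r - z)).
  by apply: L2M; [exact: L2_qk|exact: L2_krefl (L2_qk t0)].
have aF : abscont F (fun z => qk t z * qk t (r - z)).
  apply: AC_C1; last first.
    apply: contM; first exact: cont_qk.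
    move=> z; apply: (continuous_comp (f := fun z => r - z)); last exact: cont_qk.
    by apply: cvgB; [exact: cvg_cst|exact: cvg_id].
  move=> z; apply: (der_eq (derM (derC _ _) (derD (derM (derC _ _)
    (derD (der_atan 0 t z) (der_atan r t z))) (derM (derC _ _) (der_lnden r z t0))))).
  have d1 := den_neq0 z t0; have d2 := den_neq0 (z - r) t0; have d3 := den_neq0 (r - z) t0.
  rewrite /qk /al /be subr0; move: (@pi_neq0 R); move: (@pi R) => p p0.
  rewrite (_ : (r - z) ^+ 2 = (z - r) ^+ 2); last by ring.
  have -> : (1 + (z / t) ^+ 2)^-1 = t ^+ 2 / (z ^+ 2 + t ^+ 2).
    by field; rewrite nt d1.
  have -> : (1 + ((z - r) / t) ^+ 2)^-1 = t ^+ 2 / ((z - r) ^+ 2 + t ^+ 2).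
    by field; rewrite nt d2.
  by field; rewrite p0 nt r0 nD d1 d2.
have lF (e : nat -> R) l : (forall n, `|e n| = n%:R) ->
    (forall s, atan ((e n - s) / t) @[n --> \oo] --> l) ->
    F (e n) @[n --> \oo] --> pi^-1 ^+ 2 * (al / t * (l + l) + be / 2 * 0).
  move=> he hl; apply: cvgM; first exact: cvg_cst.
  apply: cvgD; (apply: cvgM; first exact: cvg_cst); last exact: lnden_cvg.
  by apply: cvgD; exact: hl.
rewrite (AC_integral aF sq (lF (fun n => n%:R) _ _ (fun s => cvgn_atan s t0))
  (lF (fun n => - n%:R) _ _ (fun s => cvgn_atanN s t0))); last 2 first.
- by move=> n; rewrite normr_nat.
- by move=> n; rewrite normrN normr_nat.
rewrite /al /Pk; move: (@pi_neq0 R); move: (@pi R) => p p0.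
have nD' : r ^+ 2 + (t + t) ^+ 2 != 0.
  by rewrite (_ : (t + t) ^+ 2 = 4 * t ^+ 2)//; ring.
by field; rewrite p0 nt ?nD ?nD'.
Qed.

Lemma cv_cv_qk t f x : 0 < t -> L2 f -> summ f ->
  cv (qk t) (cv (qk t) f) x = - cv (Pk (t + t)) f x.
Proof.
move=> t0 hf sf; have mf := L2_mf hf; have hq := L2_qk t0; have mq := L2_mf hq.
have tt : 0 < t + t by rewrite addr_gt0.
pose F y z := f y * (qk t z * qk t (y - x - z)).
have mF : measurable_fun setT (fun p : R * R => F p.1 p.2).
  apply: measurable_funM; first exact: measurable_p1.
  apply: measurable_funM; first exact: measurable_p2.
  rewrite (_ : (fun p => _) = (fun p : R * R => qk t (- (p.2 - (p.1 - x))))); last first.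
    by apply/funext => p; rewrite opprB.
  apply: (measurableT_comp (measurable_fopp mq)).
  apply: measurable_funB; first exact: measurable_snd.
  by apply: measurable_funB; [exact: measurable_fst|exact: measurable_cst].
have hqr y : L2 (fun z => qk t (y - x - z)) by exact: L2_krefl.
have sF y : summ (F y) by apply: summZ; exact: L2M.
have Fb y : I (fun z => `|F y z|) <= (nm (qk t) * nm (qk t)) * `|f y|.
  rewrite (_ : I _ = `|f y| * I (fun z => `|qk t z * qk t (y - x - z)|)); last first.
    by rewrite -I_Z; [apply: I_ext => z; rewrite normrM|apply: summ_norm; exact: L2M].
  rewrite mulrC ler_wpM2r// -[X in _ <= _ * X](nm_krefl (y - x) hq).
  exact: CS_norm.
have FUB := fubini_I mF sF Fb (summZ _ (summ_norm sf)); have [s1 s2 _ _] := FUB.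
transitivity (I (fun z => I (F^~ z))).
  apply: I_ext => z; rewrite cvE// -I_Z.
    by apply: I_ext => y; rewrite /F opprD addrA; ring.
  by apply: L2M => //; exact: L2_kshift.
have [_ _ _ <-] := FUB; clear FUB; rewrite cvE//; last exact: measurable_Pk.
rewrite -I_N; last by apply: L2M => //; apply: L2_kshift; exact: L2_Pk.
apply: I_eq_ae.
- exact: summ_mf s1.
- apply: measurable_funN; apply: measurable_funM => //.
  by apply: measurable_fshift; exact: measurable_Pk.
(* The value [r = y - x = 0], excluded in [I_qq], concerns a single point [y]. *)
- have : {ae mu, forall y : R, y <> x}.
    exists [set x]; split; [exact: measurable_set1|exact: lebesgue_measure_set1|].
    by move=> y /= /contrapT.
  apply: aeS => y yx; rewrite I_Z; last exact: L2M.
  rewrite I_qq//; first by ring.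
  by rewrite subr_eq0; apply/eqP.
Qed.

Lemma qk_sqr_le t z : 0 < t -> qk t z ^+ 2 <= (pi * t)^-1 ^+ 2.
Proof.
move=> t0; have d0 := den_neq0 z t0; have nt : t != 0 by rewrite gt_eqF.
apply: (@le_trans _ _ ((pi * t)^-1 * Pk t z)); last first.
  by rewrite expr2 ler_wpM2l ?Pk_le// invr_ge0 mulr_ge0 ?pi_ge0 ?ltW.
rewrite -subr_ge0 (_ : _ - _ = Pk t z ^+ 2) ?sqr_ge0// /qk /Pk.
by move: (@pi_neq0 R); move: (@pi R) => p p0; field; rewrite p0 nt d0.
Qed.

(** A qualitative fact whose bound depends on the [L^1] norm of [f]. The sharp estimate pairs
    [cv (qk t) f] with itself, which presupposes that it is square integrable. *)
Lemma L2_cv_qk t f : 0 < t -> L2 f -> summ f -> L2 (cv (qk t) f).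
Proof.
move=> t0 hf sf; have mf := L2_mf hf; have hq := L2_qk t0; have mq := L2_mf hq.
pose F y x := `|f y| * qk t (y - x) ^+ 2.
have mF : measurable_fun setT (fun p : R * R => F p.1 p.2).
  apply: measurable_funM; first exact: (measurable_p1 (measurable_norm mf)).
  apply: measurable_funX; apply: (measurableT_comp mq).
  by apply: measurable_funB; [exact: measurable_fst|exact: measurable_snd].
have sF y : summ (F y) by apply: summZ; case: (L2_krefl y hq).
have IF y : I (F y) = `|f y| * nm (qk t) ^+ 2.
  by rewrite I_Z -?nm_sqr ?nm_krefl//; case: (L2_krefl y hq).
have Fb y : I (fun x => `|F y x|) <= nm (qk t) ^+ 2 * `|f y|.
  rewrite mulrC -IF le_eqVlt; apply/orP; left; apply/eqP; apply: I_ext => x.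
  by rewrite ger0_norm// mulr_ge0// sqr_ge0.
have FUB := fubini_I mF sF Fb (summZ _ (summ_norm sf)); have [s1 s2 _ _] := FUB.
have mc : measurable_fun setT (cv (qk t) f) by exact: measurable_cv.
split; first exact: mc.
apply: (summ_dom (g := fun x => (I (fun y => `|f y|) + 1) * I (F^~ x))).
- exact: measurable_sqr mc.
- move=> x; rewrite ger0_norm ?sqr_ge0//.
  have mqx : measurable_fun setT (fun y => qk t (y - x)) by exact: measurable_fshift.
  have sx : summ (fun y => `|f y| * qk t (y - x) ^+ 2).
    apply: (@summ_dom _ (fun y => (pi * t)^-1 ^+ 2 * `|f y|)).
    + by apply: measurable_funM; [exact: measurable_norm|exact: measurable_sqr].
    + move=> y; rewrite normrM normr_id ger0_norm ?sqr_ge0// mulrC ler_wpM2r//.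
      exact: qk_sqr_le.
    + exact: summZ (summ_norm sf).
  set A := I (fun y => `|f y|); set J := I (F^~ x).
  have A0 : 0 <= A by exact: I_ge0.
  have J0 : 0 <= J by apply: I_ge0 => y; rewrite mulr_ge0// sqr_ge0.
  set B := I (fun y => `|f y| * `|qk t (y - x)|).
  (* The optimal [s] would be [B / A], but [A] may vanish; with [A + 1] one still obtains
     [B ^+ 2 <= (A + 1) * J]. *)
  have [sB QB] := weighted_quad (B / (A + 1)) (summ_norm sf) (fun y => normr_ge0 _) mqx sx.
  have cB : `|cv (qk t) f x| <= B.
    rewrite cvE//; apply: I_dom => //; first exact: measurable_funM.
    by move=> y; rewrite normrM mulrC.
  have : 0 <= (B / (A + 1)) ^+ 2 * A - 2 * (B / (A + 1)) * B + J by exact: QB.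
  have B0 : 0 <= B by apply: I_ge0 => y; rewrite mulr_ge0.
  have c2 : cv (qk t) f x ^+ 2 <= B ^+ 2.
    by rewrite -(real_normK (num_real (cv (qk t) f x))) lerXn2r// nnegrE.
  move: c2; move: (cv (qk t) f x ^+ 2) => C; move: A0 J0 B0.
  clear QB cB sB; move: B J A => B J A A0 J0 B0 c2 h.
  have A1 : 0 < A + 1 by rewrite ltr_wpDl.
  have : 0 <= (A + 1) ^+ 2 * ((B / (A + 1)) ^+ 2 * A - 2 * (B / (A + 1)) * B + J).
    by rewrite mulr_ge0// sqr_ge0.
  have -> : (A + 1) ^+ 2 * ((B / (A + 1)) ^+ 2 * A - 2 * (B / (A + 1)) * B + J) =
    B ^+ 2 * A - 2 * (A + 1) * B ^+ 2 + (A + 1) ^+ 2 * J by field; rewrite gt_eqF.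
  move=> h2; have : (A + 1) * B ^+ 2 <= (A + 1) * ((A + 1) * J).
    have := sqr_ge0 B; nra.
  by rewrite ler_pM2l// => /(le_trans c2).
- exact: summZ s2.
Qed.

Lemma cv_neg K f x : L2 K -> L2 f -> cv (fun z => - K z) f x = - cv K f x.
Proof.
move=> hK hf; rewrite -I_N; last by apply: L2M => //; exact: L2_shiftl.
by apply: I_ext => z; rewrite mulNr.
Qed.

Lemma cv_qk_opp t f : 0 < t -> L2 f ->
  cv (fun z => qk t (- z)) f = fun x => - cv (qk t) f x.
Proof.
move=> t0 hf; apply/funext => x; rewrite -cv_neg; [|exact: L2_qk|exact: hf].
by congr (cv _ f x); apply/funext => z; rewrite qk_opp.
Qed.

(** The square of the left norm is [- <T T f, f>], that is [<P f, f>] with the Poisson kernel of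
    parameter [t + t], and convolution with a probability density does not increase the norm. *)
Lemma cv_qk_contr1 t f : 0 < t -> L2 f -> summ f -> nm (cv (qk t) f) <= nm f.
Proof.
move=> t0 hf sf; have hq := L2_qk t0; have hG := L2_cv_qk t0 hf sf.
have tt : 0 < t + t by rewrite addr_gt0.
have [hP nP] := cv_Pk tt hf.
have [_ _ adj] := cv_adj hq hG hf sf.
have E : ip (cv (qk t) f) (cv (qk t) f) = ip (cv (Pk (t + t)) f) f.
  transitivity (- ip (cv (qk t) (cv (qk t) f)) f).
    rewrite adj (cv_qk_opp t0 hf) -I_N; last first.
      by apply: L2M => //; exact: L2N.
    by apply: I_ext => x; rewrite mulrN opprK.
  rewrite -I_N.
    by apply: I_ext => x; rewrite cv_cv_qk// mulNr opprK.
  apply: (summ_dom (g := fun x => `|cv (Pk (t + t)) (fun y => `|f y|) x * f x|)).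
  - apply: measurable_funM; last exact: L2_mf.
    by apply: measurable_cv; exact: L2_mf.
  - move=> x; rewrite !normrM ler_wpM2r// cv_cv_qk// normrN.
    apply: le_trans (ler_norm _).
    apply: I_dom.
    + by apply: measurable_funM; [exact: measurable_Pk|exact: L2_mf (L2_shiftl x hf)].
    + by move=> z; rewrite normrM (ger0_norm (Pk_ge0 _ tt)).
    + by apply: L2M; [exact: L2_Pk|exact: (L2_norm (L2_shiftl x hf))].
  - by apply: summ_norm; exact: L2M.
have : nm (cv (qk t) f) ^+ 2 <= nm f * nm f.
  rewrite -ipff E; apply: le_trans (ler_norm _) _.
  apply: (@le_trans _ _ (I (fun x => `|cv (Pk (t + t)) (fun y => `|f y|) x * f x|))).
    apply: I_dom.
    + apply: measurable_funM; last exact: L2_mf.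
      by apply: measurable_cv; [exact: measurable_Pk|exact: L2_mf].
    + move=> x; rewrite !normrM ler_wpM2r//.
      apply: le_trans (ler_norm _); apply: I_dom.
      * by apply: measurable_funM; [exact: measurable_Pk|exact: L2_mf (L2_shiftl x hf)].
      * by move=> z; rewrite normrM (ger0_norm (Pk_ge0 _ tt)).
      * by apply: L2M; [exact: L2_Pk|exact: (L2_norm (L2_shiftl x hf))].
    + by apply: summ_norm; exact: L2M.
  apply: le_trans (CS_norm hP hf) _; rewrite ler_wpM2r ?nm_ge0//.
by rewrite -expr2 ler_pXn2r// nnegrE nm_ge0.
Qed.

(** Truncate [f] to [[-n, n]]: the transforms converge pointwise because [qk t] is in [L^2], and
    Fatou carries the bound over. *)
Lemma cv_qk_contr t f : 0 < t -> L2 f -> L2 (cv (qk t) f) /\ nm (cv (qk t) f) <= nm f.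
Proof.
move=> t0 hf; have hq := L2_qk t0.
pose fn (n : nat) x := chi (- n%:R) n%:R x * f x.
have hfn n : L2 (fn n) by apply: L2_bmul hf; [exact: measurable_chi|exact: chi_le1].
have sfn n : summ (fn n) by exact: summ_chi_mul.
have fnf n : nm (fn n) <= nm f.
  rewrite -[leRHS]mul1r; apply: nm_bmul => //; [exact: measurable_chi|exact: chi_le1].
have cvx x : cv (qk t) (fn n) x @[n --> \oo] --> cv (qk t) f x.
  apply: (@dct_I _ _ _ (fun z => `|qk t z * f (x + z)|)).
  - by move=> n; apply: measurable_funM; [exact: L2_mf|exact: L2_mf (L2_shiftl x (hfn n))].
  - by apply: measurable_funM; [exact: L2_mf|exact: L2_mf (L2_shiftl x hf)].
  - by apply: summ_norm; apply: L2M => //; exact: L2_shiftl.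
  - apply: aeW => z; apply: cvgM; first exact: cvg_cst.
    exact: chi_cvg.
  - move=> n z; rewrite !normrM ler_wpM2l// ler_piMl// chi_le1//.
have mc : measurable_fun setT (cv (qk t) f) by apply: measurable_cv; exact: L2_mf.
have [] := @fatou_I _ (fun n x => cv (qk t) (fn n) x ^+ 2) (fun x => cv (qk t) f x ^+ 2) (nm f ^+ 2).
- by move=> n; case: (L2_cv_qk t0 (hfn n) (sfn n)).
- by move=> n x; exact: sqr_ge0.
- move=> n; rewrite -nm_sqr; apply: lerXn2r; rewrite ?nnegrE ?nm_ge0//.
  exact: le_trans (cv_qk_contr1 t0 (hfn n) (sfn n)) (fnf n).
- exact: measurable_sqr.
- by apply: aeW => x; apply: cvgM; exact: cvx.
move=> s2 _ h; split; first by split.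
by rewrite -(ler_pXn2r (n := 2))// ?nnegrE ?nm_ge0// [leLHS]nm_sqr.
Qed.

End Convolution.

(** * Principal values *)

#[global] Opaque nm.
Section Hilbert.
Context {R : realType}.
Local Notation mu := (@lebesgue_measure R).
Local Notation I := (Rintegral mu setT).
Implicit Types (f g h u v w m K F G : R -> R) (a b c r s t x y z M e : R).

Ltac ring_ip := repeat match goal with
  |- context [@ip ?R ?f ?g] => generalize (@ip R f g); intro end; ring.

Lemma L2_approx f e : L2 f -> 0 < e ->
  exists g, [/\ L2 g, summ g, L2 (fun x => f x - g x) & nm (fun x => f x - g x) <= e].
Proof.
move=> hf e0; have [M [M0 hM]] := nm_tail hf e0.
have hc : L2 (fun x => chi (- M) M x * f x).
  by apply: L2_bmul hf; [exact: measurable_chi|exact: chi_le1].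
exists (fun x => chi (- M) M x * f x); split => //.
- exact: summ_chi_mul.
- exact: L2B.
- apply: hM; first exact: L2B.
  + move=> x; rewrite /chi; case: ifP => _; last by rewrite mul0r subr0.
    by rewrite mul1r subrr normr0.
  + by move=> x; rewrite ler_norml => /andP[h1 h2]; rewrite chi_in// mul1r subrr.
Qed.

(** [cv_adj] with the odd kernel covers summable [g]. Both sides are continuous in [g] by the
    contraction bound, and summable functions are dense. *)
Lemma cv_qk_skew t f g : 0 < t -> L2 f -> L2 g ->
  ip (cv (qk t) f) g = - ip f (cv (qk t) g).
Proof.
move=> t0 hf hg; have hq := L2_qk t0.
have [hTf nTf] := cv_qk_contr t0 hf.
have [hTg nTg] := cv_qk_contr t0 hg.
apply/eqP; rewrite -subr_eq0 opprK -normr_le0; apply/ler_addgt0Pl => e e0; rewrite addr0.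
have F0 : 0 < 2 * (nm f + 1) by rewrite mulr_gt0// ltr_wpDl// nm_ge0.
have [g' [hg' sg' hgg ngg]] := L2_approx hg (divr_gt0 e0 F0).
have [hTg' _] := cv_qk_contr t0 hg'.
have [hTgg nTgg] := cv_qk_contr t0 hgg.
have [_ _ adj] := cv_adj hq hf hg' sg'.
have E : ip (cv (qk t) f) g + ip f (cv (qk t) g) =
  ip (cv (qk t) f) (fun x => g x - g' x) + ip f (cv (qk t) (fun x => g x - g' x)).
  have -> : ip f (cv (qk t) (fun x => g x - g' x)) = ip f (cv (qk t) g) - ip f (cv (qk t) g').
    by rewrite -ipBr//; congr (ip f _); apply/funext => x; exact: cvB.
  rewrite ipBr// adj (cv_qk_opp t0 hg').
  have -> : ip f (fun x => - cv (qk t) g' x) = - ip f (cv (qk t) g').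
    rewrite -I_N; last exact: L2M.
    by apply: I_ext => x; rewrite mulrN.
  by ring_ip.
rewrite E; apply: le_trans (ler_normD _ _) _.
have h1 := CS hTf hgg; have h2 := CS hf hTgg.
have n1 : nm (cv (qk t) f) * nm (fun x => g x - g' x) <= nm f * (e / (2 * (nm f + 1))).
  by apply: ler_pM; rewrite ?nm_ge0.
have n2 : nm f * nm (cv (qk t) (fun x => g x - g' x)) <= nm f * (e / (2 * (nm f + 1))).
  by apply: ler_wpM2l; [exact: nm_ge0|exact: le_trans nTgg ngg].
apply: le_trans (lerD (le_trans h1 n1) (le_trans h2 n2)) _.
have F1 : 0 <= nm f by exact: nm_ge0.
have -> : nm f * (e / (2 * (nm f + 1))) + nm f * (e / (2 * (nm f + 1))) = e * (2 * nm f) / (2 * (nm f + 1)) by ring.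
clear -F0 e0; rewrite ler_pdivrMr// ler_pM2l// mulrDr lerDl mulr1; exact: ler0n.
Qed.

Definition tk t z : R := if t < `|z| then (pi * z)^-1 else 0.

(** Where |z| > t the difference is [- Pk t z * (t / z)]; elsewhere |qk t z| is [Pk t z] times |z| /
    t. The truncated and the smooth regularizations thus differ by a mean, which carries bounds from
    one to the other. *)
Lemma qk_tk t z : 0 < t -> `|qk t z - tk t z| <= Pk t z.
Proof.
move=> t0; have d0 := den_gt0 z t0; have p0 : 0 < pi :> R := pi_gt0 R.
have piV := @piV_gt0 R.
rewrite /tk /qk /Pk; case: ltP => h.
  have z0 : 0 < `|z| by exact: lt_trans h.
  have zn : z != 0 by rewrite -normr_gt0.
  have -> : pi^-1 * (z / (z ^+ 2 + t ^+ 2)) - (pi * z)^-1 =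
     - (pi^-1 * (t / (z ^+ 2 + t ^+ 2)) * (t / z)).
    rewrite invfM; move: (pi^-1 : R) => q; move: (lt0r_neq0 d0) => dn.
    by field; rewrite zn dn.
  rewrite normrN normrM ger0_norm; last by rewrite mulr_ge0 ?divr_ge0 ?ltW.
  rewrite ler_piMr//; first by rewrite mulr_ge0 ?divr_ge0 ?ltW.
  by rewrite normrM normfV ler_pdivrMr// mul1r gtr0_norm// ltW.
rewrite subr0 normrM (ger0_norm (ltW piV)) ler_pM2l// normrM normfV.
by rewrite (gtr0_norm d0) ler_pM2r// invr_gt0.
Qed.

Lemma tk_opp t z : tk t (- z) = - tk t z.
Proof. by rewrite /tk normrN mulrN invrN; case: ifP => // _; rewrite oppr0. Qed.

Lemma measurable_tk t : 0 < t -> measurable_fun setT (tk t).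
Proof.
move=> t0.
(* This expression is twice the maximum of [z ^+ 2] and [t ^+ 2]: continuous, never zero, and equal
   to [2 * z ^+ 2] where the truncated kernel is nonzero. It replaces the singular [1 / z] by a
   continuous function. *)
have cD : continuous (fun z : R => z ^+ 2 + t ^+ 2 + `|z ^+ 2 - t ^+ 2|).
  apply: contD; first exact: cont_den.
  move=> x; apply: (@continuous_comp _ _ _ (fun z : R => z ^+ 2 - t ^+ 2) (fun y : R => `|y|)).
    have : continuous (fun z : R => z ^+ 2 - t ^+ 2) by cont_tac.
    exact.
  exact: norm_continuous.
have D0 z : z ^+ 2 + t ^+ 2 + `|z ^+ 2 - t ^+ 2| != 0.
  by rewrite gt_eqF// ltr_pwDl// den_gt0.
rewrite (_ : tk t = fun z => (1 - chi (- t) t z) * (pi^-1 * (2 * z / (z ^+ 2 + t ^+ 2 + `|z ^+ 2 - t ^+ 2|)))).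
  apply: measurable_funM.
    by apply: measurable_funB; [exact: measurable_cst|exact: measurable_chi].
  apply: continuous_measurable_fun.
  apply: contM; first exact: contC.
  apply: contM; first by apply: contM; [exact: contC|exact: cont_id].
  exact: (contV D0).
apply/funext => z; rewrite /tk /chi -ler_norml leNgt; case: ltP => h /=; last by rewrite subrr mul0r.
have zn : z != 0 by rewrite -normr_gt0; exact: lt_trans h.
rewrite subr0 mul1r ger0_norm; last first.
  by rewrite subr_ge0 -(real_normK (num_real z)) lerXn2r// ?nnegrE ?ltW.
rewrite invfM; congr (_ * _).
rewrite (_ : z ^+ 2 + t ^+ 2 + (z ^+ 2 - t ^+ 2) = 2 * z ^+ 2); last by ring.
by field.
Qed.

Lemma L2_tk t : 0 < t -> L2 (tk t).
Proof.
move=> t0; have hd : L2 (fun z => qk t z - tk t z).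
  apply: (L2_dom _ _ (L2_Pk t0)).
    by apply: measurable_funB; [exact: measurable_qk|exact: measurable_tk].
  by move=> z; rewrite (ger0_norm (Pk_ge0 _ t0)) qk_tk.
have -> : tk t = fun z => qk t z - (qk t z - tk t z).
  by apply/funext => z; rewrite subKr.
by apply: L2B => //; exact: L2_qk.
Qed.

Lemma hilbert_truncE f t x : 0 < t -> L2 f -> hilbert_trunc f x t = cv (tk t) f x.
Proof.
move=> t0 hf; have mt := measurable_tk t0; have p0 := @pi_neq0 R.
rewrite cvE//; last exact: L2_mf.
rewrite /hilbert_trunc Rintegral_mkcond.
have s1 : summ (fun y => tk t (y - x) * f y).
  by apply: L2M => //; exact: L2_kshift (L2_tk t0).
rewrite [X in _ * X](_ : _ = pi * I (fun y => tk t (y - x) * f y)).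
  by rewrite mulrA mulVf// mul1r.
rewrite -I_Z//; apply: I_ext => y; rewrite /patch /tk.
case: ifPn => [|] ; rewrite ?inE /= => h.
  by rewrite h invfM mulrA mulrA mulfV// mul1r mulrC.
rewrite (_ : (t < `|y - x|) = false) ?mul0r ?mulr0//.
by apply: contraNF h => h; rewrite inE.
Qed.

Lemma cv_qk_tk t f x : 0 < t -> L2 f ->
  `|cv (qk t) f x - cv (tk t) f x| <= cv (Pk t) (fun y => `|f y|) x.
Proof.
move=> t0 hf; have hfx := L2_shiftl x hf.
rewrite -I_B; [|exact: L2M (L2_qk t0) _|exact: L2M (L2_tk t0) _].
apply: I_dom.
- apply: measurable_funB; apply: measurable_funM; try exact: (L2_mf hfx).
    exact: measurable_qk.
  exact: measurable_tk.
- move=> z; rewrite -mulrBl normrM ler_wpM2r//; exact: qk_tk.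
- by apply: L2M; [exact: L2_Pk|exact: L2_norm].
Qed.

Lemma L2_cv_tk t f : 0 < t -> L2 f -> L2 (cv (tk t) f) /\ nm (cv (tk t) f) <= 2 * nm f.
Proof.
move=> t0 hf; have [h1 n1] := cv_qk_contr t0 hf; have [h2 n2] := cv_Pk t0 hf.
have hd : L2 (fun x => cv (qk t) f x - cv (tk t) f x).
  apply: (L2_dom _ _ h2).
    apply: measurable_funB; first exact: L2_mf.
    by apply: measurable_cv; [exact: measurable_tk|exact: L2_mf].
  by move=> x; apply: le_trans (cv_qk_tk x t0 hf) (ler_norm _).
have nd : nm (fun x => cv (qk t) f x - cv (tk t) f x) <= nm f.
  apply: le_trans n2; apply: nm_dom => // x.
  by apply: le_trans (cv_qk_tk x t0 hf) (ler_norm _).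
have -> : cv (tk t) f = fun x => cv (qk t) f x - (cv (qk t) f x - cv (tk t) f x).
  by apply/funext => x; rewrite subKr.
split; first exact: L2B.
apply: le_trans (nmB _ _) _ => //.
by rewrite mulr2n mulrDl mul1r; exact: (lerD n1 nd).
Qed.

(** The limit [t -> 0] is taken along a sequence, as Fatou and dominated convergence require. *)
Definition tn (n : nat) : R := n.+1%:R^-1.
Lemma tn_gt0 n : 0 < tn n. Proof. by rewrite invr_gt0. Qed.
Lemma tn_cvg : tn n @[n --> \oo] --> 0. Proof. exact: cvg_harmonic. Qed.

(** Fatou along [tn]: the truncated transforms are bounded in [L^2] uniformly, once by the
    contraction [qk] and once by the Poisson mean of the difference. *)
Lemma hilbert_L2 f h : L2 f -> is_hilbert f h -> L2 h.
Proof.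
move=> hf [mh hh].
have [|||||s1 _ _] := @fatou_I R (fun n x => cv (tk (tn n)) f x ^+ 2) (fun x => h x ^+ 2) ((2 * nm f) ^+ 2).
- by move=> n; case: (L2_cv_tk (tn_gt0 n) hf) => -[].
- by move=> n x; exact: sqr_ge0.
- move=> n; rewrite -nm_sqr lerXn2r ?nnegrE ?nm_ge0 ?mulr_ge0 ?nm_ge0//.
  by case: (L2_cv_tk (tn_gt0 n) hf).
- exact: measurable_sqr.
- apply: aeS hh => x /cvg_at_rightP /(_ tn) H.
  have {}H : hilbert_trunc f x (tn n) @[n --> \oo] --> h x.
    by apply: H; split; [exact: tn_gt0|exact: tn_cvg].
  have -> : (fun n => cv (tk (tn n)) f x ^+ 2) = (fun n => hilbert_trunc f x (tn n) * hilbert_trunc f x (tn n)).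
    by apply/funext => n; rewrite expr2 hilbert_truncE//; exact: tn_gt0.
  by rewrite expr2; apply: cvgM.
- by split.
Qed.

Lemma I_qk_tk t : 0 < t -> summ (fun z => qk t z - tk t z) /\ I (fun z => qk t z - tk t z) = 0.
Proof.
move=> t0; have md : measurable_fun setT (fun z => qk t z - tk t z).
  by apply: measurable_funB; [exact: measurable_qk|exact: measurable_tk].
have sd : summ (fun z => qk t z - tk t z).
  by apply: (summ_dom md _ (summ_Pk t0)) => z; exact: qk_tk.
split=> //; have := I_opp md.
rewrite (I_ext (g := fun z => - (qk t z - tk t z))); last first.
  by move=> z; rewrite qk_opp tk_opp opprB opprK addrC.
by rewrite I_N//; move: (I _) => r; lra.
Qed.

(** The odd kernel [qk t - tk t] has integral zero, so [f x] may be subtracted from [f (x + z)].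
    Small [z] is handled by Hölder continuity of [f], the rest by boundedness of [f] and the decay
    of [Pk t] away from [0]. *)
Lemma cv_qk_tk_H1 s f df : 0 < s -> H1 f df -> exists C, forall t x, 0 < t ->
  `|cv (qk t) f x - cv (tk t) f x| <= s + C * t.
Proof.
move=> s0 hf; have [hf1 hf2 hf3] := hf.
pose N := nm f + nm df.
have N0 : 0 <= N by rewrite addr_ge0 ?nm_ge0.
have mf := L2_mf hf1.
(* By [H1_incr], an increment larger than [s] forces |z| to be at least [z0]. *)
pose z0 := s ^+ 2 / (N + 1) ^+ 2.
have z00 : 0 < z0 by rewrite divr_gt0 ?exprn_gt0// ltr_wpDl.
(* Chosen so that this constant times [z ^+ 2 / (z ^+ 2 + 1)] is at least [2 * N], the largest
   possible increment, as soon as |z| reaches [z0]. *)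
exists (2 * N * (1 + z0 ^- 2)) => t x t0.
pose d z := qk t z - tk t z.
have [sd Id] := I_qk_tk t0.
pose C := 2 * N * (1 + z0 ^- 2).
have C0 : 0 <= C by rewrite !mulr_ge0// addr_ge0// invr_ge0 sqr_ge0.
have hfx := L2_shiftl x hf1.
have E : cv (qk t) f x - cv (tk t) f x = I (fun z => d z * (f (x + z) - f x)).
  rewrite -I_B; [|exact: L2M (L2_qk t0) _|exact: L2M (L2_tk t0) _].
  transitivity (I (fun z => d z * f (x + z)) - f x * I d).
    by rewrite Id mulr0 subr0; apply: I_ext => z; rewrite mulrBl.
  rewrite -I_Z// -I_B; first by apply: I_ext => z; rewrite /d; ring.
    apply: L2M => //; apply: L2B; [exact: L2_qk|exact: L2_tk].
  exact: summZ.
rewrite E; apply: (@le_trans _ _ (I (fun z => s * Pk t z + C * t * Pk 1 z))); last first.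
  rewrite I_D; [|exact: summZ (summ_Pk _)|exact: summZ (summ_Pk ltr01)].
  rewrite (I_Z _ (summ_Pk t0)) (I_Z _ (summ_Pk ltr01)) (I_Pk t0) (I_Pk ltr01).
  by rewrite !mulr1.
apply: I_dom.
- apply: measurable_funM; first exact: summ_mf sd.
  by apply: measurable_funB; [exact: L2_mf hfx|exact: measurable_cst].
- move=> z; rewrite normrM.
  have hd : `|d z| <= Pk t z by exact: qk_tk.
  have P0 := Pk_ge0 z t0.
  have hD : `|f (x + z) - f x| <= s + C * (z ^+ 2 / (z ^+ 2 + 1)).
    have q0 : 0 <= z ^+ 2 / (z ^+ 2 + 1) by rewrite divr_ge0 ?sqr_ge0// addr_ge0 ?sqr_ge0.
    have [hs|hs] := leP `|f (x + z) - f x| s.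
      by apply: le_trans hs _; rewrite lerDl mulr_ge0.
    have hz : z0 <= `|z|.
      have := H1_incr x (x + z) hf; rewrite addrAC subrr add0r => h1.
      have h2 : s < Num.sqrt `|z| * (N + 1).
        apply: lt_le_trans hs (le_trans h1 _); rewrite ler_wpM2l ?sqrtr_ge0//.
        by rewrite /N; have := nm_ge0 f; lra.
      rewrite /z0 ler_pdivrMr ?exprn_gt0 ?ltr_wpDl//.
      rewrite -(sqr_sqrtr (normr_ge0 z)) -exprMn lerXn2r ?nnegrE ?(ltW s0) ?(ltW h2)//.
      by apply: mulr_ge0; [exact: sqrtr_ge0|exact: addr_ge0].
    apply: (@le_trans _ _ (2 * N)).
      apply: le_trans (ler_normB _ _) _; rewrite mulr2n mulrDl mul1r.
      by apply: lerD; exact: H1_sup.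
    apply: (@le_trans _ _ (C * (z ^+ 2 / (z ^+ 2 + 1)))); last by rewrite lerDr ltW.
    rewrite /C -mulrA ler_peMr ?mulr_ge0//.
    have hz2 : z0 ^+ 2 <= z ^+ 2.
      by rewrite -(real_normK (num_real z)) lerXn2r ?nnegrE ?(ltW z00).
    have z20 : 0 < z0 ^+ 2 by rewrite exprn_gt0.
    move: (z ^+ 2) (z0 ^+ 2) hz2 z20 => a b ab b0.
    have a0 : 0 < a by exact: lt_le_trans ab.
    rewrite mulrA ler_pdivlMr ?mul1r; last by rewrite addr_gt0.
    rewrite mulrDl mul1r lerD2l.
    by rewrite mulrC ler_pdivlMr// mul1r.
  apply: (le_trans (ler_pM _ _ hd hD)) => //.
  rewrite mulrDr (mulrC (Pk t z)) lerD2l mulrCA -mulrA ler_wpM2l//.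
  rewrite /Pk expr1n; have d0 := den_gt0 z t0; have d1 : 0 < z ^+ 2 + 1 by rewrite ltr_wpDl ?sqr_ge0.
  have -> : pi^-1 * (t / (z ^+ 2 + t ^+ 2)) * (z ^+ 2 / (z ^+ 2 + 1)) =
      t * (pi^-1 * (1 / (z ^+ 2 + 1))) * (z ^+ 2 / (z ^+ 2 + t ^+ 2)).
    by move: (pi^-1 : R) => p; field; rewrite !gt_eqF.
  rewrite ler_piMr//; last by rewrite ler_pdivrMr// mul1r lerDl sqr_ge0.
  by apply: mulr_ge0; [exact: ltW|apply: mulr_ge0; [exact: ltW piV_gt0|rewrite divr_ge0// ltW]].
- by apply: summD; [exact: summZ (summ_Pk t0)|exact: summZ (summ_Pk ltr01)].
Qed.

Lemma hilbert_cvg f df h : H1 f df -> is_hilbert f h ->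
  {ae mu, forall x, cv (qk (tn n)) f x @[n --> \oo] --> h x}.
Proof.
move=> hf [mh hh]; have [hf1 _ _] := hf.
apply: aeS hh => x /cvg_at_rightP /(_ tn) H.
have {}H : hilbert_trunc f x (tn n) @[n --> \oo] --> h x.
  by apply: H; split; [exact: tn_gt0|exact: tn_cvg].
have D : cv (qk (tn n)) f x - cv (tk (tn n)) f x @[n --> \oo] --> 0.
  apply/cvgrPdist_le => e e0; have e2 : 0 < e / 2 by rewrite divr_gt0.
  have [C HC] := cv_qk_tk_H1 e2 hf.
  have C1 : 0 < `|C| + 1 by rewrite ltr_wpDl.
  have /cvgrPdist_le /(_ _ (divr_gt0 e2 C1)) T := tn_cvg.
  near=> n; rewrite sub0r normrN; apply: le_trans (HC _ x (tn_gt0 n)) _.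
  rewrite [leRHS]splitr lerD2l.
  have : `|0 - tn n| <= e / 2 / (`|C| + 1) by near: n.
  rewrite sub0r normrN gtr0_norm ?tn_gt0// ler_pdivlMr// mulrC => h1.
  apply: le_trans h1; rewrite ler_wpM2r ?(ltW (tn_gt0 n))//.
  by have := ler_norm C; lra.
have -> : (fun n => cv (qk (tn n)) f x) =
  (fun n => hilbert_trunc f x (tn n) + (cv (qk (tn n)) f x - cv (tk (tn n)) f x)).
  by apply/funext => n; rewrite hilbert_truncE ?tn_gt0// addrCA subrr addr0.
by rewrite -[h x]addr0; exact: cvgD.
Unshelve. all: by end_near. Qed.
End Hilbert.

(** * Coercivity *)

Section Positivity.
Context {R : realType}.
Local Notation mu := (@lebesgue_measure R).
Local Notation I := (Rintegral mu setT).
Implicit Types (f g h u v w m K F G du dv dw : R -> R) (a b c r s t x y z M e : R).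

(** The increment is [z] times the average of [du] over [[x, x + z]], to which [cv_mean] applies. *)
Lemma nm_translation_pos u du z : H1 u du -> 0 < z ->
  nm (fun x => u (x + z) - u x) <= z * nm du.
Proof.
move=> [hu hdu ac] z0.
pose K y := z^-1 * chi 0 z y.
have sK : summ K by apply: summZ; exact: summ_chi.
have IK : I K = 1.
  by rewrite I_Z; [rewrite I_chi1 ?(ltW z0)// subr0 mulVf// gt_eqF|exact: summ_chi].
have zV : 0 <= z^-1 by rewrite invr_ge0 ltW.
have Kb y : 0 <= K y <= z^-1.
  apply/andP; split; first by apply: mulr_ge0 => //; exact: chi_ge0.
  by apply: ler_piMr => //; exact: le_trans (ler_norm _) (chi_le1 _ _ _).
have [hC nC] := cv_mean Kb sK IK hdu.
have hK : L2 K by apply: L2Z; exact: L2_chi.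
have hD : L2 (fun x => u (x + z) - u x) by apply: L2B => //; exact: L2_shift.
apply: (@le_trans _ _ (nm (fun x => z * cv K (fun y => `|du y|) x))); last first.
  by rewrite nmZ// gtr0_norm// ler_pM2l.
apply: nm_dom => // [|x]; first exact: L2Z.
have xz : x <= x + z by rewrite lerDl ltW.
have [_ ->] := ac _ _ xz.
have mdu := L2_mf hdu.
have hdx := L2_shiftl x hdu.
rewrite -(I_shiftl x); last by apply: measurable_funM => //; exact: measurable_chi.
have E y : chi x (x + z) (x + y) * du (x + y) = chi 0 z y * du (x + y).
  by rewrite /chi -{1}[x]addr0 !lerD2l.
rewrite (I_ext E); apply: le_trans (ler_norm _); rewrite -I_Z; last by apply: L2M hK (L2_norm hdx).
apply: I_dom.
- by apply: measurable_funM; [exact: measurable_chi|exact: L2_mf hdx].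
- move=> y; rewrite /K mulrA mulrA mulfV ?gt_eqF// mul1r normrM.
  by rewrite (ger0_norm (chi_ge0 _ _ _)).
- by apply: summZ; apply: L2M hK (L2_norm hdx).
Qed.

Lemma nm_translation u du z : H1 u du -> nm (fun x => u (x + z) - u x) <= `|z| * nm du.
Proof.
move=> hH; have [hu _ _] := hH.
have [z0|z0|<-] := ltgtP 0 z.
- by rewrite gtr0_norm//; exact: nm_translation_pos.
- have z1 : 0 < - z by rewrite oppr_gt0.
  rewrite ltr0_norm//; apply: le_trans (nm_translation_pos hH z1).
  have hD : L2 (fun x => u (x + z) - u x) by apply: L2B => //; exact: L2_shift.
  rewrite -(nm_shift (- z) (L2_mf hD)) -nmN; last exact: (L2_shift _ hD).
  by rewrite le_eqVlt; apply/orP; left; apply/eqP; apply: nm_ext => x; rewrite opprB subrK.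
- rewrite normr0 mul0r (nm_ext (g := fun=> 0 * 0)); last by move=> x; rewrite addr0 subrr mulr0.
  by rewrite nmZ ?normr0 ?mul0r//; exact: L2_0.
Qed.

(** Turns a quadratic form into an integral of [K] against the autocorrelation of [u], where
    positivity can be read off. *)
Lemma cv_ip K u g : summ K -> L2 K -> L2 u -> L2 g ->
  ip (cv K u) g = I (fun z => K z * ip (fun x => u (x + z)) g) /\
  summ (fun z => K z * ip (fun x => u (x + z)) g).
Proof.
move=> sK hK hu hg; have mK := L2_mf hK; have mu' := L2_mf hu; have mg := L2_mf hg.
pose F z x := K z * (u (z + x) * g x).
have mF : measurable_fun setT (fun p : R * R => F p.1 p.2).
  apply: measurable_funM; first exact: measurable_p1.
  by apply: measurable_funM; [exact: measurable_add2|exact: measurable_p2].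
have sz z : summ (fun x => u (z + x) * g x) by apply: L2M => //; exact: L2_shiftl.
have sF z : summ (F z) by exact: summZ.
have Fb z : I (fun x => `|F z x|) <= (nm u * nm g) * `|K z|.
  rewrite (_ : I _ = `|K z| * I (fun x => `|u (z + x) * g x|)); last first.
    by rewrite -I_Z; [apply: I_ext => x; rewrite normrM|exact: summ_norm].
  rewrite mulrC ler_wpM2r// -(nm_shiftl z mu'); apply: CS_norm => //.
  exact: L2_shiftl.
have FUB := fubini_I mF sF Fb (summZ _ (summ_norm sK)); have [s1 s2 _ _] := FUB.
have E1 : (fun z => I (F z)) = (fun z => K z * ip (fun x => u (x + z)) g).
  apply/funext => z; rewrite (I_Z _ (sz z)); congr (_ * _); apply: I_ext => x.
  by rewrite addrC.
have E2 : (fun x => I (F^~ x)) = (fun x => cv K u x * g x).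
  apply/funext => x; rewrite mulrC -I_Z; last by apply: L2M => //; exact: L2_shiftl.
  by apply: I_ext => z; rewrite /F (addrC z); ring.
by rewrite E1 in s1; have [_ _ _] := FUB; rewrite E1 E2 => E; split.
Qed.

Lemma cv_sym K u g : summ K -> L2 K -> (forall z, K (- z) = K z) -> L2 u -> L2 g ->
  ip (cv K u) g = ip u (cv K g).
Proof.
move=> sK hK ev hu hg; have [E1 s1] := cv_ip sK hK hu hg; have [E2 _] := cv_ip sK hK hg hu.
rewrite E1 (ipC u) E2 -(I_opp (summ_mf s1)); apply: I_ext => z; rewrite ev; congr (_ * _).
rewrite /ip -(I_shift z); last first.
  by apply: measurable_funM; [exact: L2_mf (L2_shift _ hu)|exact: L2_mf].
by apply: I_ext => x; rewrite addrK mulrC.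
Qed.

(** Moves the derivative onto the kernel: [dq t] is even, summable and of integral zero, whereas
    [qk t] is odd and only square integrable. *)
Lemma cv_qk_der t v dv x : 0 < t -> H1 v dv -> cv (qk t) dv x = - cv (dq t) v x.
Proof.
move=> t0 hv; have E := H1_ibp (H1_shift x hv) (H1_qk t0).
have -> : cv (qk t) dv x = ip (fun y => dv (y + x)) (qk t).
  by apply: I_ext => z; rewrite mulrC addrC.
by rewrite E; congr (- _); apply: I_ext => z; rewrite mulrC addrC.
Qed.

Lemma L2_cv_dq t v dv : 0 < t -> H1 v dv -> L2 (cv (dq t) v).
Proof.
move=> t0 hv; have [_ hd _] := hv.
have -> : cv (dq t) v = fun x => - cv (qk t) dv x.
  by apply/funext => x; rewrite (cv_qk_der _ t0 hv) opprK.
by apply: L2N; case: (cv_qk_contr t0 hd).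
Qed.

(** The weak form of commutation with [d/dx]. It allows the equation for [x phi'] to be tested when
    only the transform of [x phi'], and not of its derivative, has a known limit. *)
Lemma ip_cv_der t v dv w dw : 0 < t -> H1 v dv -> H1 w dw ->
  ip (cv (qk t) dv) w = - ip (cv (qk t) v) dw.
Proof.
move=> t0 hv hw; have [hv1 hv2 _] := hv; have [hw1 hw2 _] := hw.
rewrite (cv_qk_skew t0 hv1 hw2) opprK.
have -> : cv (qk t) dv = fun x => - cv (dq t) v x by apply/funext => x; exact: cv_qk_der.
have -> : cv (qk t) dw = fun x => - cv (dq t) w x by apply/funext => x; exact: cv_qk_der.
have h1 := L2_cv_dq t0 hv; have h2 := L2_cv_dq t0 hw.
transitivity (- ip (cv (dq t) v) w).
  rewrite -I_N; last exact: L2M.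
  by apply: I_ext => x; rewrite mulNr.
rewrite (cv_sym (summ_dq t0) (L2_dq t0) (dq_opp t))//.
rewrite -I_N; last exact: L2M.
by apply: I_ext => x; rewrite mulrN.
Qed.

(* [-H d/dx] is a nonnegative operator; its regularization by [qk t] is so up to [O(t)]. *)
Lemma cv_qk_der_le t u du : 0 < t -> H1 u du ->
  ip (cv (qk t) du) u <= t / pi * nm du ^+ 2.
Proof.
move=> t0 hu; have [hu1 hu2 _] := hu.
have -> : ip (cv (qk t) du) u = - ip (cv (dq t) u) u.
  rewrite -I_N; last by apply: L2M => //; exact: L2_cv_dq hu.
  by apply: I_ext => x; rewrite (cv_qk_der _ t0 hu) mulNr.
have [E s] := cv_ip (summ_dq t0) (L2_dq t0) hu1 hu1; rewrite E.
pose rho z := ip (fun x => u (x + z)) u.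
have rhoE z : nm u ^+ 2 - rho z = 2^-1 * nm (fun x => u (x + z) - u x) ^+ 2.
  have h1 := L2_shift z hu1; have h2 := L2B h1 hu1; rewrite /rho.
  rewrite -(ipff (fun x => u (x + z) - u x)); have := nm_shift z (L2_mf hu1).
  move: h1 h2; set U := fun x => u (x + z) => h1 h2 nU.
  rewrite (ipBl h1 hu1 h2) (ipBr h1 hu1 h1) (ipBr h1 hu1 hu1) !ipff nU (ipC u U).
  by move: (nm u) (ip U u) => a b; field.
have Id := I_dq t0.
(* As [dq t] has integral zero, [- rho] may be replaced by [nm u ^+ 2 - rho], half a squared
   increment and hence nonnegative. Only |z| <= t, where [dq t] is nonnegative, can then contribute
   to the upper bound. *)
have EE : - I (fun z => dq t z * rho z) = I (fun z => dq t z * (nm u ^+ 2 - rho z)).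
  transitivity (nm u ^+ 2 * I (dq t) - I (fun z => dq t z * rho z)).
    by rewrite Id mulr0 sub0r.
  rewrite -I_Z; last exact: summ_dq.
  rewrite -I_B //; last by apply: summZ; exact: summ_dq.
  by apply: I_ext => z; ring.
have tt : - t <= t by lra.
(* On [[-t, t]] one has [dq t z * z ^+ 2 <= pi^-1], and the half squared increment is at most
   [z ^+ 2 * nm du ^+ 2 / 2]; the segment has length [2 * t]. *)
have -> : t / pi * nm du ^+ 2 = I (fun z => (2^-1 * nm du ^+ 2 * pi^-1) * chi (- t) t z).
  rewrite I_Z; last exact: summ_chi.
  by rewrite I_chi1// opprK; move: (pi^-1 : R) (nm du) => p d; field.
rewrite [leLHS]EE; apply: I_le.
- rewrite (_ : (fun z => _) = (fun z => nm u ^+ 2 * dq t z - dq t z * rho z)).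
    by apply: summB => //; apply: summZ; exact: summ_dq.
  by apply/funext => z; ring.
- by apply: summZ; exact: summ_chi.
- move=> z; rewrite rhoE; have := nm_translation z hu.
  set d := nm (fun x => _) => hd; have d0 : 0 <= d by exact: nm_ge0.
  have p0 := @piV_gt0 R.
  have hd2 : d ^+ 2 <= z ^+ 2 * nm du ^+ 2.
    rewrite -(real_normK (num_real z)) -exprMn lerXn2r ?nnegrE//.
    by apply: mulr_ge0; [exact: normr_ge0|exact: nm_ge0].
  rewrite /chi -ler_norml; have [hz|hz] := leP `|z| t.
    rewrite mulr1 /dq.
    have z2 : z ^+ 2 <= t ^+ 2.
      by rewrite -(real_normK (num_real z)) lerXn2r ?nnegrE// ltW.
    have D0 := den_gt0 z t0.
    have N0 := sqr_ge0 (nm du).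
    have K : (t ^+ 2 - z ^+ 2) / (z ^+ 2 + t ^+ 2) ^+ 2 * z ^+ 2 <= 1.
      rewrite mulrAC ler_pdivrMr ?exprn_gt0// mul1r.
      by have := sqr_ge0 z; move: (z ^+ 2) (t ^+ 2) z2 D0 => a b; nra.
    have K0 : 0 <= (t ^+ 2 - z ^+ 2) / (z ^+ 2 + t ^+ 2) ^+ 2.
      by rewrite divr_ge0 ?subr_ge0 ?sqr_ge0.
    move: ((t ^+ 2 - z ^+ 2) / (z ^+ 2 + t ^+ 2) ^+ 2) K K0 => k K K0.
    have : k * d ^+ 2 <= nm du ^+ 2.
      apply: (@le_trans _ _ (k * (z ^+ 2 * nm du ^+ 2))); first exact: ler_wpM2l.
      by rewrite mulrA ler_piMl.
    move=> /(ler_wpM2l (ltW p0)); move: (pi^-1) (d ^+ 2) (nm du ^+ 2) => p dd n; lra.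
  rewrite mulr0 /dq -mulrA mulr_ge0_le0 ?(ltW p0)// mulr_le0_ge0//; last by rewrite mulr_ge0 ?sqr_ge0// invr_ge0.
  rewrite mulr_le0_ge0 ?invr_ge0 ?sqr_ge0// subr_le0.
  by rewrite -(real_normK (num_real z)) lerXn2r ?nnegrE// ltW.
Qed.

(** For [gamma >= 0] the nonlocal term has a favourable sign up to [O(t)]. For [gamma < 0] it is
    bounded by the contraction estimate, and what remains is a binary quadratic form in [nm u] and
    [nm du], definite exactly when [gamma ^+ 2 < 4 * c]. *)
Lemma coercivity gamma c : (0 <= gamma -> 0 < c) -> (gamma < 0 -> gamma ^+ 2 / 4 < c) ->
  exists d C, [/\ 0 < d, 0 <= C & forall t u du, 0 < t -> H1 u du ->
    d * (nm u ^+ 2 + nm du ^+ 2) <=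
    c * nm u ^+ 2 + nm du ^+ 2 - gamma * ip (cv (qk t) du) u + C * t * nm du ^+ 2].
Proof.
move=> h0 h1; have p0 := @piV_gt0 R.
have [g0|g0] := leP 0 gamma.
  have c0 := h0 g0; exists (Num.min c 1), (gamma / pi); split.
  - by rewrite lt_min c0 ltr01.
  - by apply: mulr_ge0 => //; exact: ltW.
  - move=> t u du t0 hu; have h := ler_wpM2l g0 (cv_qk_der_le t0 hu).
    have m1 : Num.min c 1 <= c by rewrite ge_min lexx.
    have m2 : Num.min c 1 <= 1 by rewrite ge_min lexx orbT.
    have n1 := ler_wpM2r (sqr_ge0 (nm u)) m1.
    have n2 := ler_wpM2r (sqr_ge0 (nm du)) m2.
    have E : gamma / pi * t * nm du ^+ 2 = gamma * (t / pi * nm du ^+ 2) by ring.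
    rewrite E mulrDr; move: n1 n2 h; clear.
    move: (nm u ^+ 2) (nm du ^+ 2) (ip _ _) (Num.min c 1) (t / pi) => a b i m k; lra.
have c1 := h1 g0.
pose G := - gamma.
have G0 : 0 < G by rewrite oppr_gt0.
have c2 : G ^+ 2 < 4 * c by rewrite sqrrN; lra.
have c0 : 0 < c by have := sqr_ge0 G; lra.
(* [d] is small enough for the form [c x^2 + y^2 - G x y - d (x^2 + y^2)] to be nonnegative. *)
pose d := (4 * c - G ^+ 2) / (4 * (1 + c)).
have D0 : 0 < 4 * (1 + c) by lra.
have dE : d * (4 * (1 + c)) = 4 * c - G ^+ 2 by rewrite divfK// gt_eqF.
have d0 : 0 < d by rewrite divr_gt0// subr_gt0.
exists d, 0; split=> // t u du t0 [hu hdu _]; rewrite !mul0r addr0.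
have [hT nT] := cv_qk_contr t0 hdu.
have hip : `|ip (cv (qk t) du) u| <= nm du * nm u.
  by apply: le_trans (CS hT hu) _; rewrite ler_wpM2r ?nm_ge0.
have {}hip : - (nm du * nm u) <= ip (cv (qk t) du) u by move: hip; rewrite ler_norml => /andP[].
have h : G * (- (nm du * nm u)) <= G * ip (cv (qk t) du) u by rewrite ler_wpM2l// ltW.
have N1 := nm_ge0 u; have N2 := nm_ge0 du.
have Q : d * (nm u ^+ 2 + nm du ^+ 2) <= c * nm u ^+ 2 + nm du ^+ 2 - G * (nm du * nm u).
  move: (nm u) (nm du) => x y.
  have d1 : d < 1.
    rewrite -(ltr_pM2r D0) mul1r dE; have := sqr_ge0 G; lra.
  have dc : G ^+ 2 <= 4 * (c - d) * (1 - d).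
    have -> : G ^+ 2 = 4 * c - d * (4 * (1 + c)) by rewrite dE; ring.
    have := sqr_ge0 d; lra.
  have e0 : 0 < 1 - d by rewrite subr_gt0.
  rewrite -subr_ge0.
  have : 0 <= 4 * (1 - d) * (c * x ^+ 2 + y ^+ 2 - G * (y * x) - d * (x ^+ 2 + y ^+ 2)).
    have -> : 4 * (1 - d) * (c * x ^+ 2 + y ^+ 2 - G * (y * x) - d * (x ^+ 2 + y ^+ 2)) =
      (2 * (1 - d) * y - G * x) ^+ 2 + (4 * (c - d) * (1 - d) - G ^+ 2) * x ^+ 2 by ring.
    by rewrite addr_ge0 ?sqr_ge0// mulr_ge0 ?sqr_ge0// subr_ge0.
  by rewrite pmulr_rge0// mulr_gt0.
have -> : - (gamma * ip (cv (qk t) du) u) = G * ip (cv (qk t) du) u by rewrite mulNr.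
move: Q h; rewrite mulrN; move: (G * ip _ _) (G * _) => i j; lra.
Qed.
End Positivity.

(** * Weights and commutators *)

Section Weights.
Context {R : realType}.
Local Notation mu := (@lebesgue_measure R).
Local Notation I := (Rintegral mu setT).
Implicit Types (f g h u v w m K F G du dv dw : R -> R) (a b c r s t x y z M e : R).

(** The upper limit of |F n| is at most [M]. The sequences compared below need not converge, and in
    this form the bounds simply add. *)
Definition evle (F : nat -> R) M := forall e, 0 < e -> \forall n \near \oo, `|F n| <= M + e.

Lemma evle_bnd (F : nat -> R) M : (forall n, `|F n| <= M) -> evle F M.
Proof. by move=> h e e0; apply: nearW => n; apply: le_trans (h n) _; rewrite lerDl ltW. Qed.

Lemma evleD (F G : nat -> R) M N : evle F M -> evle G N -> evle (fun n => F n + G n) (M + N).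
Proof.
move=> h1 h2 e e0; have e2 : 0 < e / 2 by rewrite divr_gt0.
have := h1 _ e2; have := h2 _ e2 => k2 k1.
near=> n; apply: le_trans (ler_normD _ _) _.
rewrite [in leRHS](splitr e) addrACA; apply: lerD; by near: n.
Unshelve. all: by end_near. Qed.

Lemma evle_cvg (F : nat -> R) : F n @[n --> \oo] --> 0 -> evle F 0.
Proof.
move=> /cvgrPdist_le h e e0; have := h _ e0 => k; near=> n; rewrite add0r.
by rewrite -normrN -[- F n]add0r; near: n.
Unshelve. all: by end_near. Qed.

Lemma evle_ext (F G : nat -> R) M : (forall n, F n = G n) -> evle F M -> evle G M.
Proof. by move=> FG h; have -> : G = F by apply/funext => n. Qed.

Lemma evle_le (F : nat -> R) M N : M <= N -> evle F M -> evle F N.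
Proof.
move=> MN h e e0; have := h _ e0; apply: filterS => n Fn; apply: le_trans Fn _.
by rewrite lerD2r.
Qed.

Lemma evle_lim (F : nat -> R) M l : F n @[n --> \oo] --> l -> evle F M -> `|l| <= M.
Proof.
move=> Fl h; apply/ler_addgt0Pl => e e0; rewrite addrC.
have Fn : `|F n| @[n --> \oo] --> `|l| by exact: cvg_norm.
rewrite -(cvg_lim (@Rhausdorff R) Fn); apply: limr_le; [|exact: h]; apply/cvg_ex; by exists `|l|.
Qed.

Lemma evle_cst M l : evle (fun=> l) M -> `|l| <= M.
Proof. by apply: evle_lim; exact: cvg_cst. Qed.

(** By [nm_sk], a bound for the norm of [sk (tn n)], hence the size of the commutator errors. *)
Definition sn n : R := Num.sqrt (pi * tn n).

Lemma sn_cvg : sn n @[n --> \oo] --> 0.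
Proof.
rewrite -sqrtr0; apply: continuous_cvg; first exact: sqrt_continuous.
by rewrite -[X in _ --> X](mulr0 pi); apply: cvgM; [exact: cvg_cst|exact: tn_cvg].
Qed.

Lemma evle_sn (F : nat -> R) M N : (forall n, `|F n| <= M + N * sn n) -> evle F M.
Proof.
move=> h; have N0 : evle (fun n => N * sn n) 0.
  by apply: evle_cvg; rewrite -[X in _ --> X](mulr0 N); apply: cvgM; [exact: cvg_cst|exact: sn_cvg].
move=> e e0; have := N0 _ e0; apply: filterS => n; rewrite add0r => Nn.
apply: le_trans (h n) _; rewrite lerD2l; exact: le_trans (ler_norm _) Nn.
Qed.

(** The formula is that of [sk r], so the bounds for [sk] apply verbatim. [wa] and [wb] are the real
    and imaginary parts of [r / (r - i x)]; [wm] is both [x * wa r x] and [r * wb r x]. *)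
Definition wa r x : R := r ^+ 2 / (x ^+ 2 + r ^+ 2).
Definition wb r x : R := r * x / (x ^+ 2 + r ^+ 2).
Definition wm r x : R := r ^+ 2 * x / (x ^+ 2 + r ^+ 2).
Definition dwa r x : R := - (2 * r ^+ 2 * x) / (x ^+ 2 + r ^+ 2) ^+ 2.
Definition dwb r x : R := r * (r ^+ 2 - x ^+ 2) / (x ^+ 2 + r ^+ 2) ^+ 2.
Definition dwm r x : R := r ^+ 2 * (r ^+ 2 - x ^+ 2) / (x ^+ 2 + r ^+ 2) ^+ 2.
Definition ddwa r x : R := r ^+ 2 * (6 * x ^+ 2 - 2 * r ^+ 2) / (x ^+ 2 + r ^+ 2) ^+ 3.
Definition ddwm r x : R := 2 * r ^+ 2 * x * (x ^+ 2 - 3 * r ^+ 2) / (x ^+ 2 + r ^+ 2) ^+ 3.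

Ltac den_cont := move=> r0; rewrite /wa /wb /wm /dwa /dwb /dwm /ddwa /ddwm; cont_tac;
  move=> x; rewrite ?expf_neq0// den_neq0//.

Lemma cont_wa r : 0 < r -> continuous (wa r). Proof. by den_cont. Qed.
Lemma cont_wb r : 0 < r -> continuous (wb r). Proof. by den_cont. Qed.
Lemma cont_wm r : 0 < r -> continuous (wm r). Proof. by den_cont. Qed.
Lemma cont_dwa r : 0 < r -> continuous (dwa r). Proof. by den_cont. Qed.
Lemma cont_dwb r : 0 < r -> continuous (dwb r). Proof. by den_cont. Qed.
Lemma cont_dwm r : 0 < r -> continuous (dwm r). Proof. by den_cont. Qed.
Lemma cont_ddwa r : 0 < r -> continuous (ddwa r). Proof. by den_cont. Qed.
Lemma cont_ddwm r : 0 < r -> continuous (ddwm r). Proof. by den_cont. Qed.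

Ltac den_der := move=> r0; apply: AC_C1 => [x|];
  [eapply der_eq; [rewrite /wa /wb /wm /dwa /dwb /dwm; der_tac; rewrite ?expf_neq0// den_neq0//
    |rewrite /= /dwa /dwb /dwm /ddwa /ddwm ?expr1; field; rewrite den_neq0//]|].

Lemma AC_wa r : 0 < r -> abscont (wa r) (dwa r).
Proof. den_der; exact: cont_dwa. Qed.
Lemma AC_wb r : 0 < r -> abscont (wb r) (dwb r).
Proof. den_der; exact: cont_dwb. Qed.
Lemma AC_wm r : 0 < r -> abscont (wm r) (dwm r).
Proof. den_der; exact: cont_dwm. Qed.
Lemma AC_dwa r : 0 < r -> abscont (dwa r) (ddwa r).
Proof. den_der; exact: cont_ddwa. Qed.
Lemma AC_dwm r : 0 < r -> abscont (dwm r) (ddwm r).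
Proof. den_der; exact: cont_ddwm. Qed.

Lemma wmE r x : wm r x = x * wa r x. Proof. by rewrite /wm /wa mulrA (mulrC x). Qed.
Lemma wbE r x : 0 < r -> wb r x = r^-1 * x * wa r x.
Proof. by move=> r0; rewrite /wb /wa; field; rewrite (gt_eqF r0) den_neq0. Qed.

Lemma wm_shift r x z : 0 < r ->
  wm r (x + z) - wm r x = z * (wa r x * wa r (x + z) - wb r x * wb r (x + z)).
Proof.
move=> r0; rewrite /wm /wa /wb; have := den_neq0 x r0; have := den_neq0 (x + z) r0.
by move=> h1 h2; field; rewrite h1 h2.
Qed.

Lemma wa_bnd r x : 0 < r -> 0 <= wa r x <= 1. Proof. exact: sk_bnd. Qed.
Lemma wa_le1 r x : 0 < r -> `|wa r x| <= 1.
Proof. by move=> r0; have /andP[? ?] := wa_bnd x r0; rewrite ger0_norm. Qed.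

Lemma wab r x : 0 < r -> wa r x ^+ 2 + wb r x ^+ 2 = wa r x.
Proof. by move=> r0; rewrite /wa /wb; field; rewrite den_neq0. Qed.
Lemma wb_sqr r x : 0 < r -> wb r x ^+ 2 <= wa r x.
Proof. by move=> r0; rewrite -(wab x r0) lerDr sqr_ge0. Qed.
Lemma wb_le1 r x : 0 < r -> `|wb r x| <= 1.
Proof.
move=> r0; rewrite -(ler_pXn2r (n := 2))// ?nnegrE// expr1n real_normK ?num_real//.
by apply: le_trans (wb_sqr x r0) _; case/andP: (wa_bnd x r0).
Qed.

Lemma den_ratio r x (k : nat) n M : 0 < r ->
  - (M * (x ^+ 2 + r ^+ 2) ^+ k) <= n -> n <= M * (x ^+ 2 + r ^+ 2) ^+ k ->
  `|n / (x ^+ 2 + r ^+ 2) ^+ k| <= M.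
Proof.
move=> r0 h1 h2; have d0 := den_gt0 x r0.
by rewrite normrM normfV (gtr0_norm (exprn_gt0 k d0)) ler_pdivrMr ?exprn_gt0// ler_norml h1.
Qed.

Lemma dwm_le1 r x : 0 < r -> `|dwm r x| <= 1.
Proof.
move=> r0; apply: den_ratio => //; have := sqr_ge0 x; have := sqr_ge0 r; move: (x ^+ 2) (r ^+ 2) => a b; nra.
Qed.

Lemma wa_den r x k n M : 0 < r ->
  `|n / (x ^+ 2 + r ^+ 2) ^+ k| <= M -> `|r ^+ 2 * n / (x ^+ 2 + r ^+ 2) ^+ k.+1| <= M * wa r x.
Proof.
move=> r0 h; have /andP[w0 _] := wa_bnd x r0.
have -> : r ^+ 2 * n / (x ^+ 2 + r ^+ 2) ^+ k.+1 = n / (x ^+ 2 + r ^+ 2) ^+ k * wa r x.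
  by rewrite /wa [_ ^+ k.+1]exprS invfM; ring.
by rewrite normrM (ger0_norm w0) ler_wpM2r.
Qed.

Lemma dwa_le r x : 0 < r -> `|dwa r x| <= r^-1 * wa r x.
Proof.
move=> r0; have -> : dwa r x = r ^+ 2 * (- (2 * x)) / (x ^+ 2 + r ^+ 2) ^+ 2.
  by rewrite /dwa; congr (_ / _); ring.
have e1 : 2 * x <= r^-1 * (x ^+ 2 + r ^+ 2).
  by rewrite [leRHS]mulrC ler_pdivlMr//; have := sqr_ge0 (x - r); rewrite sqrrB; lra.
have e2 : - (2 * x) <= r^-1 * (x ^+ 2 + r ^+ 2).
  by rewrite [leRHS]mulrC ler_pdivlMr//; have := sqr_ge0 (x + r); rewrite sqrrD; lra.
by apply: wa_den => //; apply: (@den_ratio r x 1) => //; rewrite expr1// lerN2.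
Qed.

Lemma dwb_le r x : 0 < r -> `|dwb r x| <= r^-1 * wa r x.
Proof.
move=> r0; have -> : dwb r x = r ^+ 2 * (r^-1 * (r ^+ 2 - x ^+ 2)) / (x ^+ 2 + r ^+ 2) ^+ 2.
  by rewrite /dwb; congr (_ / _); rewrite expr2; field; rewrite gt_eqF.
apply: wa_den => //; apply: (@den_ratio r x 1) => //; rewrite expr1 -?mulrN ler_pM2l ?invr_gt0//.
  by have := sqr_ge0 r; lra.
by have := sqr_ge0 x; lra.
Qed.

Lemma ddwa_le r x : 1 <= r -> `|ddwa r x| <= 6 * r^-1 * wa r x.
Proof.
move=> r1; have r0 : 0 < r by exact: lt_le_trans r1.
have X := sqr_ge0 x; have Rr : 1 <= r ^+ 2 by rewrite expr_ge1// ltW.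
have rV : r^-1 <= 1 by rewrite invf_le1.
have rV0 : 0 < r^-1 by rewrite invr_gt0.
have nD : r * (x ^+ 2 + r ^+ 2) <= (x ^+ 2 + r ^+ 2) ^+ 2.
  rewrite [leRHS]expr2 ler_wpM2r ?(ltW (den_gt0 x r0))//.
  by have : r <= r ^+ 2; [rewrite expr2 ler_peMr// ltW|lra].
apply: wa_den => //; apply: (@den_ratio r x 2) => //; rewrite -(ler_pM2l r0) ?mulrN !mulrA [r * 6]mulrC -[6 * r * r^-1]mulrA mulfV ?gt_eqF// mulr1.
  rewrite -subr_ge0; have := nD; have := mulr_ge0 (ltW r0) X; have := mulr_ge0 (ltW r0) (sqr_ge0 r); lra.
have := nD; have := mulr_ge0 (ltW r0) X; have := mulr_ge0 (ltW r0) (sqr_ge0 r); lra.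
Qed.

Lemma ddwm_le r x : 1 <= r -> `|ddwm r x| <= 6.
Proof.
move=> r1; have r0 : 0 < r by exact: lt_le_trans r1.
have X := sqr_ge0 x; have Rr : r <= r ^+ 2 by rewrite expr2 ler_peMr// ltW.
have h1 : `|2 * r * x / (x ^+ 2 + r ^+ 2) ^+ 1| <= 1.
  apply: den_ratio => //; rewrite expr1 mul1r.
    by have := sqr_ge0 (x + r); rewrite sqrrD; lra.
  by have := sqr_ge0 (x - r); rewrite sqrrB; lra.
have h2 : `|(x ^+ 2 - 3 * r ^+ 2) / (x ^+ 2 + r ^+ 2) ^+ 1| <= 3.
  by apply: den_ratio => //; rewrite expr1; lra.
have h3 : `|r / (x ^+ 2 + r ^+ 2) ^+ 1| <= 1.
  by apply: den_ratio => //; rewrite expr1 mul1r; lra.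
have -> : ddwm r x = (2 * r * x / (x ^+ 2 + r ^+ 2) ^+ 1) *
   ((x ^+ 2 - 3 * r ^+ 2) / (x ^+ 2 + r ^+ 2) ^+ 1) * (r / (x ^+ 2 + r ^+ 2) ^+ 1).
  by rewrite /ddwm !expr1; field; rewrite den_neq0.
rewrite 2!normrM; have : 1 * 3 * 1 <= 6 :> R by lra.
by apply: le_trans; apply: ler_pM => //; apply: ler_pM.
Qed.

Lemma summ_wa r : 0 < r -> summ (wa r). Proof. exact: summ_sk. Qed.
Lemma L2_wa r : 0 < r -> L2 (wa r). Proof. exact: L2_sk. Qed.
Lemma nm_wa r : 0 < r -> nm (wa r) <= Num.sqrt (pi * r). Proof. exact: nm_sk. Qed.

Lemma L2_wdom f M r : 0 < r -> 0 <= M -> continuous f -> (forall x, `|f x| <= M * wa r x) ->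
  L2 f /\ nm f <= M * Num.sqrt (pi * r).
Proof.
move=> r0 M0 cf fM; have hM : L2 (fun x => M * wa r x) by exact: L2Z (L2_wa r0).
have h x : `|f x| <= `|M * wa r x| by exact: le_trans (fM x) (ler_norm _).
have hf : L2 f by apply: L2_dom h hM; exact: continuous_measurable_fun.
split=> //; apply: le_trans (nm_dom hf hM h) _.
by rewrite nmZ ?ger0_norm//; [rewrite ler_wpM2l// nm_wa|exact: L2_wa].
Qed.

Lemma L2_wb r : 0 < r -> L2 (wb r) /\ nm (wb r) <= Num.sqrt (pi * r).
Proof.
move=> r0; have mb : measurable_fun setT (wb r) by apply: continuous_measurable_fun; exact: cont_wb.
have sb : summ (fun x => wb r x ^+ 2).
  apply: (summ_dom _ _ (summ_wa r0)); first exact: measurable_sqr.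
  by move=> x; rewrite ger0_norm ?sqr_ge0// wb_sqr.
have hb : L2 (wb r) by split.
split=> //; rewrite -(ler_pXn2r (n := 2))// ?nnegrE ?nm_ge0 ?sqrtr_ge0// nm_sqr sqr_sqrtr; last first.
  by rewrite mulr_ge0 ?pi_ge0// ltW.
apply: (@le_trans _ _ (I (wa r))).
  by apply: I_le => // [|x]; [exact: summ_wa|exact: wb_sqr].
rewrite (I_ext (g := fun z => pi * r * Pk r z)); last by move=> z; exact: skE.
by rewrite I_Z ?I_Pk ?mulr1//; exact: summ_Pk.
Qed.

Lemma wm_le r x : 0 < r -> `|wm r x| <= r.
Proof.
move=> r0; have -> : wm r x = r * wb r x by rewrite /wm /wb; field; rewrite den_neq0.
by rewrite normrM (gtr0_norm r0) ler_piMr ?wb_le1// ltW.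
Qed.

Lemma measurable_wm r : 0 < r -> measurable_fun setT (wm r).
Proof. by move=> r0; apply: continuous_measurable_fun; exact: cont_wm. Qed.

Lemma L2_wmM r f : 0 < r -> L2 f -> L2 (fun x => wm r x * f x).
Proof. by move=> r0; apply: L2_bmul; [exact: measurable_wm|move=> x; exact: wm_le]. Qed.

(** The factor [z] removes the singularity: [qk t z * z] is [pi^-1 * (1 - sk t z)], so the integral
    of [F] appears with an error that vanishes with [t]. *)
Lemma qk_moment t F x : 0 < t -> L2 F -> summ F ->
  I (fun z => qk t z * z * F (x + z)) = pi^-1 * (I F - cv (sk t) F x).
Proof.
move=> t0 hF sF; have sx := summ_shiftl x sF; have hx := L2_shiftl x hF.
have s1 : summ (fun z => sk t z * F (x + z)) by apply: L2M hx; exact: L2_sk.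
rewrite -(I_shiftl x (L2_mf hF)) -I_B// -I_Z; last exact: summB.
by apply: I_ext => z; rewrite qk_id//; ring.
Qed.

Lemma cv_sk_le t F x : 0 < t -> L2 F -> `|cv (sk t) F x| <= Num.sqrt (pi * t) * nm F.
Proof.
move=> t0 hF; apply: le_trans (cv_le _ (L2_sk t0) hF) _.
by rewrite ler_wpM2r ?nm_ge0// nm_sk.
Qed.

Lemma summ_qk_moment t F x : 0 < t -> L2 F -> summ F -> summ (fun z => qk t z * z * F (x + z)).
Proof.
move=> t0 hF sF; have sx := summ_shiftl x sF; have hx := L2_shiftl x hF.
have s1 : summ (fun z => sk t z * F (x + z)) by apply: L2M hx; exact: L2_sk.
rewrite (_ : (fun z => _) = fun z => pi^-1 * (F (x + z) - sk t z * F (x + z))).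
  by apply: summZ; exact: summB.
by apply/funext => z; rewrite qk_id//; ring.
Qed.

Lemma x_cv_qk t f x : 0 < t -> L2 f -> summ f -> L2 (fun x => x * f x) ->
  x * cv (qk t) f x = cv (qk t) (fun x => x * f x) x - pi^-1 * (I f - cv (sk t) f x).
Proof.
move=> t0 hf sf hxf; have s2 := summ_qk_moment x t0 hf sf.
have s1 : summ (fun z => qk t z * ((x + z) * f (x + z))).
  by apply: L2M (L2_qk t0) (L2_shiftl x hxf).
rewrite -qk_moment// -I_B// -I_Z; last by apply: L2M (L2_qk t0) (L2_shiftl x hf).
by apply: I_ext => z; ring.
Qed.

(** [wm_shift] extracts the factor [z] from the increment of the weight and separates the variables;
    [qk_moment] then applies to [wa r * f] and to [wb r * f]. *)
Lemma wm_cv_qk r t f x : 0 < r -> 0 < t -> L2 f ->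
  wm r x * cv (qk t) f x = cv (qk t) (fun x => wm r x * f x) x
   - pi^-1 * (wa r x * (ip (wa r) f - cv (sk t) (fun x => wa r x * f x) x)
            - wb r x * (ip (wb r) f - cv (sk t) (fun x => wb r x * f x) x)).
Proof.
move=> r0 t0 hf; have ha := L2_wa r0; have [hb _] := L2_wb r0.
have haf : L2 (fun x => wa r x * f x).
  by apply: L2_bmul (L2_mf ha) _ hf => y; exact: wa_le1.
have hbf : L2 (fun x => wb r x * f x).
  by apply: L2_bmul (L2_mf hb) _ hf => y; exact: wb_le1.
have sa := L2M ha hf; have sb := L2M hb hf.
have hmf := L2_wmM r0 hf.
have q1 := summ_qk_moment x t0 haf sa; have q2 := summ_qk_moment x t0 hbf sb.
have -> : pi^-1 * (wa r x * (ip (wa r) f - cv (sk t) (fun x => wa r x * f x) x)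
            - wb r x * (ip (wb r) f - cv (sk t) (fun x => wb r x * f x) x)) =
  wa r x * (pi^-1 * (ip (wa r) f - cv (sk t) (fun x => wa r x * f x) x))
  - wb r x * (pi^-1 * (ip (wb r) f - cv (sk t) (fun x => wb r x * f x) x)).
  by move: (pi^-1 : R) (ip _ _) (ip _ _) (cv _ _ _) (cv _ _ _) => p i j k l; ring.
rewrite -[ip (wa r) f]/(I _) -[ip (wb r) f]/(I _) -qk_moment// -qk_moment//.
rewrite -!I_Z//; last by apply: L2M (L2_qk t0) (L2_shiftl x hf).
rewrite -I_B; [|exact: summZ|exact: summZ].
rewrite -I_B; [|by apply: L2M (L2_qk t0) (L2_shiftl x hmf)|by apply: summB; exact: summZ].
apply: I_ext => z; have := wm_shift x z r0 => E.
have -> : wm r x = wm r (x + z) - z * (wa r x * wa r (x + z) - wb r x * wb r (x + z)) by rewrite -E; ring.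
by ring.
Qed.

(** [D] adds the [a] part of the commutator back, leaving the [b] part in the bound: [<b, f>] gains
    a factor [r^-1] once a first moment is known, [<a, f>] does not. The [2] counts the two [sk]
    errors. *)
Lemma wm_commutator r t f : 0 < r -> 0 < t -> L2 f ->
  let D x := wm r x * cv (qk t) f x - cv (qk t) (fun x => wm r x * f x) x + pi^-1 * ip (wa r) f * wa r x in
  L2 D /\ nm D <= pi^-1 * Num.sqrt (pi * r) * (`|ip (wb r) f| + 2 * Num.sqrt (pi * t) * nm f).
Proof.
move=> r0 t0 hf D; have ha := L2_wa r0; have [hb nb] := L2_wb r0; have na := nm_wa r0.
have haf : L2 (fun x => wa r x * f x).
  by apply: L2_bmul (L2_mf ha) _ hf => y; exact: wa_le1.
have hbf : L2 (fun x => wb r x * f x).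
  by apply: L2_bmul (L2_mf hb) _ hf => y; exact: wb_le1.
have n1 : nm (fun x => wa r x * f x) <= nm f.
  by rewrite -[leRHS]mul1r; apply: nm_bmul => //; [exact: L2_mf|move=> y; exact: wa_le1].
have n2 : nm (fun x => wb r x * f x) <= nm f.
  by rewrite -[leRHS]mul1r; apply: nm_bmul => //; [exact: L2_mf|move=> y; exact: wb_le1].
pose s : R := Num.sqrt (pi * t); have s0 : 0 <= s by exact: sqrtr_ge0.
have p0 : 0 <= pi^-1 :> R by apply: ltW; exact: piV_gt0.
pose A := pi^-1 * (s * nm f); pose B := pi^-1 * (`|ip (wb r) f| + s * nm f).
have A0 : 0 <= A by rewrite !mulr_ge0 ?nm_ge0.
have B0 : 0 <= B by rewrite mulr_ge0// addr_ge0// mulr_ge0// nm_ge0.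
have hAB : L2 (fun x => A * `|wa r x| + B * `|wb r x|).
  by apply: L2D; apply: L2Z; exact: L2_norm.
have key x : `|D x| <= `|A * `|wa r x| + B * `|wb r x| |.
  rewrite [leRHS]ger0_norm; last by rewrite addr_ge0// mulr_ge0.
  have s1 := le_trans (cv_sk_le x t0 haf) (ler_wpM2l s0 n1).
  have s2 := le_trans (cv_sk_le x t0 hbf) (ler_wpM2l s0 n2).
  have -> : D x = pi^-1 * cv (sk t) (fun x => wa r x * f x) x * wa r x
     + pi^-1 * (ip (wb r) f - cv (sk t) (fun x => wb r x * f x) x) * wb r x.
    rewrite /D wm_cv_qk//.
    by move: (pi^-1 : R) (ip _ _) (ip _ _) (cv (sk t) _ _) (cv (sk t) _ _) (cv _ _ _) => p i j k l q; ring.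
  apply: le_trans (ler_normD _ _) _; rewrite !normrM (ger0_norm p0); apply: lerD.
    by rewrite ler_wpM2r// ler_wpM2l.
  rewrite ler_wpM2r// ler_wpM2l//; apply: le_trans (ler_normB _ _) _.
  by rewrite lerD2l.
have hT := (cv_qk_contr t0 hf).1; have hTm := (cv_qk_contr t0 (L2_wmM r0 hf)).1.
have hD : L2 D.
  by apply: L2D; [apply: L2B => //; exact: L2_wmM|exact: L2Z].
split=> //; apply: le_trans (nm_dom hD hAB key) _.
apply: le_trans (nmD _ _) _; try by apply: L2Z; exact: L2_norm.
rewrite !nmZ; [|exact: L2_norm..]; rewrite !nm_norm (ger0_norm A0) (ger0_norm B0).
have -> : pi^-1 * Num.sqrt (pi * r) * (`|ip (wb r) f| + 2 * s * nm f) =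
   A * Num.sqrt (pi * r) + B * Num.sqrt (pi * r).
  by rewrite /A /B; move: (pi^-1 : R) (Num.sqrt _) (nm f) `|_| => p q n i; ring.
by apply: lerD; apply: ler_wpM2l.
Qed.

Variables gamma c : R.

(** The weak form of [c - d^2/dx^2 - gamma T_t d/dx] at [t = tn n], with densities as separate
    arguments. *)
Definition Bn n v dv w dw :=
  c * ip v w + ip dv dw - gamma * ip (cv (qk (tn n)) dv) w.

Lemma H1_wm r v dv : 0 < r -> H1 v dv ->
  H1 (fun x => wm r x * v x) (fun x => dwm r x * v x + wm r x * dv x).
Proof.
move=> r0; apply: (@H1_mul _ _ _ (r + 1)); first exact: AC_wm.
- exact: measurable_wm.
- by apply: continuous_measurable_fun; exact: cont_dwm.
- by move=> x; apply: le_trans (wm_le x r0) _; rewrite lerDl.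
- by move=> x; apply: le_trans (dwm_le1 x r0) _; rewrite lerDr ltW.
Qed.

(** The norm of [wa r] may grow like [sqrt r]; each derivative is given a bound with a factor
    [r^-1], which suffices for uniformity in [r >= 1]. *)
Lemma wa_norms r : 1 <= r ->
  [/\ H1 (wa r) (dwa r), H1 (dwa r) (ddwa r), nm (dwa r) <= pi & nm (ddwa r) <= 6 * pi].
Proof.
move=> r1; have r0 : 0 < r by exact: lt_le_trans r1.
have rV : 0 <= r^-1 by rewrite invr_ge0 ltW.
have [h1 n1] := L2_wdom r0 rV (cont_dwa r0) (fun x => dwa_le x r0).
have rV6 : 0 <= 6 * r^-1 by rewrite mulr_ge0.
have [h2 n2] := L2_wdom r0 rV6 (cont_ddwa r0) (fun x => ddwa_le x r1).
have hp : r^-1 * Num.sqrt (pi * r) <= pi.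
  have pr : 1 <= pi * r by rewrite mulr_ege1//; have := @pi_ge2 R; lra.
  have s1 : 1 <= Num.sqrt (pi * r) by rewrite -sqrtr1 ler_wsqrtr.
  have pr0 : 0 <= pi * r by lra.
  rewrite mulrC ler_pdivrMr// -[leRHS](sqr_sqrtr pr0) expr2 ler_peMr// sqrtr_ge0.
split.
- by split => //; [exact: L2_wa|exact: AC_wa].
- by split => //; exact: AC_dwa.
- exact: le_trans n1 hp.
- by apply: le_trans n2 _; rewrite -mulrA ler_pM2l.
Qed.

Lemma H1_dwm r v dv : 1 <= r -> H1 v dv ->
  H1 (fun x => dwm r x * v x) (fun x => ddwm r x * v x + dwm r x * dv x).
Proof.
move=> r1; have r0 : 0 < r by exact: lt_le_trans r1.
apply: (@H1_mul _ _ _ 6); first exact: AC_dwm.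
- by apply: continuous_measurable_fun; exact: cont_dwm.
- by apply: continuous_measurable_fun; exact: cont_ddwm.
- by move=> x; apply: le_trans (dwm_le1 x r0) _; lra.
- by move=> x; exact: ddwm_le.
Qed.

Lemma H1_wu r v dv k : 1 <= r -> H1 v dv ->
  H1 (fun x => wm r x * v x - k * wa r x)
     (fun x => dwm r x * v x + wm r x * dv x - k * dwa r x).
Proof.
move=> r1 hv; have r0 : 0 < r by exact: lt_le_trans r1.
have [ha _ _ _] := wa_norms r1.
have := H1D (H1_wm r0 hv) (H1Z (- k) ha).
by apply: H1_ext => x; rewrite mulNr.
Qed.

Lemma ip_bound F (w : R -> R) M : L2 F -> L2 w -> nm F <= M -> `|ip F w| <= M * nm w.
Proof. by move=> hF hw FM; apply: le_trans (CS hF hw) _; rewrite ler_wpM2r ?nm_ge0. Qed.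

Lemma ip_mulC (m v w : R -> R) : ip v (fun x => m x * w x) = ip (fun x => m x * v x) w.
Proof. by apply: I_ext => x; ring. Qed.

(** After integration by parts only [m'' v + 2 m' v'], minus [k a''], is paired with [w]. All three
    have norms bounded independently of [r], and no derivative of [w] is left. *)
Lemma commutator_local r v dv w dw k : 1 <= r -> H1 v dv -> H1 w dw ->
  `|ip dv (fun x => dwm r x * w x + wm r x * dw x)
    - ip (fun x => dwm r x * v x + wm r x * dv x - k * dwa r x) dw|
  <= (2 * nm dv + 6 * nm v + 6 * pi * `|k|) * nm w.
Proof.
move=> r1 hv hw; have [hv1 hv2 _] := hv; have [hw1 hw2 _] := hw.
have r0 : 0 < r by exact: lt_le_trans r1.
have [ha hda _ nd] := wa_norms r1; have [_ ha1 _] := ha; have [_ hdda _] := hda.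
have mdm : measurable_fun setT (dwm r) by apply: continuous_measurable_fun; exact: cont_dwm.
have mddm : measurable_fun setT (ddwm r) by apply: continuous_measurable_fun; exact: cont_ddwm.
have dm_le x := dwm_le1 x r0. have ddm_le x := ddwm_le x r1.
have L1 := L2_bmul mdm dm_le hv1. have L2' := L2_bmul mdm dm_le hv2.
have L3 := L2_wmM r0 hv2. have L4 := L2_wmM r0 hw2. have L5 := L2_bmul mdm dm_le hw1.
have L6 := L2_bmul mddm ddm_le hv1.
have L7 := L2Z k ha1. have L8 := L2Z k hdda.
have ibp1 := H1_ibp (H1_dwm r1 hv) hw.
have ibp2 := H1_ibp (H1Z k hda) hw.
have -> : ip dv (fun x => dwm r x * w x + wm r x * dw x)
    - ip (fun x => dwm r x * v x + wm r x * dv x - k * dwa r x) dw =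
  ip (fun x => ddwm r x * v x + 2 * (dwm r x * dv x) - k * ddwa r x) w.
  rewrite (ipDr L5 L4 hv2) (ipBl (L2D L1 L3) L7 hw2) (ipDl L1 L3 hw2) !ip_mulC.
  rewrite (ipBl (L2D L6 (L2Z 2 L2')) L8 hw1) (ipDl L6 (L2Z 2 L2') hw1) (ipZl 2 L2' hw1).
  move: ibp1; rewrite (ipDl L6 L2' hw1) => ibp1.
  move: ibp1 ibp2; move: (ip _ _) (ip _ _) (ip _ _) (ip _ _) (ip _ _) (ip _ _) => *; lra.
have hF := L2B (L2D L6 (L2Z 2 L2')) L8.
apply: ip_bound => //; apply: le_trans (nmB (L2D L6 (L2Z 2 L2')) L8) _.
have n1 : nm (fun x => ddwm r x * v x) <= 6 * nm v by exact: nm_bmul.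
have n2 : nm (fun x => dwm r x * dv x) <= 1 * nm dv by exact: nm_bmul.
have n3 := nmD L6 (L2Z 2 L2').
have n4 : nm (fun x => 2 * (dwm r x * dv x)) = 2 * nm (fun x => dwm r x * dv x).
  by rewrite nmZ// ger0_norm.
have n5 : nm (fun x => k * ddwa r x) <= `|k| * (6 * pi).
  by rewrite nmZ// ler_wpM2l.
have -> : 6 * pi * `|k| = `|k| * (6 * pi) by rewrite mulrC.
move: n1 n2 n3 n4 n5; move: (nm _) (nm _) (nm _) (nm _) (nm _) (nm _) (nm _) (`|k| * _) => *; lra.
Qed.

(** The scaling that makes the rank two terms harmless: [pi^-1], the norm [sqrt (pi r)] of a weight
    and the bound [r^-1 sqrt (pi r)] of its derivative multiply to exactly [1]. *)
Lemma pi_cancel r i n M : 0 < r -> 0 <= i -> 0 <= n -> 0 <= M ->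
  i <= r^-1 * Num.sqrt (pi * r) * M -> n <= Num.sqrt (pi * r) -> pi^-1 * i * n <= M.
Proof.
move=> r0 i0 n0 M0 h1 h2; have p0 := @piV_gt0 R.
have pr : 0 <= pi * r by rewrite mulr_ge0 ?pi_ge0// ltW.
rewrite -mulrA; apply: (@le_trans _ _ (pi^-1 * (r^-1 * Num.sqrt (pi * r) * M * Num.sqrt (pi * r)))).
  by rewrite ler_pM2l//; apply: ler_pM.
have -> : r^-1 * Num.sqrt (pi * r) * M * Num.sqrt (pi * r) = r^-1 * M * Num.sqrt (pi * r) ^+ 2 by ring.
rewrite sqr_sqrtr// le_eqVlt; apply/orP; left; apply/eqP.
move: (@pi_neq0 R); move: (@pi R) => p pn; field.
by rewrite pn (gt_eqF r0).
Qed.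

(** Here the transform acts on [dv], so both coefficients integrate by parts, [<a, v'> = - <a', v>]
    and likewise for [b], and [pi_cancel] bounds the rank two terms. The three [nm v] come from [a],
    from [b] and from [m' v]. *)
Lemma commutator_nonlocal r v dv w k t : 1 <= r -> 0 < t -> H1 v dv -> L2 w ->
  `|ip (cv (qk t) dv) (fun x => wm r x * w x)
    - ip (cv (qk t) (fun x => dwm r x * v x + wm r x * dv x - k * dwa r x)) w|
  <= (3 * nm v + pi * `|k|) * nm w + 2 * pi^-1 * Num.sqrt (pi * r) * nm dv * nm w * Num.sqrt (pi * t).
Proof.
move=> r1 t0 hv hw; have [hv1 hv2 _] := hv.
have r0 : 0 < r by exact: lt_le_trans r1.
have rV : 0 <= r^-1 by rewrite invr_ge0 ltW.
have [ha hda nd _] := wa_norms r1; have [ha0 ha1 _] := ha.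
have [hb nb] := L2_wb r0; have na := nm_wa r0.
have [hdb ndb] := L2_wdom r0 rV (cont_dwb r0) (fun x => dwb_le x r0).
have [_ nda] := L2_wdom r0 rV (cont_dwa r0) (fun x => dwa_le x r0).
have hb1 : H1 (wb r) (dwb r) by split => //; exact: AC_wb.
have mdm : measurable_fun setT (dwm r) by apply: continuous_measurable_fun; exact: cont_dwm.
have dm_le x := dwm_le1 x r0.
have L1 := L2_bmul mdm dm_le hv1. have L3 := L2_wmM r0 hv2.
have hT := (cv_qk_contr t0 hv2).1.
have hTm := (cv_qk_contr t0 L3).1.
have L7 := L2Z k ha1. have LR := L2B L1 L7.
have [hTR nTR] := cv_qk_contr t0 LR.
have hU := L2B (L2D L1 L3) L7.
have hTU := (cv_qk_contr t0 hU).1.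
have ia : ip (wa r) dv = - ip (dwa r) v by rewrite (H1_ibp ha hv) opprK.
have ib : ip (wb r) dv = - ip (dwb r) v by rewrite (H1_ibp hb1 hv) opprK.
have [hD nD] := wm_commutator r0 t0 hv2.
move: hD nD; set D := fun x => _ => hD nD.
have hDa := L2Z (pi^-1 * ip (wa r) dv) ha0.
have -> : ip (cv (qk t) dv) (fun x => wm r x * w x)
    - ip (cv (qk t) (fun x => dwm r x * v x + wm r x * dv x - k * dwa r x)) w =
  ip (fun x => D x - pi^-1 * ip (wa r) dv * wa r x
      - cv (qk t) (fun x => dwm r x * v x - k * dwa r x) x) w.
  rewrite ip_mulC -(ipBl (L2_wmM r0 hT) hTU hw).
  congr (ip _ w); apply/funext => x.
  have -> : (fun x => dwm r x * v x + wm r x * dv x - k * dwa r x) =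
    (fun x => (fun x => wm r x * dv x) x + (fun x => dwm r x * v x - k * dwa r x) x).
    by apply/funext => y; ring.
  rewrite (cvD _ (L2_qk t0) L3 LR) /D.
  by move: (cv _ _ _) (cv _ _ _) (cv _ _ _) (ip _ _) (pi^-1 : R) => a b d e p; ring.
have key : nm (fun x => D x - pi^-1 * ip (wa r) dv * wa r x
      - cv (qk t) (fun x => dwm r x * v x - k * dwa r x) x) <=
   3 * nm v + pi * `|k| + 2 * pi^-1 * Num.sqrt (pi * r) * nm dv * Num.sqrt (pi * t).
  apply: le_trans (nmB (L2B hD hDa) hTR) _.
  have k1 := nmB hD hDa.
  have k2 := le_trans nTR (nmB L1 L7).
  have k3 : nm (fun x => dwm r x * v x) <= 1 * nm v by exact: nm_bmul.
  have k4 : nm (fun x => k * dwa r x) <= pi * `|k| by rewrite nmZ// mulrC ler_wpM2r.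
  have k5 : nm (fun x => pi^-1 * ip (wa r) dv * wa r x) <= nm v.
    rewrite nmZ// normrM ia normrN (ger0_norm (ltW (@piV_gt0 R))).
    apply: (pi_cancel r0) na; rewrite ?nm_ge0//.
    by apply: le_trans (CS ha1 hv1) _; rewrite ler_wpM2r ?nm_ge0.
  have k6 : pi^-1 * Num.sqrt (pi * r) * `|ip (wb r) dv| <= nm v.
    rewrite ib normrN mulrAC.
    apply: (pi_cancel r0) (lexx _); rewrite ?nm_ge0 ?sqrtr_ge0//.
    by apply: le_trans (CS hdb hv1) _; rewrite ler_wpM2r ?nm_ge0.
  move: nD k1 k2 k3 k4 k5 k6; rewrite mulrDr.
  have -> : pi^-1 * Num.sqrt (pi * r) * (2 * Num.sqrt (pi * t) * nm dv) =
    2 * pi^-1 * Num.sqrt (pi * r) * nm dv * Num.sqrt (pi * t) by ring.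
  move: (2 * pi^-1 * Num.sqrt (pi * r) * nm dv * Num.sqrt (pi * t)) (pi^-1 * Num.sqrt (pi * r) * `|_|) => A B.
  move: (nm _) (nm _) (nm _) (nm _) (nm _) (nm _) (nm _) => *; lra.
apply: le_trans (ip_bound (L2B (L2B hD hDa) hTR) hw key) _.
by rewrite mulrDl le_eqVlt; apply/orP; left; apply/eqP; ring.
Qed.

(** A joint constant for [commutator_local] and [commutator_nonlocal], independent of [r]. *)
Definition C0 := 6 + 6 * pi + `|gamma| * (3 + pi) : R.

(** With [r] fixed, the error [sqrt (pi r) sqrt (pi t)] disappears as [n] grows. The term
    [c * k * <a, w>] is kept exactly: its size is [sqrt r], and it is what later cancels the other
    large terms. *)
Lemma commutator r v dv w dw k : 1 <= r -> H1 v dv -> H1 w dw ->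
  evle (fun n => Bn n v dv (fun x => wm r x * w x) (fun x => dwm r x * w x + wm r x * dw x)
    - Bn n (fun x => wm r x * v x - k * wa r x)
           (fun x => dwm r x * v x + wm r x * dv x - k * dwa r x) w dw - c * k * ip (wa r) w)
   (C0 * (nm v + nm dv + `|k|) * nm w).
Proof.
move=> r1 hv hw; have [hv1 hv2 _] := hv; have [hw1 hw2 _] := hw.
have r0 : 0 < r by exact: lt_le_trans r1.
have loc := commutator_local k r1 hv hw.
have nl n := commutator_nonlocal k r1 (tn_gt0 n) hv hw1.
have E3 : ip v (fun x => wm r x * w x) = ip (fun x => wm r x * v x - k * wa r x) w + k * ip (wa r) w.
  rewrite ip_mulC (ipBl (L2_wmM r0 hv1) (L2Z k (L2_wa r0)) hw1) (ipZl k (L2_wa r0) hw1) subrK; exact: erefl.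
pose K := `|gamma| * (2 * pi^-1 * Num.sqrt (pi * r) * nm dv * nm w).
apply: (@evle_sn _ _ K) => n.
have {}nl := nl n.
rewrite /Bn E3.
set a := ip dv _ in loc *; set b := ip _ dw in loc *.
set p := ip _ _ in nl *; set q := ip _ w in nl *.
rewrite -/b.
set i := ip _ w; set j := ip (wa r) w.
have -> : c * (i + k * j) + a - gamma * p - (c * i + b - gamma * q) - c * k * j =
   (a - b) - gamma * (p - q) by ring.
apply: le_trans (ler_normB _ _) _; rewrite normrM.
have := lerD loc (ler_wpM2l (normr_ge0 gamma) nl) => h; apply: le_trans h _.
have V := nm_ge0 v; have DV := nm_ge0 dv; have W := nm_ge0 w; have kk := normr_ge0 k.
have gg := normr_ge0 gamma; have p0 := pi_ge0 R.
rewrite -/(sn n).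
have -> : (2 * nm dv + 6 * nm v + 6 * pi * `|k|) * nm w + `|gamma| * ((3 * nm v + pi * `|k|) * nm w
     + 2 / pi * Num.sqrt (pi * r) * nm dv * nm w * sn n) =
  (2 * nm dv + 6 * nm v + 6 * pi * `|k| + `|gamma| * (3 * nm v + pi * `|k|)) * nm w + K * sn n.
  by rewrite /K; ring.
rewrite lerD2r ler_wpM2r//.
rewrite /C0; move: (nm v) (nm dv) `|k| `|gamma| (pi : R) V DV kk gg p0 => x y z g P x0 y0 z0 g0 P0.
have e1 := mulr_ge0 P0 x0; have e2 := mulr_ge0 P0 y0; have e3 := mulr_ge0 g0 y0.
have e4 := mulr_ge0 g0 e1; have e5 := mulr_ge0 g0 e2; have e6 := mulr_ge0 g0 z0.
nra.
Qed.

End Weights.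

(** * The energy estimate *)

Ltac gen_ip := repeat match goal with
  |- context [@ip ?R ?f ?g] => generalize (@ip R f g); intro end.

Section Energy.
Context {R : realType}.
Local Notation mu := (@lebesgue_measure R).
Local Notation I := (Rintegral mu setT).
Implicit Types (f g h u v w m K F G du dv dw q : R -> R) (a b r s t x y z M e k Q : R).

Lemma evle_ge (F G : nat -> R) M l : (forall n, G n <= `|F n|) ->
  G n @[n --> \oo] --> l -> evle F M -> l <= M.
Proof.
move=> GF Gl h; apply/ler_addgt0Pl => e e0; rewrite addrC.
rewrite -(cvg_lim (@Rhausdorff R) Gl); apply: limr_le; first by apply/cvg_ex; exists l.
by have := h _ e0; apply: filterS => n; apply: le_trans.
Qed.

(** The test class: closed under multiplication by [m] and by [x m], and containing the trapezoids
    and the weighted unknowns [m v - k a], which are tested against themselves. *)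
Definition TC w dw := H1 w dw /\ H1 (fun x => x * w x) (fun x => w x + x * dw x).

Lemma H1_wa r v dv : 1 <= r -> H1 v dv ->
  H1 (fun x => wa r x * v x) (fun x => dwa r x * v x + wa r x * dv x).
Proof.
move=> r1; have r0 : 0 < r by exact: lt_le_trans r1.
apply: (@H1_mul _ _ _ 1); first exact: AC_wa.
- by apply: continuous_measurable_fun; exact: cont_wa.
- by apply: continuous_measurable_fun; exact: cont_dwa.
- by move=> x; exact: wa_le1.
- move=> x; apply: le_trans (dwa_le x r0) _.
  have /andP[w0 w1] := wa_bnd x r0; apply: mulr_ile1 => //; first by rewrite invr_ge0 ltW.
  by rewrite invf_le1.
Qed.

Lemma TC_wm r w dw : 1 <= r -> TC w dw ->
  TC (fun x => wm r x * w x) (fun x => dwm r x * w x + wm r x * dw x).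
Proof.
move=> r1 [h1 h2]; have r0 : 0 < r by exact: lt_le_trans r1.
split; first exact: H1_wm.
by have := H1_wm r0 h2; apply: H1_ext => x; ring.
Qed.

(* [x wm r] is the bounded multiplier [r^2 (1 - wa r)]. *)
Lemma H1_xwm r v dv : 1 <= r -> H1 v dv ->
  H1 (fun x => x * (wm r x * v x)) (fun x => wm r x * v x + x * (dwm r x * v x + wm r x * dv x)).
Proof.
move=> r1 hv; have r0 : 0 < r by exact: lt_le_trans r1.
have := H1D (H1Z (r ^+ 2) hv) (H1Z (- r ^+ 2) (H1_wa r1 hv)); apply: H1_ext => x;
  by rewrite /wa /wm /dwa /dwm; field; rewrite den_neq0.
Qed.

Lemma TC_xwm r w dw : 1 <= r -> TC w dw ->
  TC (fun x => x * (wm r x * w x)) (fun x => wm r x * w x + x * (dwm r x * w x + wm r x * dw x)).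
Proof.
move=> r1 [h1 h2]; split; first exact: H1_xwm.
by have := H1_xwm r1 h2; apply: H1_ext => x; ring.
Qed.

(** [x * wa r x] is [r * wb r x], square integrable for fixed [r], so the subtracted multiple of [a]
    does not leave the test class. *)
Lemma TC_wu r v dv k : 1 <= r -> H1 v dv ->
  TC (fun x => wm r x * v x - k * wa r x)
     (fun x => dwm r x * v x + wm r x * dv x - k * dwa r x).
Proof.
move=> r1 hv; have r0 : 0 < r by exact: lt_le_trans r1.
split; first exact: H1_wu.
have hb : H1 (wb r) (dwb r).
  have rV : 0 <= r^-1 by rewrite invr_ge0 ltW.
  have [hdb _] := L2_wdom r0 rV (cont_dwb r0) (fun x => dwb_le x r0).
  by have [hb _] := L2_wb r0; split => //; exact: AC_wb.
have := H1D (H1_xwm r1 hv) (H1Z (- (k * r)) hb); apply: H1_ext => x;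
  by rewrite /wa /wb /wm /dwa /dwb /dwm; field; rewrite den_neq0.
Qed.

Variables gamma c : R.
Hypotheses (hc0 : 0 <= gamma -> 0 < c) (hc1 : gamma < 0 -> gamma ^+ 2 / 4 < c).

Lemma c_gt0 : 0 < c.
Proof.
have [/hc0//|g0] := leP 0 gamma.
by apply: le_lt_trans (hc1 g0); rewrite divr_ge0 ?sqr_ge0.
Qed.

Local Notation B := (Bn gamma c).

(** [M] depends only on the potential and the operator, and [C2] on [C1] besides, so the estimate is
    uniform over a family [u]. The last conclusion is a weak [L^2] bound on [u''], read off from the
    equation. *)
Lemma energy q Q : measurable_fun setT q -> (forall x, `|q x| <= Q) ->
  (forall e, 0 < e -> exists M, 0 < M /\ forall x, M <= `|x| -> `|q x| <= e) ->
  exists M, 0 < M /\ forall C1, exists C2, forall u du, TC u du ->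
    nm (fun x => chi (- M) M x * (q x * u x)) <= C1 ->
    (forall w dw, TC w dw -> evle (fun n => B n u du w dw - ip (fun x => q x * u x) w) (C1 * nm w)) ->
    [/\ nm u <= C2, nm du <= C2 & forall w dw, TC w dw -> `|ip du dw| <= C2 * nm w].
Proof.
move=> mq qQ q0; have [d [C [d0 C0 coer]]] := coercivity hc0 hc1.
have d2 : 0 < d / 2 by rewrite divr_gt0.
(* Outside [[-M, M]] the potential is at most [d / 2], half of the coercivity constant, and is
   absorbed. *)
have [M [M0 hM]] := q0 _ d2; exists M; split=> // C1.
(* Testing with [u] itself gives [d / 2 * nm u ^+ 2 + d * nm du ^+ 2 <= 2 * C1 * nm u], which bounds
   both norms by [U0]. *)
pose U0 := 4 * C1 / d.
(* The second summand pays for [<du, dw>] when the equation is solved for it: the defect [C1], the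
   potential term [C1 + d / 2 * U0], the zeroth order term and the nonlocal term. *)
exists (U0 + (2 * C1 + `|c| * U0 + `|gamma| * U0 + d / 2 * U0)) => u du hu n1 ev.
have [[hu1 hu2 hu3] _] := hu.
have C10 : 0 <= C1 by exact: le_trans (nm_ge0 _) n1.
have U00 : 0 <= U0 by rewrite divr_ge0 ?(ltW d0)// mulr_ge0.
have hqu : L2 (fun x => q x * u x) by exact: L2_bmul mq qQ hu1.
have hc : L2 (fun x => chi (- M) M x * (q x * u x)).
  by apply: L2_bmul hqu; [exact: measurable_chi|exact: chi_le1].
have nqu : nm (fun x => q x * u x) <= C1 + d / 2 * nm u.
  have hr : L2 (fun x => q x * u x - chi (- M) M x * (q x * u x)) by exact: L2B.
  have E : nm (fun x => q x * u x) = nm (fun x => chi (- M) M x * (q x * u x) +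
      (q x * u x - chi (- M) M x * (q x * u x))).
    by apply: nm_ext => x; rewrite addrC subrK.
  rewrite E; apply: le_trans (nmD hc hr) _; apply: lerD => //.
  have hdu : L2 (fun x => d / 2 * u x) by exact: L2Z.
  rewrite -[d / 2 in leRHS]gtr0_norm// -(nmZ _ hu1).
  apply: nm_dom => // x; rewrite /chi; case: ifPn => h; first by rewrite mul1r subrr normr0.
  rewrite mul0r subr0 normrM [leRHS]normrM (gtr0_norm d2) ler_wpM2r//; apply: hM.
  by rewrite leNgt; apply: contra h => h; rewrite -ler_norml ltW.
have U := nm_ge0 u; have DU := nm_ge0 du.
have key : d * (nm u ^+ 2 + nm du ^+ 2) - ip (fun x => q x * u x) u <= C1 * nm u.
  apply: (evle_ge (G := fun n => d * (nm u ^+ 2 + nm du ^+ 2) - ip (fun x => q x * u x) u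
     - C * nm du ^+ 2 * tn n) _ _ (ev _ _ hu)).
    move=> n; apply: le_trans (ler_norm _); rewrite /Bn !ipff.
    have := coer _ _ _ (tn_gt0 n) (And3 hu1 hu2 hu3).
    gen_ip; move: (nm u) (nm du) (tn n) => *; lra.
  rewrite -[X in _ --> X]subr0; apply: cvgB; first exact: cvg_cst.
  by rewrite -[X in _ --> X](mulr0 (C * nm du ^+ 2)); apply: cvgM; [exact: cvg_cst|exact: tn_cvg].
have k2 : ip (fun x => q x * u x) u <= (C1 + d / 2 * nm u) * nm u.
  by apply: le_trans (ler_norm _) _; exact: ip_bound.
have k3 : d / 2 * nm u ^+ 2 + d * nm du ^+ 2 <= 2 * C1 * nm u by move: key k2; lra.
have DD := sqr_ge0 (nm du); have dDD : 0 <= d * nm du ^+ 2 by rewrite mulr_ge0// ltW.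
have bu : nm u <= U0.
  rewrite /U0 ler_pdivlMr//; have [<-|un] := eqVneq 0 (nm u); first by rewrite mul0r mulr_ge0.
  have u0 : 0 < nm u by rewrite lt_def eq_sym un.
  rewrite -(ler_pM2r u0); move: k3 dDD; rewrite expr2; lra.
have bdu : nm du <= U0.
  rewrite -(ler_pXn2r (n := 2)) ?nnegrE// -(ler_pM2l d0).
  have e1 : d * nm du ^+ 2 <= 2 * C1 * U0.
    have := ler_wpM2l (mulr_ge0 (ler0n R 2) C10) bu.
    have : 0 <= d / 2 * nm u ^+ 2 by rewrite mulr_ge0 ?sqr_ge0// ltW.
    by move: k3; lra.
  apply: le_trans e1 _; have -> : d * U0 ^+ 2 = 4 * C1 * U0.
    by rewrite expr2 mulrA /U0 [d * _]mulrC divfK// gt_eqF.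
  by have := mulr_ge0 C10 U00; lra.
have rest0 : 0 <= 2 * C1 + `|c| * U0 + `|gamma| * U0 + d / 2 * U0.
  by rewrite !addr_ge0// mulr_ge0// ltW.
split; [by lra|by lra|move=> w dw hw].
have [[hw1 hw2 _] _] := hw; have W := nm_ge0 w.
have hT n := (cv_qk_contr (tn_gt0 n) hu2).1; have nT n := (cv_qk_contr (tn_gt0 n) hu2).2.
have b1 : `|ip u w| <= U0 * nm w by exact: ip_bound.
have b2 n : `|ip (cv (qk (tn n)) du) w| <= U0 * nm w.
  by apply: ip_bound => //; exact: le_trans (nT n) bdu.
have b3 : `|ip (fun x => q x * u x) w| <= (C1 + d / 2 * U0) * nm w.
  by apply: ip_bound => //; apply: le_trans nqu _; rewrite lerD2l ler_wpM2l// ltW.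
have b4 n : `|ip (fun x => q x * u x) w - c * ip u w + gamma * ip (cv (qk (tn n)) du) w| <=
   (C1 + d / 2 * U0) * nm w + `|c| * (U0 * nm w) + `|gamma| * (U0 * nm w).
  apply: le_trans (ler_normD _ _) _; apply: lerD; last by rewrite normrM ler_wpM2l.
  by apply: le_trans (ler_normB _ _) _; apply: lerD => //; rewrite normrM ler_wpM2l.
have : evle (fun=> ip du dw) (C1 * nm w + ((C1 + d / 2 * U0) * nm w + `|c| * (U0 * nm w) + `|gamma| * (U0 * nm w))).
  apply: evle_ext (evleD (ev _ _ hw) (evle_bnd b4)) => n; rewrite /Bn.
  by gen_ip; ring.
move/evle_cst => h2; apply: le_trans h2 _.
have := mulr_ge0 U00 W; lra.
Qed.

End Energy.

(** * First and second moments *)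

Ltac gen_B := repeat match goal with
  |- context [@Bn ?R ?a ?b ?n ?f ?g ?h ?k] => generalize (@Bn R a b n f g h k); intro end.

Ltac gen_nm := repeat match goal with
  |- context [@nm ?R ?f] => generalize (@nm R f); intro end.

Section Passes.
Context {R : realType}.
Local Notation mu := (@lebesgue_measure R).
Local Notation I := (Rintegral mu setT).
Implicit Types (f g h u v w m K F G du dv dw q : R -> R) (a b r s t x y z M e k Q : R).

Lemma L2_fatou (F : nat -> R -> R) f M : (forall n, L2 (F n)) -> (forall n, nm (F n) <= M) ->
  measurable_fun setT f -> {ae mu, forall x, F n x @[n --> \oo] --> f x} -> L2 f /\ nm f <= M.
Proof.
move=> hF FM mf Ff; have M0 : 0 <= M by exact: le_trans (nm_ge0 _) (FM 0%N).
have [|||||s1 _ h] := @fatou_I R (fun n x => F n x ^+ 2) (fun x => f x ^+ 2) (M ^+ 2).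
- by move=> n; case: (hF n).
- by move=> n x; exact: sqr_ge0.
- by move=> n; rewrite -nm_sqr lerXn2r ?nnegrE ?nm_ge0.
- exact: measurable_sqr.
- by apply: aeS Ff => x h; apply: cvgM.
by split; [split|rewrite -(ler_pXn2r (n := 2))// ?nnegrE ?nm_ge0// nm_sqr].
Qed.

Definition rn n : R := n.+1%:R.
Lemma rn_ge1 n : 1 <= rn n. Proof. by rewrite ler1n. Qed.
Lemma rn_gt0 n : 0 < rn n. Proof. by rewrite ltr0n. Qed.

Lemma waE n x : wa (rn n) x = (1 + x ^+ 2 * tn n ^+ 2)^-1.
Proof.
rewrite /wa /tn -/(rn n) exprVn; have := rn_gt0 n; move: (rn n) => r r0.
have r2 : 0 < r ^+ 2 by rewrite exprn_gt0.
have := den_neq0 x r0; rewrite addrC => d.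
rewrite -[1 in RHS](divff (lt0r_neq0 r2)) -mulrDl invfM invrK mulrC addrC.
by rewrite [X in X^-1]addrC.
Qed.

Lemma wa_cvg x : wa (rn n) x @[n --> \oo] --> (1 : R).
Proof.
rewrite (_ : (fun n => _) = fun n => (1 + x ^+ 2 * tn n ^+ 2)^-1); last by apply/funext => n; exact: waE.
rewrite -[X in _ --> X]invr1; apply: cvgV; first exact: oner_neq0.
rewrite -[X in _ --> X]addr0; apply: cvgD; first exact: cvg_cst.
rewrite -[X in _ --> X](mulr0 (x ^+ 2)); apply: cvgM; first exact: cvg_cst.
by rewrite -[X in _ --> X](mulr0 0); apply: cvgM; exact: tn_cvg.
Qed.

Lemma wm_cvg x : wm (rn n) x @[n --> \oo] --> x.
Proof.
rewrite (_ : (fun n => _) = fun n => x * wa (rn n) x); last by apply/funext => n; exact: wmE.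
by rewrite -[X in _ --> X]mulr1; apply: cvgM; [exact: cvg_cst|exact: wa_cvg].
Qed.

Lemma dwa_cvg x : dwa (rn n) x @[n --> \oo] --> (0 : R).
Proof.
apply/cvgrPdist_le => e e0; have /cvgrPdist_le /(_ _ e0) := @tn_cvg R; apply: filterS => n.
rewrite !sub0r !normrN; apply: le_trans; apply: le_trans (dwa_le x (rn_gt0 n)) _.
rewrite (gtr0_norm (tn_gt0 n)) ler_piMr ?(ltW (tn_gt0 n))//.
by have /andP[] := wa_bnd x (rn_gt0 n).
Qed.

Lemma dwmE r x : 0 < r -> dwm r x = wa r x + x * dwa r x.
Proof. by move=> r0; rewrite /dwm /wa /dwa; field; rewrite den_neq0. Qed.

Lemma dwm_cvg x : dwm (rn n) x @[n --> \oo] --> (1 : R).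
Proof.
rewrite (_ : (fun n => _) = fun n => wa (rn n) x + x * dwa (rn n) x); last first.
  by apply/funext => n; exact: dwmE (rn_gt0 n).
rewrite -[X in _ --> X]addr0; apply: cvgD; first exact: wa_cvg.
by rewrite -[X in _ --> X](mulr0 x); apply: cvgM; [exact: cvg_cst|exact: dwa_cvg].
Qed.

Lemma wm_le_id r x : 0 < r -> `|wm r x| <= `|x|.
Proof. by move=> r0; rewrite wmE normrM ler_piMr// wa_le1. Qed.

Lemma measurable_xM f : measurable_fun setT f -> measurable_fun setT (fun x => x * f x).
Proof. by move=> mf; apply: measurable_funM => //; exact: measurable_id. Qed.

Lemma AC_xM v dv : H1 v dv -> abscont (fun x => x * v x) (fun x => v x + x * dv x).
Proof.
move=> [[mv _] [mdv _] ac].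
have acx : abscont (fun x : R => x) (fun=> 1).
  by apply: AC_C1; exact: contC.
have mid : measurable_fun setT (fun x : R => x) by exact: measurable_id.
have := ACM mid mv (measurable_cst (1 : R)) mdv acx ac.
by apply: AC_ext => x //; rewrite mul1r.
Qed.

(** The limit [r -> infinity]. Pointwise [m v - kn a] tends to [x v - k]; Fatou gives membership in
    [L^2], and [weak_cvg] carries over the bound on the second derivative. *)
Lemma weighted_limit v dv (kn : nat -> R) k M : H1 v dv -> kn n @[n --> \oo] --> k ->
  (forall n, nm (fun x => wm (rn n) x * v x - kn n * wa (rn n) x) <= M) ->
  (forall n, nm (fun x => dwm (rn n) x * v x + wm (rn n) x * dv x - kn n * dwa (rn n) x) <= M) ->
  H1 (fun x => x * v x - k) (fun x => v x + x * dv x) /\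
  ((forall n w dw, TC w dw ->
     `|ip (fun x => dwm (rn n) x * v x + wm (rn n) x * dv x - kn n * dwa (rn n) x) dw| <= M * nm w) ->
   forall w dw, TC w dw -> `|ip (fun x => v x + x * dv x) dw| <= M * nm w).
Proof.
move=> hv kc b1 b2; have [hv1 hv2 hv3] := hv; have mv := L2_mf hv1; have mdv := L2_mf hv2.
have hu n := H1_wu (kn n) (rn_ge1 n) hv.
have c1 x : dwm (rn n) x * v x + wm (rn n) x * dv x - kn n * dwa (rn n) x @[n --> \oo] --> v x + x * dv x.
  rewrite -[X in _ --> X]subr0 -(mulr0 k); apply: cvgB.
    apply: cvgD; last by apply: cvgM; [exact: wm_cvg|exact: cvg_cst].
    by rewrite -[X in _ --> X]mul1r; apply: cvgM; [exact: dwm_cvg|exact: cvg_cst].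
  by apply: cvgM => //; exact: dwa_cvg.
have [h1 _] : L2 (fun x => x * v x - k) /\ nm (fun x => x * v x - k) <= M.
  apply: (L2_fatou _ b1) => [n||].
  - by case: (hu n).
  - by apply: measurable_funB; [exact: measurable_xM|exact: measurable_cst].
  - apply: aeW => x; apply: cvgB.
      by apply: cvgM; [exact: wm_cvg|exact: cvg_cst].
    by rewrite -[X in _ --> X]mulr1; apply: cvgM => //; exact: wa_cvg.
have [h2 _] : L2 (fun x => v x + x * dv x) /\ nm (fun x => v x + x * dv x) <= M.
  apply: (L2_fatou _ b2) => [n||].
  - by case: (hu n).
  - by apply: measurable_funD => //; exact: measurable_xM.
  - by apply: aeW => x; exact: c1.
split.
  split=> //; have ack : abscont (fun=> - k) (fun=> 0).
    by apply: AC_C1; exact: contC.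
  by have := ACD (AC_xM hv) ack; apply: AC_ext => x //; rewrite addr0.
move=> b3 w dw hw; have [[hw1 hw2 _] _] := hw.
have cv : ip (fun x => dwm (rn n) x * v x + wm (rn n) x * dv x - kn n * dwa (rn n) x) dw
    @[n --> \oo] --> ip (fun x => v x + x * dv x) dw.
  apply: (weak_cvg _ b2) => // [n|]; first by case: (hu n).
  by apply: aeW => x; exact: c1.
by apply: (evle_lim cv); apply: evle_bnd => n; exact: b3.
Qed.

Variables gamma c : R.
Hypotheses (hc0 : 0 <= gamma -> 0 < c) (hc1 : gamma < 0 -> gamma ^+ 2 / 4 < c).
Local Notation B := (Bn gamma c).

Lemma C0_ge0 : 0 <= C0 gamma.
Proof.
rewrite /C0; have p0 := pi_ge0 R; have g0 := normr_ge0 gamma.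
by have := mulr_ge0 g0 p0; lra.
Qed.

(** The weak equation with source [f], stated as a limit of regularized forms, so that no transform
    of [v] or [dv] has to be named. *)
Definition WE v dv f := forall w dw, TC w dw -> B n v dv w dw @[n --> \oo] --> ip f w.

Lemma evle_sub (F : nat -> R) l : F n @[n --> \oo] --> l -> evle (fun n => F n - l) 0.
Proof.
move=> h; apply: evle_cvg; rewrite -(subrr l); apply: cvgB => //; exact: cvg_cst.
Qed.

Lemma evleN (F : nat -> R) M : evle F M -> evle (fun n => - F n) M.
Proof. by move=> h e e0; have := h _ e0; apply: filterS => n; rewrite normrN. Qed.

Variables (q : R -> R) (Q : R).
Hypotheses (hq : L2 q) (qQ : forall x, `|q x| <= Q).
Hypothesis q0 : forall e, 0 < e -> exists M, 0 < M /\ forall x, M <= `|x| -> `|q x| <= e.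

Lemma Q_ge0 : 0 <= Q. Proof. exact: le_trans (qQ 0). Qed.

(** [u = m v] satisfies the equation of [v] with defect bounded uniformly in [r]: the commutator is
    uniform when [k = 0], and the source becomes [m f], dominated by [x f]. *)
Lemma first_moment v dv f : H1 v dv -> L2 f -> L2 (fun x => x * f x) ->
  WE v dv (fun x => q x * v x + f x) -> TC v dv.
Proof.
move=> hv hf hxf we; have [hv1 hv2 _] := hv.
have mq := L2_mf hq.
(* Three contributions to [C1]: the potential term on [[-M, M]], where the weight is at most [M];
   the source [x f]; the commutator. *)
have [M [M0 /(_ (Q * M * nm v + nm (fun x => x * f x) + C0 gamma * (nm v + nm dv + 0)))]] := energy hc0 hc1 mq qQ q0.
set C1 := _ + _ => -[C2 hC2].
have C00 := C0_ge0.
have nx := nm_ge0 (fun x => x * f x).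
have X1 : 0 <= C0 gamma * (nm v + nm dv + 0) by rewrite mulr_ge0// !addr_ge0 ?nm_ge0.
have main n : [/\ nm (fun x => wm (rn n) x * v x - 0 * wa (rn n) x) <= C2,
    nm (fun x => dwm (rn n) x * v x + wm (rn n) x * dv x - 0 * dwa (rn n) x) <= C2 &
    forall w dw, TC w dw ->
     `|ip (fun x => dwm (rn n) x * v x + wm (rn n) x * dv x - 0 * dwa (rn n) x) dw| <= C2 * nm w].
  have r0 := rn_gt0 n; have r1 := rn_ge1 n; move: (rn n) r0 r1 => r r0 r1.
  have hu := TC_wu 0 r1 hv; have [[hu1 _ _] _] := hu.
  have hqu := L2_bmul mq qQ hu1.
  have hmf : L2 (fun x => wm r x * f x) by exact: L2_wmM.
  have nmf : nm (fun x => wm r x * f x) <= nm (fun x => x * f x).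
    by apply: nm_dom => // x; rewrite normrM [leRHS]normrM ler_wpM2r// wm_le_id.
  apply: hC2 => //.
    apply: (@le_trans _ _ (nm (fun x => (Q * M) * v x))).
      apply: nm_dom.
      - by apply: L2_bmul hqu; [exact: measurable_chi|exact: chi_le1].
      - exact: L2Z.
      - move=> x; rewrite /chi; case: ifPn => h; last by rewrite mul0r normr0.
        have xM : `|x| <= M by rewrite ler_norml.
        rewrite mul1r mul0r subr0 [leRHS]normrM ger0_norm ?mulr_ge0 ?Q_ge0 ?(ltW M0)//.
        rewrite normrM (normrM (wm r x)) mulrA ler_wpM2r//; apply: ler_pM => //.
        exact: le_trans (wm_le_id x r0) xM.
    rewrite nmZ// ger0_norm ?mulr_ge0 ?Q_ge0 ?(ltW M0)//.
    by rewrite /C1 -addrA lerDl addr_ge0.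
  move=> w dw hw; have [hw0 _] := hw; have [hw1 _ _] := hw0.
  have e1 := evleN (commutator gamma c 0 r1 hv hw0).
  have e2 := evle_sub (we _ _ (TC_wm r1 hw)).
  have e3 : `|ip (fun x => wm r x * f x) w| <= nm (fun x => x * f x) * nm w by exact: ip_bound.
  have e4 := @evle_bnd R (fun=> ip (fun x => wm r x * f x) w) _ (fun _ => e3).
  have E : ip (fun x => q x * v x + f x) (fun x => wm r x * w x) =
     ip (fun x => q x * (wm r x * v x - 0 * wa r x)) w + ip (fun x => wm r x * f x) w.
    rewrite ip_mulC -(ipDl hqu hmf hw1); congr (ip _ w); apply/funext => x; ring.
  rewrite normr0 in e1.
  apply: (evle_le _ (evle_ext _ (evleD (evleD e1 e2) e4))); last first.
    by move=> k; rewrite E; gen_B; gen_ip; ring.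
  have X2 : 0 <= Q * M * nm v * nm w by rewrite !mulr_ge0 ?Q_ge0 ?(ltW M0) ?nm_ge0.
  by rewrite /C1 addr0 !mulrDl; move: X2; clear; gen_nm; lra.
have [h _] := weighted_limit hv (cvg_cst (0 : R)) (fun n => let: And3 a _ _ := main n in a) (fun n => let: And3 _ a _ := main n in a).
by split=> //; move: h; apply: H1_ext => x //; rewrite subr0.
Qed.

(** Expanding a square gives [2|f| <= (1 + x^2) f^2 + 1 / (1 + x^2)], and the right-hand side is
    summable. *)
Lemma summ_moment f : L2 f -> L2 (fun x => x * f x) -> summ f.
Proof.
move=> hf hxf; have sw := @summ_wa R 1 ltr01.
apply: (@summ_dom _ (fun x => f x ^+ 2 + (x * f x) ^+ 2 + wa 1 x)); first exact: L2_mf.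
  move=> x; rewrite exprMn -(real_normK (num_real (f x))).
  have d0 := den_gt0 x (ltr01 : 0 < 1 :> R).
  have W : wa 1 x * (x ^+ 2 + 1) = 1.
    by rewrite /wa expr1n divfK// -(expr1n _ 2) den_neq0.
  have W0 : 0 <= wa 1 x by have /andP[] := wa_bnd x (ltr01 : 0 < 1 :> R).
  have s0 := normr_ge0 (f x); move: `|f x| (wa 1 x) W W0 s0 => s W; set D := _ + 1 => WD W0 s0.
  have h : 0 <= W * (D * s - 1) ^+ 2 by rewrite mulr_ge0// sqr_ge0.
  have E : W * (D * s - 1) ^+ 2 = (W * D) * D * s ^+ 2 - 2 * (W * D) * s + W by ring.
  rewrite E WD /D in h; lra.
by apply: summD => //; apply: summD; [case: hf|case: hxf].
Qed.

Lemma L2_xder v dv : TC v dv -> L2 (fun x => x * dv x).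
Proof.
move=> [[hv _ _] [_ h _]]; have := L2B h hv; congr L2; apply/funext => x.
by rewrite addrAC subrr add0r.
Qed.

(* No rank one term [pi^-1 * I dv] appears because the integral of [dv] vanishes. *)
Lemma xstep v dv w dw : TC v dv -> TC w dw ->
  evle (fun n => B n v dv (fun x => x * w x) (fun x => w x + x * dw x)
    - B n (fun x => x * v x) (fun x => v x + x * dv x) w dw
    - 2 * ip dv w - gamma * ip (cv (qk (tn n)) v) w) 0.
Proof.
move=> hv hw; have hxdv := L2_xder hv; have hxdw := L2_xder hw.
have [hv0 [hxv1 hxv2 _]] := hv; have [hv1 hv2 _] := hv0.
have [hw0 [hxw1 hxw2 _]] := hw; have [hw1 hw2 _] := hw0.
have sdv := summ_moment hv2 hxdv; have sw := summ_moment hw1 hxw1.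
have Idv := H1_int0 hv0 sdv.
pose P n := ip (cv (qk (tn n)) dv) (fun x => x * w x)
  - ip (cv (qk (tn n)) (fun x => v x + x * dv x)) w + ip (cv (qk (tn n)) v) w.
have Pb n : `|P n| <= 0 + (pi^-1 * nm dv * I (fun x => `|w x|)) * sn n.
  have t0 := @tn_gt0 R n; rewrite /P add0r; set t := tn n in t0 *.
  have [h1 _] := cv_qk_contr t0 hv2; have [h2 _] := cv_qk_contr t0 hxv2.
  have [h3 _] := cv_qk_contr t0 hv1.
  have s1 := L2M h1 hxw1; have s2 := L2M h2 hw1; have s3 := L2M h3 hw1.
  have -> : ip (cv (qk t) dv) (fun x => x * w x) - ip (cv (qk t) (fun x => v x + x * dv x)) w
      + ip (cv (qk t) v) w = I (fun x => pi^-1 * cv (sk t) dv x * w x).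
    rewrite -I_B// -I_D//; last exact: summB.
    apply: I_ext => x; have := x_cv_qk x t0 hv2 sdv hxdv; rewrite Idv => E.
    rewrite (cvD _ (L2_qk t0) hv1 hxdv) [_ * (x * w x)]mulrCA mulrA E.
    by move: (pi^-1 : R) (cv _ _ _) (cv _ _ _) (cv _ _ _) => *; ring.
  have -> : pi^-1 * nm dv * I (fun x => `|w x|) * sn n =
      I (fun x => (pi^-1 * (sn n * nm dv)) * `|w x|).
    by rewrite I_Z; [ring|exact: summ_norm].
  have p0 : 0 <= pi^-1 :> R by apply: ltW; exact: piV_gt0.
  apply: I_dom; last by apply: summZ; exact: summ_norm.
    apply: measurable_funM; last exact: L2_mf.
    apply: measurable_funM; first exact: measurable_cst.
    by apply: measurable_cv; [exact: measurable_sk|exact: L2_mf].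
  move=> x; rewrite normrM ler_wpM2r// normrM (ger0_norm p0) ler_wpM2l//.
  exact: cv_sk_le.
apply: (@evle_sn _ _ _ (`|gamma| * (pi^-1 * nm dv * I (fun x => `|w x|)))) => n.
have h : `|gamma * P n| <= `|gamma| * (pi^-1 * nm dv * I (fun x => `|w x|)) * sn n.
  by rewrite normrM -mulrA ler_wpM2l//; have := Pb n; rewrite add0r.
rewrite add0r; apply: le_trans h; rewrite -(normrN (gamma * P n)) le_eqVlt.
apply/orP; left; apply/eqP; congr `|_|.
have i1 : ip v (fun x => x * w x) = ip (fun x => x * v x) w by exact: ip_mulC.
have i2 : ip dv (fun x => w x + x * dw x) = ip dv w + ip dv (fun x => x * dw x) by exact: ipDr.
have i3 : ip (fun x => v x + x * dv x) dw = ip v dw + ip dv (fun x => x * dw x).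
  by rewrite ip_mulC; exact: ipDl.
have i4 := H1_ibp hv0 hw0.
rewrite /Bn /P i1 i2 i3 i4.
set a := ip (fun x => x * v x) w; set b := ip v dw; set d := ip dv _; set e := ip _ w.
set e' := ip _ (fun x => x * w x); set e2 := ip _ w.
by ring.
Qed.

(** [x v] is weighted by [m], so the equation of [v] is tested with [x m w]. Three multiples of
    [<a, w>] are too large as [r] grows: [kf], from the [x^-2] tail of [f];
    [gamma * pi^-1 * <a, v>], from commuting [m] with the transform of [v]; and [- c * k], from the
    subtraction. The choice of [k] makes their sum zero. *)
Lemma second_moment v dv f kf : TC v dv -> L2 f -> L2 (fun x => x * f x) ->
  L2 (fun x => x * (x * f x) - kf) -> WE v dv (fun x => q x * v x + f x) ->
  exists k C, H1 (fun x => x * (x * v x) - k) (fun x => x * v x + x * (v x + x * dv x)) /\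
    forall w dw, TC w dw -> `|ip (fun x => x * v x + x * (v x + x * dv x)) dw| <= C * nm w.
Proof.
move=> hv hf hxf hF we; have hxdv := L2_xder hv.
have [hv0 hx0] := hv; have [hv1 hv2 _] := hv0; have [hxv1 hxv2 _] := hx0.
have sv := summ_moment hv1 hxv1.
have c0 := c_gt0 hc0 hc1; have cn : c != 0 by rewrite gt_eqF.
have mq := L2_mf hq.
have p0 : 0 <= pi^-1 :> R by apply: ltW; exact: piV_gt0.
(* The solution of [c * kn n = kf + gamma * pi^-1 * <a, v>]. Its limit [k] is the coefficient of the
   [x^-2] tail of [v], and [K0] bounds all the [kn n]. *)
pose kn n := (kf + gamma * pi^-1 * ip (wa (rn n)) v) / c.
pose k := (kf + gamma * pi^-1 * I v) / c.
pose K0 := (`|kf| + `|gamma| * pi^-1 * I (fun x => `|v x|)) / c.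
have kc : kn n @[n --> \oo] --> k.
  apply: cvgM; last exact: cvg_cst; apply: cvgD; first exact: cvg_cst.
  apply: cvgM; first exact: cvg_cst.
  apply: (dct_I _ _ (summ_norm sv)).
  - by move=> n; exact: summ_mf (L2M (L2_wa (rn_gt0 n)) hv1).
  - exact: L2_mf.
  - apply: aeW => x; rewrite -[X in _ --> X]mul1r.
    by apply: cvgM; [exact: wa_cvg|exact: cvg_cst].
  - by move=> n x; rewrite normrM ler_piMl// wa_le1// rn_gt0.
have kb n : `|kn n| <= K0.
  rewrite /kn /K0 normrM (gtr0_norm (_ : 0 < c^-1)) ?invr_gt0// ler_wpM2r ?invr_ge0 ?(ltW c0)//.
  apply: le_trans (ler_normD _ _) _; rewrite lerD2l normrM normrM (ger0_norm p0).
  rewrite ler_wpM2l ?mulr_ge0//.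
  apply: I_dom; last exact: summ_norm.
    exact: summ_mf (L2M (L2_wa (rn_gt0 n)) hv1).
  by move=> x; rewrite normrM ler_piMl// wa_le1// rn_gt0.
have K00 : 0 <= K0 by exact: le_trans (normr_ge0 _) (kb 0%N).
pose v1 x := x * v x; pose dv1 x := v x + x * dv x; pose F x := x * (x * f x) - kf.
pose A := Q * nm v1; pose A' := C0 gamma * (nm v1 + nm dv1 + K0).
(* What is left after the cancellation: [k q a], [a F], the local term [2 m v'] from multiplying by
   [x], and two nonlocal terms bounded by [nm v1], namely the [b] part in [D] and the transform of
   [m v]. *)
pose A2 := K0 * nm q + nm F + 2 * nm (fun x => x * dv x) + 2 * `|gamma| * nm v1.
have [M [M0 /(_ (M * A + K0 * nm q + A' + A2))]] := energy hc0 hc1 mq qQ q0.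
set C1 := _ + _ => -[C2 hC2].
have C00 := C0_ge0.
have A0 : 0 <= M * A by rewrite !mulr_ge0 ?nm_ge0 ?Q_ge0 ?(ltW M0).
have Kq0 : 0 <= K0 * nm q by rewrite mulr_ge0 ?nm_ge0.
have A'0 : 0 <= A' by rewrite mulr_ge0// !addr_ge0 ?nm_ge0.
have A20 : 0 <= A2.
  have := nm_ge0 F; have := nm_ge0 (fun x => x * dv x); have := mulr_ge0 (normr_ge0 gamma) (nm_ge0 v1).
  by rewrite /A2 -[2 * `|gamma| * _]mulrA; move: Kq0; clear; gen_nm; lra.
have main n : [/\ nm (fun x => wm (rn n) x * v1 x - kn n * wa (rn n) x) <= C2,
    nm (fun x => dwm (rn n) x * v1 x + wm (rn n) x * dv1 x - kn n * dwa (rn n) x) <= C2 &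
    forall w dw, TC w dw ->
     `|ip (fun x => dwm (rn n) x * v1 x + wm (rn n) x * dv1 x - kn n * dwa (rn n) x) dw| <= C2 * nm w].
  have kE : c * kn n = kf + gamma * pi^-1 * ip (wa (rn n)) v by rewrite /kn mulrC divfK.
  have r0 := rn_gt0 n; have r1 := rn_ge1 n; have := kb n.
  move: (kn n) kE; move: (rn n) r0 r1 => r r0 r1 kap kE kapb.
  have hu := TC_wu kap r1 hx0; have [[hu1 _ _] _] := hu.
  have hqu := L2_bmul mq qQ hu1.
  have ha := L2_wa r0; have ma := L2_mf ha.
  have hqa : L2 (fun x => q x * wa r x) by exact: L2_bmul mq qQ ha.
  have nqa : nm (fun x => q x * wa r x) <= nm q.
    by apply: nm_dom => // x; rewrite normrM ler_piMr// wa_le1.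
  have hFa : L2 (fun x => wa r x * F x) by apply: L2_bmul ma _ hF => x; exact: wa_le1.
  have nFa : nm (fun x => wa r x * F x) <= 1 * nm F.
    by apply: nm_bmul => // x; exact: wa_le1.
  have hmdv : L2 (fun x => wm r x * dv x) by exact: L2_wmM.
  have nmdv : nm (fun x => wm r x * dv x) <= nm (fun x => x * dv x).
    by apply: nm_dom => // x; rewrite normrM [leRHS]normrM ler_wpM2r// wm_le_id.
  have hmv : L2 (fun x => wm r x * v x) by exact: L2_wmM.
  have nmv : nm (fun x => wm r x * v x) <= nm v1.
    by apply: nm_dom => // x; rewrite normrM [leRHS]normrM ler_wpM2r// wm_le_id.
  (* Since [b = r^-1 x a], the coefficient [<b, v>] is [r^-1 <a, x v>]; the first moment of [v]
     makes this small enough to offset the norm of [b]. *)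
  have bv : pi^-1 * Num.sqrt (pi * r) * `|ip (wb r) v| <= nm v1.
    rewrite mulrAC; apply: (pi_cancel r0) (lexx _); rewrite ?nm_ge0 ?sqrtr_ge0//.
    have -> : ip (wb r) v = r^-1 * ip (wa r) v1.
      rewrite -I_Z; last exact: L2M.
      by apply: I_ext => x; rewrite (wbE x r0) /v1; ring.
    rewrite normrM (gtr0_norm (_ : 0 < r^-1)) ?invr_gt0// -mulrA ler_wpM2l ?invr_ge0 ?(ltW r0)//.
    by apply: le_trans (CS ha hxv1) _; rewrite ler_wpM2r ?nm_ge0// nm_wa.
  apply: hC2 => //.
    have hv1M : L2 (fun x => (Q * M) * `|v1 x| + K0 * `|q x|).
      by apply: L2D; apply: L2Z; exact: L2_norm.
    have QM : 0 <= Q * M by rewrite mulr_ge0 ?Q_ge0 ?(ltW M0).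
    apply: (@le_trans _ _ (nm (fun x => (Q * M) * `|v1 x| + K0 * `|q x|))).
      apply: nm_dom => //.
      - by apply: L2_bmul hqu; [exact: measurable_chi|exact: chi_le1].
      - move=> x; rewrite /chi; case: ifPn => h; last by rewrite mul0r normr0.
        have xM : `|x| <= M by rewrite ler_norml.
        rewrite mul1r [leRHS]ger0_norm; last by rewrite addr_ge0// mulr_ge0.
        rewrite normrM; apply: (@le_trans _ _ (`|q x| * (M * `|v1 x| + K0 * 1))).
          rewrite ler_wpM2l//; apply: le_trans (ler_normB _ _) _; apply: lerD.
            by rewrite normrM ler_wpM2r//; exact: le_trans (wm_le_id x r0) xM.
          by rewrite normrM; apply: ler_pM => //; exact: wa_le1.
        rewrite mulr1 mulrDr (mulrC _ K0) lerD2r mulrA ler_wpM2r// ler_wpM2r ?(ltW M0)//.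
    apply: le_trans (nmD _ _) _; try by apply: L2Z; exact: L2_norm.
    rewrite (nmZ _ (L2_norm hxv1)) (nmZ _ (L2_norm hq)) !nm_norm (ger0_norm QM) (ger0_norm K00).
    have -> : Q * M * nm v1 = M * A by rewrite /A; ring.
    rewrite /C1; lra.
  move=> w dw hw; have [hw0 _] := hw; have [hw1 _ _] := hw0.
  pose u x := wm r x * v1 x - kap * wa r x.
  pose du x := dwm r x * v1 x + wm r x * dv1 x - kap * dwa r x.
  pose mw x := wm r x * w x; pose dmw x := dwm r x * w x + wm r x * dw x.
  pose xmw x := x * mw x; pose dxmw x := mw x + x * dmw x.
  have e1 : evle (fun n => - (B n v1 dv1 mw dmw - B n u du w dw - c * kap * ip (wa r) w))
    (C0 gamma * (nm v1 + nm dv1 + `|kap|) * nm w) := evleN (commutator gamma c kap r1 hx0 hw0).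
  have e2 : evle (fun n => - (B n v dv xmw dxmw - B n v1 dv1 mw dmw - 2 * ip dv mw
     - gamma * ip (cv (qk (tn n)) v) mw)) 0 := evleN (xstep hv (TC_wm r1 hw)).
  have e3 : evle (fun n => B n v dv xmw dxmw - ip (fun x => q x * v x + f x) xmw) 0 :=
    evle_sub (we _ _ (TC_xwm r1 hw)).
  pose last n := ip (fun x => q x * v x + f x) xmw - ip (fun x => q x * u x) w
     - 2 * ip dv mw - gamma * ip (cv (qk (tn n)) v) mw
     - c * kap * ip (wa r) w.
  have e4 : evle last (A2 * nm w).
    apply: (@evle_sn _ _ _ (`|gamma| * (pi^-1 * Num.sqrt (pi * r) * 2 * nm v) * nm w)) => j.
    have t0 := @tn_gt0 R j; have [hD nD] := wm_commutator r0 t0 hv1.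
    have [hT _] := cv_qk_contr t0 hv1; have [hTm nTm] := cv_qk_contr t0 hmv.
    move: hD nD; set D := fun x => _ => hD nD.
    have E1 : ip (fun x => q x * v x + f x) xmw = ip (fun x => q x * u x) w + kap * ip (fun x => q x * wa r x) w
       + ip (fun x => wa r x * F x) w + kf * ip (wa r) w.
      rewrite -(ipZl kap hqa hw1) -(ipZl kf ha hw1) -(ipDl hqu (L2Z kap hqa) hw1).
      rewrite -(ipDl (L2D hqu (L2Z kap hqa)) hFa hw1).
      rewrite -(ipDl (L2D (L2D hqu (L2Z kap hqa)) hFa) (L2Z kf ha) hw1).
      by apply: I_ext => x; rewrite /F /xmw /mw /v1 wmE; ring.
    have E2 : ip (cv (qk (tn j)) v) mw =
       ip D w + ip (cv (qk (tn j)) (fun x => wm r x * v x)) w - pi^-1 * ip (wa r) v * ip (wa r) w.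
      rewrite [LHS]ip_mulC -(ipZl _ ha hw1) -(ipDl hD hTm hw1) -(ipBl (L2D hD hTm) (L2Z _ ha) hw1).
      by congr (ip _ w); apply/funext => x; rewrite /D; ring.
    have E3 : ip dv mw = ip (fun x => wm r x * dv x) w by exact: ip_mulC.
    have -> : last j = kap * ip (fun x => q x * wa r x) w + ip (fun x => wa r x * F x) w
        - 2 * ip (fun x => wm r x * dv x) w
        - gamma * (ip D w + ip (cv (qk (tn j)) (fun x => wm r x * v x)) w).
      by rewrite /last E1 E2 E3 kE; gen_ip; move: (pi^-1 : R) => *; ring.
    have b1 : `|ip (fun x => q x * wa r x) w| <= nm q * nm w by exact: ip_bound.
    have b2 : `|ip (fun x => wa r x * F x) w| <= nm F * nm w by apply: ip_bound => //; rewrite -[leRHS]mul1r.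
    have b3 : `|ip (fun x => wm r x * dv x) w| <= nm (fun x => x * dv x) * nm w by exact: ip_bound.
    have b4 : `|ip (cv (qk (tn j)) (fun x => wm r x * v x)) w| <= nm v1 * nm w.
      by apply: ip_bound => //; exact: le_trans nmv.
    have b5 : `|ip D w| <= (nm v1 + pi^-1 * Num.sqrt (pi * r) * 2 * nm v * sn j) * nm w.
      apply: ip_bound => //; apply: le_trans nD _; rewrite mulrDr; apply: lerD => //.
      by rewrite le_eqVlt; apply/orP; left; apply/eqP; rewrite /sn; ring.
    have b1' : `|kap * ip (fun x => q x * wa r x) w| <= K0 * (nm q * nm w).
      by rewrite normrM; apply: ler_pM.
    have b3' : `|2 * ip (fun x => wm r x * dv x) w| <= 2 * (nm (fun x => x * dv x) * nm w).
      by rewrite normrM ger0_norm// ler_wpM2l.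
    have b6 : `|gamma * (ip D w + ip (cv (qk (tn j)) (fun x => wm r x * v x)) w)| <=
       `|gamma| * ((nm v1 + pi^-1 * Num.sqrt (pi * r) * 2 * nm v * sn j) * nm w + nm v1 * nm w).
      by rewrite normrM ler_wpM2l//; apply: le_trans (ler_normD _ _) _; exact: lerD.
    apply: le_trans (ler_normB _ _) _; apply: le_trans (lerD _ b6) _.
      apply: le_trans (ler_normB _ _) _; apply: lerD b3'.
      by apply: le_trans (ler_normD _ _) _; exact: lerD b1' b2.
    rewrite le_eqVlt; apply/orP; left; apply/eqP; rewrite /A2.
    by move: (nm _) (nm _) (nm _) (nm _) (nm _) (nm _) (sn j) (Num.sqrt _) (pi^-1 : R) => *; ring.
  apply: (evle_le _ (evle_ext _ (evleD (evleD (evleD e1 e2) e3) e4))); last first.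
    move=> j; rewrite /last; set b1 := B _ v dv _ _; set b2 := B _ v1 _ _ _; set b3 := B _ u _ _ _.
    rewrite -[RHS]/(b3 - ip (fun x => q x * u x) w).
    by move: b1 b2 b3 => b1 b2 b3; gen_ip; ring.
  have h1 : C0 gamma * (nm v1 + nm dv1 + `|kap|) <= A' by rewrite ler_wpM2l// lerD2l.
  have gen (a1 a2 a3 a4 X W : R) : 0 <= W -> 0 <= a1 -> 0 <= a2 -> X <= a3 ->
      X * W + 0 + 0 + a4 * W <= (a1 + a2 + a3 + a4) * W.
    move=> W0 x1 x2 x3; rewrite !addr0 -mulrDl ler_wpM2r//; lra.
  exact: gen (nm_ge0 w) A0 Kq0 h1.
have b1 n := let: And3 a _ _ := main n in a.
have b2 n := let: And3 _ a _ := main n in a.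
have b3 n := let: And3 _ _ a := main n in a.
have [h1 h2] := weighted_limit hx0 kc b1 b2.
by exists k, C2; split=> //; exact: h2 b3.
Qed.

End Passes.

(** * Lipschitz bounds *)

Section Decay.
Context {R : realType}.
Local Notation mu := (@lebesgue_measure R).
Local Notation I := (Rintegral mu setT).
Implicit Types (f g h u v w m K F G V du dv dw dV q : R -> R) (a b r s t x y z M e k L Q : R).

Definition ramp a b x : R := Num.min (Num.max x a) b - a.

Lemma rampE a b x : a <= b ->
  ramp a b x = if x <= a then 0 else if x <= b then x - a else b - a.
Proof.
move=> ab; rewrite /ramp; case: (leP x a) => h1; first by rewrite (min_l ab) subrr.
by case: (leP x b).
Qed.

Lemma AC_ramp a b : a <= b -> abscont (ramp a b) (chi a b).
Proof.
move=> ab x y xy.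
have E z : chi x y z * chi a b z = chi (Num.max x a) (Num.min y b) z.
  rewrite /chi ge_max le_min.
  by case: (x <= z); case: (z <= y); case: (a <= z); case: (z <= b); rewrite /= ?mulr1 ?mulr0 ?mul0r.
rewrite (_ : (fun z => _) = chi (Num.max x a) (Num.min y b)); last exact/funext.
split; first exact: summ_chi.
have [h|h] := leP (Num.max x a) (Num.min y b).
  rewrite I_chi1//; move: h; rewrite !rampE//.
  by case: (leP x a) => h1; case: (leP y a) => h2; case: (leP y b) => h3;
    case: (leP x b) => h4 h; lra.
rewrite (_ : chi _ _ = fun=> 0) ?I_0; last first.
  apply/funext => z; rewrite /chi; case: ifP => // /andP[h1 h2].
  by have := le_lt_trans (le_trans h1 h2) h; rewrite ltxx.
move: h; rewrite !rampE//.
by case: (leP x a) => h1; case: (leP y a) => h2; case: (leP y b) => h3;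
    case: (leP x b) => h4 h; lra.
Qed.

Lemma L2_xchi a b : L2 (fun x => x * chi a b x).
Proof.
have h : L2 (fun x => (`|a| + `|b|) * chi a b x) by apply: L2Z; exact: L2_chi.
apply: L2_dom h; first by apply: measurable_xM; exact: measurable_chi.
move=> x; rewrite /chi; case: ifP => [/andP[h1 h2]|_]; last by rewrite !mulr0.
rewrite !mulr1 [leRHS]ger0_norm; last by rewrite addr_ge0.
rewrite ler_norml; apply/andP; split.
  by have := ler_norm (- a); rewrite normrN; have := normr_ge0 b; lra.
by have := ler_norm b; have := normr_ge0 a; lra.
Qed.

(** Rises from [0] to [1] on [[a, a + e]] and returns to [0] over the next unit length. The steep
    side produces a difference quotient with step [e], while the slow side keeps the support and the
    norm bounded. *)
Definition trap a e x : R := e^-1 * ramp a (a + e) x - ramp (a + e) (a + e + 1) x.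
Definition dtrap a e x : R := e^-1 * chi a (a + e) x - chi (a + e) (a + e + 1) x.

Lemma AC_trap a e : 0 < e -> abscont (trap a e) (dtrap a e).
Proof.
move=> e0; have l1 : a <= a + e by lra.
have l2 : a + e <= a + e + 1 by lra.
have := ACD (ACZ e^-1 (AC_ramp l1)) (ACZ (-1) (AC_ramp l2)).
by apply: AC_ext => x; rewrite mulN1r.
Qed.

Lemma trap_le a e x : 0 < e -> `|trap a e x| <= chi a (a + e + 1) x.
Proof.
move=> e0; rewrite /trap /ramp /chi.
have ee : e^-1 * e = 1 by rewrite mulVf// gt_eqF.
have eV : 0 < e^-1 by rewrite invr_gt0.
have [h1|h1] := leP x a.
  have -> : Num.min a (a + e) = a by apply: min_l; lra.
  have -> : Num.max x (a + e) = a + e by apply: max_r; lra.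
  have -> : Num.min (a + e) (a + e + 1) = a + e by apply: min_l; lra.
  by rewrite !subrr mulr0 subr0 normr0; case: ifP.
have [h2|h2] := leP x (a + e).
  have -> : Num.min (a + e) (a + e + 1) = a + e by apply: min_l; lra.
  rewrite subrr subr0 (ltW h1) /= (_ : x <= a + e + 1); last lra.
  rewrite ger0_norm ?mulr_ge0 ?(ltW eV) ?subr_ge0 ?(ltW h1)//.
  by rewrite -ee ler_pM2l//; lra.
rewrite (_ : a + e - a = e); last lra.
rewrite ee (ltW h1) /=; have [h3|h3] := leP x (a + e + 1).
  by rewrite ler_norml; apply/andP; split; lra.
by rewrite (_ : 1 - _ = 0) ?normr0//; lra.
Qed.

Lemma TC_trap a e : 0 < e -> TC (trap a e) (dtrap a e).
Proof.
move=> e0; have mt : measurable_fun setT (trap a e).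
  apply: measurable_funB.
    apply: measurable_funM; first exact: measurable_cst.
    apply: measurable_funB; last exact: measurable_cst.
    by apply: measurable_minr; [apply: measurable_maxr|]; try exact: measurable_cst; exact: measurable_id.
  apply: measurable_funB; last exact: measurable_cst.
  by apply: measurable_minr; [apply: measurable_maxr|]; try exact: measurable_cst; exact: measurable_id.
have le x := trap_le a x e0.
have h1 : L2 (trap a e).
  apply: L2_dom (L2_chi a (a + e + 1)) => // x; exact: le_trans (le x) (ler_norm _).
have h2 : L2 (dtrap a e) by apply: L2B; [apply: L2Z|]; exact: L2_chi.
have hH : H1 (trap a e) (dtrap a e) by split=> //; exact: AC_trap.
split=> //; split.
- apply: L2_dom (L2_xchi a (a + e + 1)); first exact: measurable_xM.
  by move=> x; rewrite normrM [leRHS]normrM ler_wpM2l//; exact: le_trans (le x) (ler_norm _).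
- apply: L2D => //; have := L2B (L2Z e^-1 (L2_xchi a (a + e))) (L2_xchi (a + e) (a + e + 1)).
  by congr L2; apply/funext => x; rewrite /dtrap; ring.
- exact: AC_xM.
Qed.

Lemma nm_trap a e : 0 < e -> e <= 1 -> nm (trap a e) <= 2.
Proof.
move=> e0 e1; have le x := trap_le a x e0; have [[h _ _] _] := TC_trap a e0.
apply: (@le_trans _ _ (nm (chi a (a + e + 1)))).
  by apply: nm_dom => // [|x]; [exact: L2_chi|exact: le_trans (le x) (ler_norm _)].
rewrite nm_chi; last lra.
rewrite -(ler_pXn2r (n := 2)) ?nnegrE ?sqrtr_ge0// sqr_sqrtr; lra.
Qed.

(** The hypothesis is a weak [L^2] bound on [V'']. Testing with [trap a e] bounds the difference
    quotient by [M] times the norm of the trapezoid, at most [2], plus an oscillation of [V], at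
    most [2 * S]; steps [e > 1] need only the latter. *)
Lemma lipschitz V dV M : H1 V dV -> 0 <= M ->
  (forall w dw, TC w dw -> `|ip dV dw| <= M * nm w) ->
  exists L, 0 <= L /\ forall x y, `|V y - V x| <= L * `|y - x|.
Proof.
move=> hV M0 h; have [hV1 hV2 ac] := hV; pose S := nm V + nm dV.
have S0 : 0 <= S by rewrite addr_ge0 ?nm_ge0.
have VS x y : `|V y - V x| <= 2 * S.
  by apply: le_trans (ler_normB _ _) _; rewrite mulr2n mulrDl mul1r; apply: lerD; exact: H1_sup.
exists (2 * M + 2 * S); split; first by rewrite addr_ge0// mulr_ge0.
have main a e : 0 < e -> `|V (a + e) - V a| <= (2 * M + 2 * S) * e.
  move=> e0; have [e1|e1] := leP e 1; last first.
    apply: le_trans (VS _ _) _; have : 0 <= M * e by rewrite mulr_ge0// ltW.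
    have := ler_wpM2l S0 (ltW e1); lra.
  have hw := TC_trap a e0; have := h _ _ hw.
  have -> : ip dV (dtrap a e) = e^-1 * (V (a + e) - V a) - (V (a + e + 1) - V (a + e)).
    have [|s1 ->] := ac a (a + e); first lra.
    have [|s2 ->] := ac (a + e) (a + e + 1); first lra.
    rewrite -I_Z// -I_B//; last exact: summZ.
    by apply: I_ext => x; rewrite /dtrap; ring.
  move=> h1; have h2 : `|e^-1 * (V (a + e) - V a)| <= 2 * M + 2 * S.
    rewrite -[X in `|X|](subrK (V (a + e + 1) - V (a + e))).
    apply: le_trans (ler_normD _ _) _; apply: lerD => //.
    by apply: le_trans h1 _; rewrite mulrC ler_wpM2r// nm_trap.
  move: h2; rewrite normrM gtr0_norm ?invr_gt0// mulrC ler_pdivrMr//.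
move=> x y; have [xy|xy|->] := ltgtP x y.
- have := @main x (y - x); rewrite subr_gt0 => /(_ xy); rewrite (addrC x) subrK.
  by rewrite (gtr0_norm (_ : 0 < y - x)) ?subr_gt0.
- have := @main y (x - y); rewrite subr_gt0 => /(_ xy); rewrite (addrC y) subrK.
  by rewrite distrC (distrC y x) (gtr0_norm (_ : 0 < x - y)) ?subr_gt0.
- by rewrite !subrr !normr0 mulr0.
Qed.

Variables gamma c : R.
Hypotheses (hc0 : 0 <= gamma -> 0 < c) (hc1 : gamma < 0 -> gamma ^+ 2 / 4 < c).

Lemma decay v dv f kf q dq : H1 q dq -> H1 v dv -> L2 f -> L2 (fun x => x * f x) ->
  L2 (fun x => x * (x * f x) - kf) ->
  WE gamma c v dv (fun x => q x * v x + f x) ->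
  TC v dv /\ exists k L, [/\ 0 <= L, L2 (fun x => x * (x * v x) - k),
    forall x, `|x * (x * v x)| <= L, L2 (fun x => x * (x * dv x)) &
    forall x y, `|y * (y * v y) - x * (x * v x)| <= L * `|y - x|].
Proof.
move=> hq hv hf hxf hF we; have [hq1 _ _] := hq.
have qQ x := H1_sup x hq.
have q0 e (e0 : 0 < e) := H1_vanish hq e0.
have tc := first_moment hc0 hc1 hq1 qQ q0 hv hf hxf we; split=> //.
have [k [C [hV hC]]] := second_moment hc0 hc1 hq1 qQ q0 tc hf hxf hF we.
have [_ [hxv _ _]] := tc.
have hC' w dw : TC w dw -> `|ip (fun x => x * v x + x * (v x + x * dv x)) dw| <= `|C| * nm w.
  by move=> /hC h; apply: le_trans h _; rewrite ler_wpM2r ?nm_ge0// ler_norm.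
have [L [L0 hL]] := lipschitz hV (normr_ge0 C) hC'.
have [hV1 hV2 _] := hV.
pose S := nm (fun x => x * (x * v x) - k) + nm (fun x => x * v x + x * (v x + x * dv x)) + `|k|.
have S0 : 0 <= S by rewrite !addr_ge0 ?nm_ge0.
exists k, (L + S); split.
- exact: addr_ge0.
- exact: hV1.
- move=> x; rewrite -[X in `|X|](subrK k); apply: le_trans (ler_normD _ _) _.
  by apply: le_trans (lerD (H1_sup x hV) (lexx _)) _; rewrite lerDr.
- have := L2B hV2 (L2Z 2 hxv); congr L2; apply/funext => x; ring.
- move=> x y; have := hL x y; rewrite opprB addrA subrK => h; apply: le_trans h _.
  by rewrite ler_wpM2r// lerDl.
Qed.

End Decay.

(** * Weak derivatives *)

Section Distributions.
Context {R : realType}.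
Local Notation mu := (@lebesgue_measure R).
Local Notation I := (Rintegral mu setT).
Implicit Types (f g h u v w m K F G psi rho : R -> R) (a b r s t x y z M e L : R) (p : {poly R}) (k : nat).

Definition loc f := measurable_fun setT f /\ forall a b, summ (fun x => chi a b x * f x).

Lemma summ_integrable a b f : summ (fun x => chi a b x * f x) <-> mu.-integrable `[a, b] (EFin \o f).
Proof.
have E : (fun x => (chi a b x * f x)%:E) = ((EFin \o f) \_ `[a, b]%classic).
  apply/funext => x; rewrite /patch mem_setE /chi in_itv/=.
  by case: ifP => _; rewrite ?mul1r ?mul0r.
have h := @integrable_mkcond _ (measurableTypeR R) R mu `[a, b]%classic (EFin \o f) (measurable_itv _).
split.
  by move=> s; apply/h; rewrite -E.
by move=> /h; rewrite -E.
Qed.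

Lemma locP f : loc f <-> locally_integrable setT f.
Proof.
split=> [[mf sf]|[mf _ hK]].
  split=> [||K _ cK]; [exact: mf|exact: openT|].
  have [M [_ hM]] := compact_bounded cK.
  have KM : K `<=` `[- (M + 1), M + 1]%classic.
    move=> x Kx /=; rewrite in_itv/= -ler_norml; apply: (hM (M + 1)) => //.
    by rewrite ltrDl.
  have /integrableP[_] := (summ_integrable _ _ _).1 (sf (- (M + 1)) (M + 1)).
  apply: le_lt_trans; apply: ge0_subset_integral => //.
  - exact: compact_measurable.
  - exact: measurable_funTS (measurable_EFin (measurable_norm mf)).
split=> // a b; apply/summ_integrable/integrableP; split.
  by apply/measurable_EFinP; exact: measurable_funTS.
by apply: hK => //; exact: segment_compact.
Qed.

Lemma loc_L2 f : L2 f -> loc f.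
Proof. by move=> hf; split; [exact: L2_mf|move=> a b; exact: summ_chi_mul]. Qed.

Lemma locB f g : loc f -> loc g -> loc (fun x => f x - g x).
Proof.
move=> [mf sf] [mg sg]; split=> [|a b]; first exact: measurable_funB.
rewrite (_ : (fun x => _) = fun x => chi a b x * f x - chi a b x * g x); first exact: summB.
by apply/funext => x; rewrite mulrBr.
Qed.

Lemma loc_cst (k : R) : loc (fun=> k).
Proof.
split=> [|a b]; first exact: measurable_cst.
rewrite (_ : (fun x => _) = fun x => k * chi a b x); first by apply: summZ; exact: summ_chi.
by apply/funext => x; rewrite mulrC.
Qed.

Lemma AC_loc F f : measurable_fun setT F -> abscont F f -> loc F.
Proof.
move=> mF ac; split=> // a b; have [ab|ab] := leP a b.
  have [M [M0 hM]] := AC_bound ac ab.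
  apply: (@summ_dom _ (fun x => M * chi a b x)); last by apply: summZ; exact: summ_chi.
    by apply: measurable_funM => //; exact: measurable_chi.
  by move=> x; have := hM x; rewrite /chi; case: ifP => _; rewrite ?mulr1// !mul0r !mulr0 normr0.
rewrite (_ : (fun x => _) = fun=> 0); first exact: summ0.
apply/funext => x; rewrite /chi; case: ifP => [/andP[h1 h2]|_]; last by rewrite mul0r.
by have := le_lt_trans (le_trans h1 h2) ab; rewrite ltxx.
Qed.

Lemma ae_neq a : {ae mu, forall x, x != a}.
Proof.
exists [set a]; split; [exact: measurable_set1|exact: lebesgue_measure_set1|].
by move=> x /=; case: eqVneq.
Qed.

(** Lebesgue differentiation on each half-line starting at [- n], followed by a countable union of
    null sets. *)
Lemma AC_ae_derive F f : loc f -> abscont F f -> {ae mu, forall x, is_derive x 1 F (f x)}.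
Proof.
move=> lf ac; have lf' := (locP f).1 lf.
have P n : {ae mu, forall x, - n%:R < x -> is_derive x 1 F (f x)}.
  have intf y : mu.-integrable [set` Interval (BLeft (- n%:R)) (BRight y)] (EFin \o f).
    by apply/summ_integrable; case: lf.
  have := FTC1 intf lf'; apply: aeS => x h xn.
  have [|dF eF] := h; first by rewrite lte_fin.
  have d1 : is_derive x 1 (fun y => \int[mu]_(t in [set` Interval (BLeft (- n%:R)) (BRight y)]) f t) (f x).
    by apply: DeriveDef; [exact: dF|rewrite -derive1E; exact: eF].
  have d2 := derD d1 (derC (F (- n%:R)) x); rewrite addr0 in d2.
  apply: near_eq_is_derive d2; near=> y.
  have yn : - n%:R <= y by apply: ltW; near: y; exact: lt_nbhsr.
  by have [_ E] := ac _ _ yn; rewrite -I_chi -E subrK.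
have := ae_foralln P; apply: aeS => x h.
have [n _ hn] := nbhs_infty_gtr (- x); apply: (h n).
by rewrite ltrNl; exact: (hn n (leqnn n)).
Unshelve. all: by end_near. Qed.

Lemma lip_ae F f L : loc f -> abscont F f -> (forall x y, `|F y - F x| <= L * `|y - x|) ->
  {ae mu, forall x, `|f x| <= L}.
Proof.
move=> lf ac lip; have := AC_ae_derive lf ac; apply: aeS => x [dF <-].
have cv : h^-1 *: (F (h *: 1 + x) - F x) @[h --> 0^'] --> 'D_1 F x by exact: dF.
have cn : `|h^-1 *: (F (h *: 1 + x) - F x)| @[h --> 0^'] --> `|'D_1 F x| by exact: cvg_norm.
rewrite -(cvg_lim (@Rhausdorff R) cn); apply: limr_le; first by apply/cvg_ex; eexists; exact: cn.
near=> h; have h0 : h != 0 by near: h; exact: nbhs_dnbhs_neq.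
rewrite normrM normfV mulrC ler_pdivrMr ?normr_gt0//.
by apply: le_trans (lip _ _) _; rewrite addrK /GRing.scale/= mulr1.
Unshelve. all: by end_near. Qed.

(** [f] is a density of the zero function, whose Lipschitz constant is [0]. *)
Lemma AC_zero f : loc f -> (forall a b, a < b -> I (fun x => chi a b x * f x) = 0) ->
  {ae mu, forall x, f x = 0}.
Proof.
move=> lf h; have ac : abscont (fun=> 0) f.
  move=> a b; rewrite le_eqVlt => /predU1P[<-|ab]; last by rewrite h// subrr; case: lf.
  split; first by case: lf.
  rewrite subrr -I_0; apply: I_eq_ae; first exact: measurable_cst.
    by apply: measurable_funM; [exact: measurable_chi|case: lf].
  apply: aeS (ae_neq a) => x xa; rewrite /chi -eq_le eq_sym (negbTE xa) mul0r//.
have lip x y : `|(fun=> 0 : R) y - (fun=> 0 : R) x| <= 0 * `|y - x|.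
  by rewrite subrr normr0 mul0r.
by have := lip_ae lf ac lip; apply: aeS => x; rewrite normr_le0 => /eqP.
Qed.

Lemma measurable_chi2 (g1 g2 g3 : R * R -> R) : measurable_fun setT g1 ->
  measurable_fun setT g2 -> measurable_fun setT g3 ->
  measurable_fun setT (fun o => chi (g1 o) (g2 o) (g3 o)).
Proof.
move=> m1 m2 m3; pose hv := \1_(`[0, +oo[%classic : set R) : R -> R.
have mh : measurable_fun setT hv by exact: measurable_indic.
rewrite (_ : (fun o => _) = fun o => hv (g3 o - g1 o) * hv (g2 o - g3 o)).
  by apply: measurable_funM; apply: (measurableT_comp mh); exact: measurable_funB.
apply/funext => o; rewrite /hv !indicE !mem_setE !in_itv/= !andbT !subr_ge0 /chi.
by case: (_ <= _); case: (_ <= _); rewrite /= ?mulr1 ?mulr0.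
Qed.

(** The difference of indicators gives the signed integral from [0] to [x] in one formula; it is
    additive in the endpoints except at the three points [0], [a], [b]. *)
Lemma primitive f : loc f -> exists F, measurable_fun setT F /\ abscont F f.
Proof.
move=> [mf sf]; exists (fun x => I (fun z => (chi 0 x z - chi x 0 z) * f z)).
have mc x y : measurable_fun setT (fun z => chi x y z * f z).
  by apply: measurable_funM => //; exact: measurable_chi.
split.
  apply: measurable_I2; apply: measurable_funM; last exact: measurable_p2.
  apply: measurable_funB; apply: measurable_chi2; try exact: measurable_cst;
    [exact: measurable_fst|exact: measurable_snd..|exact: measurable_fst|exact: measurable_snd].
have E x : (fun z => (chi 0 x z - chi x 0 z) * f z) = (fun z => chi 0 x z * f z - chi x 0 z * f z).
  by apply/funext => z; rewrite mulrBl.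
move=> a b ab; split=> //; rewrite !E -I_B; try exact: summB.
apply: I_eq_ae => //.
  by do !apply: measurable_funB.
have h1 := ae_neq 0; have h2 := ae_neq a; have h3 := ae_neq b.
apply: (aeS2 (P := fun x => x != 0) (Q := fun x => x != a /\ x != b)) h1 _; last first.
  exact: aeS2 h2 h3.
move=> x x0 [xa xb]; rewrite /chi.
have l1 : (x <= 0) = ~~ (0 <= x) by case: ltgtP x0.
have l2 : (x <= a) = ~~ (a <= x) by case: ltgtP xa.
have l3 : (x <= b) = ~~ (b <= x) by case: ltgtP xb.
rewrite l1 l2 l3; have ab' : (b <= x) ==> (a <= x) by apply/implyP; exact: le_trans.
by move: ab'; case: (b <= x); case: (a <= x) => //; case: (0 <= x) => //= _; ring.
Qed.

(** * Smooth bump functions *)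

Section Bump.
Variables a b e : R.
Hypotheses (ab : a < b) (e0 : 0 < e).

Definition W : {poly R} := ('X - a%:P) * (b%:P - 'X).
Lemma horner_W x : W.[x] = (x - a) * (b - x).
Proof. by rewrite /W !hornerE. Qed.

(** A family closed under differentiation: [p W^-k exp(-e/W)] has a derivative of the same shape,
    with numerator [dbp p k] and exponent [k + 2]. The parameter [e] tends to [0] later, where the
    bump tends to an indicator. *)
Definition bp p (k : nat) x :=
  if (a < x) && (x < b) then p.[x] * W.[x]^-1 ^+ k * expR (- (e / W.[x])) else 0.
Definition dbp p (k : nat) : {poly R} := p^`() * W ^+ 2 - k%:R *: (p * W^`() * W) + e *: (p * W^`()).

Lemma der_Xn f x df (k : nat) : is_derive x 1 f df ->
  is_derive x 1 (fun x => f x ^+ k) (k%:R * f x ^+ k.-1 * df).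
Proof.
case: k => [|k] h; last exact: derX.
by rewrite !mul0r; exact: derC.
Qed.

Lemma dbpE p k x : (dbp p k).[x] = p^`().[x] * W.[x] ^+ 2 -
  k%:R * (p.[x] * W^`().[x] * W.[x]) + e * (p.[x] * W^`().[x]).
Proof. by rewrite /dbp !(hornerD, hornerN, hornerZ, hornerM, horner_exp). Qed.

Lemma W_gt0 x : a < x -> x < b -> 0 < W.[x].
Proof. by move=> ax xb; rewrite horner_W mulr_gt0// subr_gt0. Qed.

Lemma der_bp_in p k x : a < x -> x < b -> is_derive x 1 (bp p k) (bp (dbp p k) k.+2 x).
Proof.
move=> ax xb; have w0 := W_gt0 ax xb; have wn : W.[x] != 0 by rewrite gt_eqF.
have dW : is_derive x 1 (fun x => W.[x]) W^`().[x] by exact: is_derive_poly.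
have dP : is_derive x 1 (fun x => p.[x]) p^`().[x] by exact: is_derive_poly.
have dV := derV wn dW.
have dE := @der_comp _ expR (fun x => - (e / W.[x])) x _ _ (is_derive_expR _) (derN (derM (derC e x) dV)).
have d := derM (derM dP (der_Xn k dV)) dE.
apply: (@near_eq_is_derive _ _ _ (fun x => p.[x] * W.[x]^-1 ^+ k * expR (- (e / W.[x])))).
  near=> y; rewrite /bp.
  have -> : a < y by near: y; exact: lt_nbhsr.
  by have -> : y < b by near: y; exact: lt_nbhsl.
apply: (der_eq d); have -> : bp (dbp p k) k.+2 x =
   (dbp p k).[x] * W.[x]^-1 ^+ k.+2 * expR (- (e / W.[x])) by rewrite /bp ax xb.
rewrite dbpE; clear d dE dV dP dW w0; move: (expR _) => E.
move: (p.[x]) (p^`().[x]) (W^`().[x]) (W.[x]) wn => P P' w' w wn.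
case: k => [|k]; first by rewrite /= !expr0; field.
rewrite -pred_Sn (exprS _ k.+2) !(exprS _ k.+1) !(exprS _ k) !exprVn.
by have := expf_neq0 k wn; move: (w ^+ k) => wk wkn; field; rewrite wkn wn.
Unshelve. all: by end_near. Qed.

Lemma bp_out p k x : ~~ ((a < x) && (x < b)) -> bp p k x = 0.
Proof. by rewrite /bp => /negbTE ->. Qed.

Lemma sqr_der0 h x C : h x = 0 -> (forall y, `|h y| <= C * (y - x) ^+ 2) -> is_derive x 1 h 0.
Proof.
move=> hx0 hC; have cv : t^-1 *: (h (t *: 1 + x) - h x) @[t --> 0^'] --> (0 : R).
  apply/cvgrPdist_le => r r0; near=> t; rewrite sub0r normrN hx0 subr0.
  have t0 : t != 0 by near: t; exact: nbhs_dnbhs_neq.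
  rewrite normrM normfV mulrC ler_pdivrMr ?normr_gt0//.
  apply: le_trans (hC _) _; rewrite addrK /GRing.scale/= mulr1 -(real_normK (num_real t)) expr2 mulrA ler_wpM2r//.
  have C1 : 0 < `|C| + 1 by rewrite ltr_wpDl.
  have : `|t| <= r / (`|C| + 1) by near: t; apply: dnbhs0_le; rewrite divr_gt0.
  rewrite ler_pdivlMr// mulrC; apply: le_trans; rewrite ler_wpM2r//.
  by have := ler_norm C; lra.
by apply: DeriveDef; [apply/cvg_ex; exists 0|apply/cvg_lim].
Unshelve. all: by end_near. Qed.

Lemma pow_exp_bound (k : nat) t : 0 <= t -> t ^+ k.+1 * expR (- t) <= k.+1`!%:R.
Proof.
move=> t0; rewrite expRN ler_pdivrMr ?expR_gt0//.
have f0 : 0 < k.+1`!%:R :> R by rewrite ltr0n fact_gt0.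
have := expR_ge1Dxn k t0; rewrite -(ler_pM2l f0) mulrDr mulrCA divff ?gt_eqF// !mulr1.
by apply: le_trans; rewrite lerDr ltW.
Qed.

(** Seen from a point [x] outside the open interval, [W.[y]] is at most [(b - a)] times the distance
    from [y] to [x]. The exponential absorbs the power [W^-(k+2)], leaving [W ^+ 2]; this gives
    derivative zero at the endpoints too. *)
Lemma bp_bound p k : exists C, forall x y, ~~ ((a < x) && (x < b)) -> `|bp p k y| <= C * (y - x) ^+ 2.
Proof.
have ac : abscont (horner p) (horner p^`()).
  by apply: AC_C1; exact: continuous_horner.
have [Mp [Mp0 hM]] := AC_bound ac (ltW ab).
(* From [t^n exp(-t) <= n!] with [t = e / W] and [n = k + 2]. *)
pose D := k.+2`!%:R / e ^+ k.+2 : R.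
have D0 : 0 <= D by rewrite divr_ge0// exprn_ge0// ltW.
exists (Mp * D * (b - a) ^+ 2) => x y nx; rewrite /bp; case: ifPn => [/andP[ay yb]|_]; last first.
  have S1 := sqr_ge0 (b - a); have S2 := sqr_ge0 (y - x).
  by rewrite normr0; apply: mulr_ge0 => //; apply: mulr_ge0 => //; exact: mulr_ge0.
have w0 := W_gt0 ay yb.
have := hM y; rewrite (chi_in (ltW ay) (ltW yb)) mul1r => Mpy.
have eb : W.[y]^-1 ^+ k.+2 * expR (- (e / W.[y])) <= D.
  rewrite /D ler_pdivlMr ?exprn_gt0//.
  have := @pow_exp_bound k.+1 (e / W.[y]) (ltW (divr_gt0 e0 w0)).
  by rewrite exprMn; apply: le_trans; rewrite le_eqVlt; apply/orP; left; apply/eqP; ring.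
have wb : W.[y] ^+ 2 <= (b - a) ^+ 2 * (y - x) ^+ 2.
  rewrite horner_W -exprMn; rewrite -(real_normK (num_real ((b - a) * (y - x)))).
  rewrite lerXn2r ?nnegrE ?mulr_ge0 ?subr_ge0 ?(ltW ay) ?(ltW yb)//.
  rewrite normrM (gtr0_norm (_ : 0 < b - a)) ?subr_gt0//.
  move: nx; rewrite negb_and -!leNgt => /orP[xa|bx].
    rewrite mulrC; apply: ler_pM; rewrite ?subr_ge0 ?(ltW ay) ?(ltW yb)//; first lra.
    by apply: le_trans (ler_norm _); lra.
  apply: ler_pM; rewrite ?subr_ge0 ?(ltW ay) ?(ltW yb)//; first lra.
  by rewrite distrC; apply: le_trans (ler_norm _); lra.
have E : p.[y] * W.[y]^-1 ^+ k * expR (- (e / W.[y])) =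
   p.[y] * (W.[y]^-1 ^+ k.+2 * expR (- (e / W.[y]))) * W.[y] ^+ 2.
  by rewrite !exprS; move: (expR _) (W.[y]^-1 ^+ k) => E wk; field; rewrite gt_eqF.
have f0 : 0 <= W.[y]^-1 ^+ k.+2 * expR (- (e / W.[y])).
  by rewrite mulr_ge0 ?expR_ge0// exprn_ge0// invr_ge0 ltW.
rewrite E normrM (ger0_norm (sqr_ge0 W.[y])) normrM (ger0_norm f0) -[leRHS]mulrA.
apply: ler_pM (mulr_ge0 (normr_ge0 _) f0) (sqr_ge0 _) _ wb.
exact: ler_pM (normr_ge0 _) f0 Mpy eb.
Qed.

Lemma der_bp p k x : is_derive x 1 (bp p k) (bp (dbp p k) k.+2 x).
Proof.
have [/andP[ax xb]|nx] := boolP ((a < x) && (x < b)); first exact: der_bp_in.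
have [C hC] := bp_bound p k; rewrite bp_out//.
by apply: sqr_der0; [exact: bp_out|move=> y; exact: hC].
Qed.

Definition bump := bp 1 0.
Lemma bumpE x : bump x = if (a < x) && (x < b) then expR (- (e / ((x - a) * (b - x)))) else 0.
Proof. by rewrite /bump /bp; case: ifP => // _; rewrite -polyC1 hornerC expr0 !mul1r horner_W. Qed.

Lemma bump_le x : `|bump x| <= chi a b x.
Proof.
rewrite bumpE /chi; case: ifPn => [/andP[ax xb]|_]; last by rewrite normr0; case: ifP.
rewrite (ltW ax) (ltW xb) /= ger0_norm ?expR_ge0// -expR0 ler_expR oppr_le0.
by rewrite divr_ge0 ?mulr_ge0 ?subr_ge0 ?ltW.
Qed.

Lemma cont_bump : continuous bump.
Proof. exact: der_cont (der_bp 1 0). Qed.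

End Bump.

Lemma derive1_bp a b e s a' b' e' p k p' k' : a < b -> 0 < e -> a' < b' -> 0 < e' ->
  derive1 (fun x => bp a b e p k x + s * bp a' b' e' p' k' x) =
  (fun x => bp a b e (dbp a b e p k) k.+2 x + s * bp a' b' e' (dbp a' b' e' p' k') k'.+2 x) /\ forall x, derivable (fun x => bp a b e p k x + s * bp a' b' e' p' k' x) x 1.
Proof.
move=> ab e0 ab' e0'.
have d x := derD (der_bp ab e0 p k x) (derM (derC s x) (der_bp ab' e0' p' k' x)).
split=> [|x]; last by case: (d x).
by apply/funext => x; rewrite derive1E; case: (d x) => _ ->; rewrite mul0r add0r.
Qed.

(** Two bumps are needed because the du Bois-Reymond argument corrects one bump by a multiple of
    another to reach integral zero. *)
Lemma test_bump a b e s a' b' e' : a < b -> 0 < e -> a' < b' -> 0 < e' ->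
  test_function (fun x => bump a b e x + s * bump a' b' e' x).
Proof.
move=> ab e0 ab' e0'; split.
  have H (n : nat) : exists p k p' k', derive1n n (fun x => bump a b e x + s * bump a' b' e' x) =
    fun x => bp a b e p k x + s * bp a' b' e' p' k' x.
    elim: n => [|n [p [k [p' [k' IH]]]]]; first by exists 1, 0%N, 1, 0%N.
    exists (dbp a b e p k), k.+2, (dbp a' b' e' p' k'), k'.+2.
    by rewrite derive1nS IH (derive1_bp s p k p' k' ab e0 ab' e0').1.
  move=> n x; have [p [k [p' [k' ->]]]] := H n.
  exact: (derive1_bp s p k p' k' ab e0 ab' e0').2.
exists (`|a| + `|b| + `|a'| + `|b'|) => x Mx.
have out c d : `|c| + `|d| < `|x| -> ~~ ((c < x) && (x < d)).
  move=> h; apply/negP => /andP[h1 h2]; move: h; apply/negP; rewrite -leNgt ler_norml.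
  have := ler_norm (- c); rewrite normrN; have := ler_norm d.
  by have := normr_ge0 c; have := normr_ge0 d => *; apply/andP; split; lra.
have := normr_ge0 a; have := normr_ge0 b; have := normr_ge0 a'; have := normr_ge0 b' => *.
by rewrite /bump !bp_out ?mulr0 ?addr0//; apply: out; lra.
Qed.

Lemma test_bump1 a b e : a < b -> 0 < e -> test_function (bump a b e).
Proof.
move=> ab e0; have := test_bump 0 ab e0 ab e0; congr test_function.
by apply/funext => x; rewrite mul0r addr0.
Qed.

Lemma bump_cvg a b x : a < x -> x < b -> bump a b (tn n) x @[n --> \oo] --> (1 : R).
Proof.
move=> ax xb; rewrite (_ : (fun n => _) = fun n => expR (- (tn n / ((x - a) * (b - x))))); last first.
  by apply/funext => n; rewrite bumpE ax xb.
rewrite -expR0; apply: continuous_cvg; first exact: continuous_expR.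
rewrite -oppr0; apply: cvgN; rewrite -[X in _ --> X](mul0r ((x - a) * (b - x))^-1).
by apply: cvgM; [exact: tn_cvg|exact: cvg_cst].
Qed.

Lemma measurable_bump a b e : a < b -> 0 < e -> measurable_fun setT (bump a b e).
Proof. by move=> ab e0; apply: continuous_measurable_fun; exact: cont_bump. Qed.

Lemma I_bump_cvg F a b : loc F -> a < b ->
  I (fun x => F x * bump a b (tn n) x) @[n --> \oo] --> I (fun x => chi a b x * F x).
Proof.
move=> [mF sF] ab; apply: (dct_I _ _ (summ_norm (sF a b))).
- by move=> n; apply: measurable_funM => //; exact: measurable_bump (tn_gt0 n).
- by apply: measurable_funM => //; exact: measurable_chi.
- have h1 := ae_neq a; have h2 := ae_neq b; apply: aeS2 h1 h2 => x xa xb.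
  rewrite mulrC; apply: cvgM; first exact: cvg_cst.
  have [/andP[ax bx]|nx] := boolP ((a < x) && (x < b)).
    by rewrite chi_in ?ltW//; exact: bump_cvg.
  rewrite (_ : (fun n => _) = fun=> 0); last first.
    by apply/funext => n; rewrite bumpE (negbTE nx).
  rewrite (_ : chi a b x = 0); first exact: cvg_cst.
  rewrite /chi; case: ifP => // /andP[h3 h4]; move: nx.
  by rewrite !lt_neqAle h3 h4 eq_sym xa xb.
- move=> n x; rewrite !normrM mulrC ler_wpM2r//.
  by apply: le_trans (ler_norm _); apply: bump_le; rewrite ?tn_gt0.
Qed.

(** As [e] tends to [0] the bumps tend to the indicator of [[a, b]], so all integrals of [F] over
    segments vanish. *)
Lemma bump_zero F : loc F ->
  (forall a b e, a < b -> 0 < e -> I (fun x => F x * bump a b e x) = 0) ->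
  {ae mu, forall x, F x = 0}.
Proof.
move=> lF h; apply: AC_zero => // a b ab; have := I_bump_cvg lF ab.
rewrite (_ : (fun n => _) = fun=> 0); last by apply/funext => n; rewrite h// tn_gt0.
by move/(cvg_lim (@Rhausdorff R)); rewrite lim_cst//; exact: Rhausdorff.
Qed.

Lemma summ_supp F g M : loc F -> measurable_fun setT g -> (exists B, forall x, `|g x| <= B) ->
  (forall x, M < `|x| -> g x = 0) -> summ (fun x => F x * g x).
Proof.
move=> [mF sF] mg [B gB] g0; have := summ_bmul mg gB (sF (- M) M); congr summ.
apply/funext => x; rewrite /chi; case: ifPn => h; first by rewrite mul1r mulrC.
by rewrite g0 ?mulr0 ?mul0r// ltNge ler_norml.
Qed.

(** * Test functions and the du Bois-Reymond lemma *)

Lemma test_der psi : test_function psi -> forall x, is_derive x 1 psi (derive1 psi x).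
Proof.
move=> [h _] x; apply: DeriveDef; first exact: (h 0%N x).
by rewrite derive1E.
Qed.

Lemma test_derive1 psi : test_function psi -> test_function (derive1 psi).
Proof.
move=> tp; have [h [M hM]] := tp; split.
  by move=> n x; have := h n.+1 x; rewrite derive1Sn.
exists M => x Mx; rewrite derive1E.
have d0 : is_derive x 1 (fun=> 0 : R) (0 : R) by exact: derC.
suff : is_derive x 1 psi (0 : R) by case.
apply: near_eq_is_derive d0; near=> y; apply/esym/hM.
near: y; apply: (cvgr_gt `|x|) => //; exact: norm_continuous.
Unshelve. all: by end_near. Qed.

Lemma test_cont psi : test_function psi -> continuous psi.
Proof. by move=> tp; exact: der_cont (test_der tp). Qed.

Lemma test_measurable psi : test_function psi -> measurable_fun setT psi.
Proof. by move=> tp; apply: continuous_measurable_fun; exact: test_cont. Qed.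

Lemma test_AC psi : test_function psi -> abscont psi (derive1 psi).
Proof. by move=> tp; apply: AC_C1 (test_der tp) _; exact/test_cont/test_derive1. Qed.

Lemma test_bounded psi : test_function psi -> exists B, forall x, `|psi x| <= B.
Proof.
move=> tp; have [_ [M hM]] := tp.
have MM : - `|M| <= `|M| by have := normr_ge0 M; lra.
have [B [B0 hB]] := AC_bound (test_AC tp) MM.
exists B => x; have [h|h] := leP `|x| `|M|.
  by have := hB x; rewrite chi_in ?mul1r//; move: h; rewrite ler_norml => /andP[].
by rewrite hM ?normr0//; apply: le_lt_trans (ler_norm M) h.
Qed.

Lemma summ_test F psi : loc F -> test_function psi -> summ (fun x => F x * psi x).
Proof.
move=> lF tp; have [_ [M hM]] := tp.
exact: summ_supp lF (test_measurable tp) (test_bounded tp) hM.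
Qed.

Lemma AC_pairing F f psi : measurable_fun setT F -> loc f -> abscont F f -> test_function psi ->
  distr_pairing f psi = - distr_pairing F (derive1 psi).
Proof.
move=> mF lf ac tp; have tp' := test_derive1 tp; have lF := AC_loc mF ac.
have [_ [M1 h1]] := tp; have [_ [M2 h2]] := tp'.
pose M := `|M1| + `|M2| + 1; have M0 : 0 < M by rewrite ltr_wpDl// addr_ge0.
have mM : - M <= M by lra.
have acp := ACM mF (test_measurable tp) lf.1 (test_measurable tp') ac (test_AC tp).
have [_ E] := acp _ _ mM.
have n1 := ler_norm M1; have n2 := ler_norm M2; have p1 := normr_ge0 M1; have p2 := normr_ge0 M2.
have z1 x : M <= `|x| -> psi x = 0 by move=> Mx; apply: h1; rewrite /M in Mx; lra.
have z2 x : M <= `|x| -> derive1 psi x = 0 by move=> Mx; apply: h2; rewrite /M in Mx; lra.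
have nM : `|M| = M by rewrite gtr0_norm.
rewrite (z1 M) ?nM// (z1 (- M)) ?normrN ?nM// !mulr0 subrr in E.
apply/eqP; rewrite -addr_eq0; apply/eqP; rewrite [RHS]E -I_D; [|exact: summ_test..].
apply: I_ext => x; rewrite /chi; case: ifPn => h; first by rewrite mul1r.
have Mx : M <= `|x| by rewrite leNgt; apply: contra h => /ltW; rewrite ler_norml.
by rewrite z1// z2// !mulr0 addr0 mul0r.
Qed.

(** The primitive from minus infinity vanishes to the left of the support by construction and to the
    right of it because [rho] has integral zero. *)
Lemma test_primitive rho : test_function rho -> I rho = 0 ->
  exists psi, test_function psi /\ derive1 psi = rho.
Proof.
move=> tr I0; have [_ [M hM]] := tr; have lone := @loc_cst (1 : R).
have sr : summ rho by have := summ_test lone tr; congr summ; apply/funext => x; rewrite mul1r.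
pose psi x := \int[mu]_(t in [set` Interval -oo%O (BRight x)]) rho t.
have FTC x : derivable psi x 1 /\ derive1 psi x = rho x.
  have xx : x < x + 1 by rewrite ltrDl.
  apply: (@continuous_FTC1 _ rho -oo%O x (x + 1)) => //.
    by apply: (integrableS measurableT) => //; exact: sr.
    by rewrite ltNyr.
  by apply: test_cont.
have dpsi : derive1 psi = rho by apply/funext => x; case: (FTC x).
exists psi; split=> //; split.
  case=> [|n] x; first by case: (FTC x).
  by rewrite derive1Sn dpsi; case: tr.
exists `|M| => x Mx; rewrite /psi Rintegral_mkcond.
have Mn := ler_norm M.
have [x0|x0] := leP 0 x.
  rewrite -[RHS]I0; apply: I_ext => y; rewrite /patch mem_setE in_itv/=.
  case: leP => // xy; rewrite hM//; apply: le_lt_trans Mn (lt_trans Mx _).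
  by rewrite !ger0_norm// ltW// (le_lt_trans x0).
rewrite -[RHS]I_0; apply: I_ext => y; rewrite /patch mem_setE in_itv/=.
case: leP => // yx; rewrite hM//; apply: le_lt_trans Mn (lt_le_trans Mx _).
by rewrite !ler0_norm ?lerN2// ltW// (le_lt_trans yx).
Qed.

Lemma du_bois_reymond F : loc F ->
  (forall psi, test_function psi -> distr_pairing F (derive1 psi) = 0) ->
  exists k : R, {ae mu, forall x, F x = k}.
Proof.
move=> lF h; have lone := @loc_cst (1 : R).
have s1 psi : test_function psi -> summ psi.
  by move=> tp; have := summ_test lone tp; congr summ; apply/funext => x; rewrite mul1r.
have [n In] : exists n, I (bump 0 1 (tn n)) != 0.
  apply: contrapT => /forallNP H; have := I_bump_cvg lone (ltr01 : 0 < 1 :> R).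
  rewrite (_ : (fun n => _) = fun=> 0); last first.
    apply/funext => n; transitivity (I (bump 0 1 (tn n))).
      by apply: I_ext => x; rewrite mul1r.
    by have /negP := H n; rewrite negbK => /eqP.
  rewrite (I_ext (g := chi 0 1)) => [|x]; last by rewrite mulr1.
  rewrite I_chi1// subr0 => /(cvg_lim (@Rhausdorff R)).
  by rewrite lim_cst// => /esym/eqP; rewrite oner_eq0.
have t0 := test_bump1 (ltr01 : 0 < 1 :> R) (tn_gt0 n).
(* With [r0] as reference, any bump minus [I bump / I r0] times [r0] is the derivative of a test
   function, so pairing [F] with a bump amounts to pairing the constant [k]. *)
pose r0 := bump 0 1 (tn n); pose k := distr_pairing F r0 / I r0.
exists k; have lk : loc (fun x => F x - k) by apply: locB => //; exact: loc_cst.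
suff : {ae mu, forall x, F x - k = 0} by apply: aeS => x /eqP; rewrite subr_eq0 => /eqP.
apply: bump_zero => // a b e ab e0.
have tb := test_bump1 ab e0; pose s := - (I (bump a b e) / I r0).
have ts := test_bump s ab e0 (ltr01 : 0 < 1 :> R) (tn_gt0 n).
have [|psi [tpsi dpsi]] := test_primitive ts.
  rewrite I_D ?I_Z; [|exact: s1..|apply: summZ; exact: s1].
  by rewrite /s mulNr divfK// subrr.
have := h _ tpsi; rewrite dpsi /distr_pairing.
have sb := summ_test lF tb; have s0 := summ_test lF t0.
rewrite (I_ext (g := fun x => F x * bump a b e x + s * (F x * r0 x))); last first.
  by move=> x; rewrite /r0; ring.
rewrite I_D ?I_Z//; last exact: summZ.
move=> E; rewrite (I_ext (g := fun x => F x * bump a b e x - k * bump a b e x)); last first.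
  by move=> x; ring.
rewrite I_B ?I_Z//; [|exact: s1|by apply: summZ; exact: s1].
rewrite -[RHS]E; congr (_ + _); rewrite /s /k /distr_pairing; by ring.
Qed.

Lemma weak_derivative_unique f g1 g2 : weak_derivative f g1 -> weak_derivative f g2 ->
  {ae mu, forall x, g1 x = g2 x}.
Proof.
move=> [_ /locP l1 h1] [_ /locP l2 h2].
suff : {ae mu, forall x, g1 x - g2 x = 0} by apply: aeS => x /eqP; rewrite subr_eq0 => /eqP.
apply: bump_zero; first exact: locB.
move=> a b e ab e0; have tb := test_bump1 ab e0.
rewrite (I_ext (g := fun x => g1 x * bump a b e x - g2 x * bump a b e x)); last by move=> x; ring.
rewrite I_B; [|exact: summ_test..].
by have := h1 _ tb; have := h2 _ tb; rewrite /distr_pairing => -> ->; rewrite subrr.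
Qed.

Lemma weak_derivative_AC f g : weak_derivative f g ->
  exists F, [/\ measurable_fun setT F, abscont F g & {ae mu, forall x, f x = F x}].
Proof.
move=> [/locP lf /locP lg h]; have [G [mG acG]] := primitive lg.
have [||k hk] := @du_bois_reymond (fun x => f x - G x).
- by apply: locB => //; exact: AC_loc acG.
- move=> psi tp; have tp' := test_derive1 tp; have := h _ tp; rewrite (AC_pairing mG lg acG tp) => /oppr_inj E.
  rewrite /distr_pairing (I_ext (g := fun x => f x * derive1 psi x - G x * derive1 psi x)); last first.
    by move=> x; ring.
  rewrite I_B; [|exact: summ_test..|exact: summ_test (AC_loc mG acG) tp'].
  by move: E; rewrite /distr_pairing => ->; rewrite subrr.
exists (fun x => G x + k); split.
- by apply: measurable_funD => //; exact: measurable_cst.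
- by move=> a b ab; have [s E] := acG a b ab; split=> //; rewrite -E; ring.
- by apply: aeS hk => x /eqP; rewrite subr_eq addrC => /eqP.
Qed.

End Distributions.

(** * The travelling wave equation *)

Section Equation.
Context {R : realType}.
Local Notation mu := (@lebesgue_measure R).
Local Notation I := (Rintegral mu setT).
Implicit Types (f g h u v w m K F G V du dv dw dV q psi : R -> R) (a b r s t x y z M e k L Q : R).

Lemma in_L2P f : in_L2 f -> L2 f.
Proof.
move=> hf; split; last exact: Lfun2_integrable_sqr.
by have := sub_Lfun_mfun hf; rewrite inE.
Qed.

Lemma in_Linfty_bounded f M : measurable_fun setT f -> {ae mu, forall x, `|f x| <= M} ->
  in_Linfty f.
Proof.
move=> mf fM; rewrite /in_Linfty inE; apply/andP; split; first by rewrite inE.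
rewrite inE /= /finite_norm unlock /Lnorm; case: ifP => // _.
apply: (@le_lt_trans _ _ M%:E); last exact: ltry.
by apply/ess_sup_inf.ess_supP; apply: aeS fM => x /=; rewrite lee_fin.
Qed.

Lemma AC_ae F f g : measurable_fun setT f -> measurable_fun setT g ->
  {ae mu, forall x, f x = g x} -> abscont F f -> abscont F g.
Proof.
move=> mf mg fg ac a b ab; have [s ->] := ac a b ab.
have m1 : measurable_fun setT (fun x => chi a b x * f x).
  by apply: measurable_funM => //; exact: measurable_chi.
have m2 : measurable_fun setT (fun x => chi a b x * g x).
  by apply: measurable_funM => //; exact: measurable_chi.
have E : {ae mu, forall x, chi a b x * f x = chi a b x * g x} by apply: aeS fg => x ->.
by split; [exact: summ_ae m2 E s|exact: I_eq_ae].
Qed.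

Lemma hilbert_ae f g h : L2 f -> L2 g -> {ae mu, forall x, f x = g x} ->
  is_hilbert f h -> is_hilbert g h.
Proof.
move=> hf hg fg [mh hh]; split=> //; apply: aeS hh => x; apply: cvg_trans; apply: near_eq_cvg.
near=> e; have e0 : 0 < e by near: e; exact: nbhs_right_gt.
rewrite !hilbert_truncE// !cvE; try exact: measurable_tk; try exact: L2_mf.
have mk : measurable_fun setT (fun y => tk e (y - x)) by exact: L2_mf (L2_kshift x (L2_tk e0)).
apply: I_eq_ae; try by apply: measurable_funM => //; exact: L2_mf.
by apply: aeS fg => y ->.
Unshelve. all: by end_near. Qed.

(** The limit of [x_cv_qk]: the [sk] error vanishes and the integral of [f] survives, so the
    transform of [x f] is [x h] plus a constant. It is applied to [phi'] and then to [x phi']. *)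
Lemma moment_cvg f h : L2 f -> L2 (fun x => x * f x) -> measurable_fun setT h ->
  {ae mu, forall x, cv (qk (tn n)) f x @[n --> \oo] --> h x} ->
  L2 (fun x => x * h x + pi^-1 * I f) /\
  {ae mu, forall x, cv (qk (tn n)) (fun x => x * f x) x @[n --> \oo] --> x * h x + pi^-1 * I f}.
Proof.
move=> hf hxf mh fh; have sf := summ_moment hf hxf.
have cv : {ae mu, forall x, cv (qk (tn n)) (fun x => x * f x) x @[n --> \oo] --> x * h x + pi^-1 * I f}.
  apply: aeS fh => x fhx.
  rewrite (_ : (fun n => _) = fun n => x * cv (qk (tn n)) f x + pi^-1 * (I f - cv (sk (tn n)) f x)); last first.
    by apply/funext => n; rewrite (x_cv_qk x (tn_gt0 n) hf sf hxf) subrK.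
  apply: cvgD; first by apply: cvgM => //; exact: cvg_cst.
  apply: cvgM; first exact: cvg_cst.
  rewrite -[X in _ --> X]subr0; apply: cvgB; first exact: cvg_cst.
  have s0 : sn n * nm f @[n --> \oo] --> 0.
    by rewrite -[X in _ --> X](mul0r (nm f)); apply: cvgM; [exact: sn_cvg|exact: cvg_cst].
  apply/cvgrPdist_le => e e0; move/cvgrPdist_le : s0 => /(_ _ e0); apply: filterS => n.
  rewrite !sub0r !normrN; apply: le_trans; apply: le_trans (ler_norm _).
  exact: cv_sk_le x (tn_gt0 n) hf.
split=> //.
apply: (L2_fatou _ _ _ cv).1 => [n|n|].
- exact: (cv_qk_contr (tn_gt0 n) hxf).1.
- exact: (cv_qk_contr (tn_gt0 n) hxf).2.
- by apply: measurable_funD; [exact: measurable_xM|exact: measurable_cst].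
Qed.

Lemma H1_bmul f df v dv M : H1 f df -> (forall x, `|df x| <= M) -> H1 v dv ->
  H1 (fun x => f x * v x) (fun x => df x * v x + f x * dv x).
Proof.
move=> hf hM; have [[mf _] [mdf _] ac] := hf.
apply: (@H1_mul _ _ _ (nm f + nm df + M)) => //.
- move=> x; apply: le_trans (H1_sup x hf) _; rewrite lerDl.
  exact: le_trans (normr_ge0 _) (hM x).
- by move=> x; apply: le_trans (hM x) _; rewrite lerDr addr_ge0 ?nm_ge0.
Qed.

Variables (gamma c : R) (phi psi h : R -> R).
Hypotheses (hc0 : 0 <= gamma -> 0 < c) (hc1 : gamma < 0 -> gamma ^+ 2 / 4 < c).

(** The second derivative of [phi] as prescribed by the equation, with [h] standing for the
    transform of [phi']. *)
Definition rhs x : R := c * phi x - gamma * h x - 2^-1 * phi x ^+ 2.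

Hypotheses (hphi : H1 phi psi) (hpsi : H1 psi rhs) (hil : is_hilbert psi h).

Let T n f := cv (qk (tn n)) f.

Lemma L2_h : L2 h.
Proof. by have [h1 _ _] := hpsi; exact: hilbert_L2 h1 hil. Qed.

Lemma T_cvg : {ae mu, forall x, T n psi x @[n --> \oo] --> h x}.
Proof. exact: hilbert_cvg hpsi hil. Qed.

Lemma weak_T f h' w : L2 f -> L2 h' -> L2 w ->
  {ae mu, forall x, T n f x @[n --> \oo] --> h' x} -> ip (T n f) w @[n --> \oo] --> ip h' w.
Proof.
move=> hf hh' hw; apply: (@weak_cvg _ _ _ _ (nm f)) => // n.
  exact: (cv_qk_contr (tn_gt0 n) hf).1.
exact: (cv_qk_contr (tn_gt0 n) hf).2.
Qed.

(** The nonlinearity is treated as a linear potential [2^-1 * phi], which vanishes at infinity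
    because [phi] lies in [H^1]. *)
Lemma WE_phi : WE gamma c phi psi (fun x => 2^-1 * phi x * phi x + 0).
Proof.
move=> w dw [hw _]; have [hw1 hw2 _] := hw; have [h1 h2 _] := hphi; have [h3 h4 _] := hpsi.
have hh := L2_h; have ibp := H1_ibp hpsi hw.
have -> : ip (fun x => 2^-1 * phi x * phi x + 0) w = c * ip phi w + ip psi dw - gamma * ip h w.
  have -> : ip psi dw = - ip rhs w by rewrite ibp opprK.
  have E x : rhs x = c * phi x - gamma * h x - 2^-1 * phi x ^+ 2 by [].
  have hq : L2 (fun x => c * phi x - gamma * h x - rhs x).
    by apply: L2B => //; apply: L2B; exact: L2Z.
  rewrite (_ : (fun x => 2^-1 * phi x * phi x + 0) = fun x => c * phi x - gamma * h x - rhs x); last first.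
    by apply/funext => x; rewrite /rhs; ring.
  rewrite ipBl//; last by apply: L2B; exact: L2Z.
  rewrite ipBl//; [|exact: L2Z..].
  by rewrite !ipZl//; ring.
rewrite /Bn; apply: cvgB; first exact: cvg_cst.
by apply: cvgM; [exact: cvg_cst|exact: weak_T h3 hh hw1 T_cvg].
Qed.

Lemma H1_half : H1 (fun x => 2^-1 * phi x) (fun x => 2^-1 * psi x).
Proof. exact: H1Z. Qed.

Lemma decay_phi : TC phi psi /\ exists k L, [/\ L2 (fun x => x * (x * phi x) - k),
  forall x, `|x * (x * phi x)| <= L & L2 (fun x => x * (x * psi x))].
Proof.
have z1 : L2 (fun x : R => x * 0).
  by rewrite (_ : (fun x => _) = fun=> 0); [exact: L2_0|apply/funext => x; rewrite mulr0].
have z2 : L2 (fun x : R => x * (x * 0) - 0).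
  by rewrite (_ : (fun x => _) = fun=> 0); [exact: L2_0|apply/funext => x; rewrite !mulr0 subr0].
have [tc [k [L [_ ? ? ? _]]]] := decay hc0 hc1 H1_half hphi L2_0 z1 z2 WE_phi.
by split=> //; exists k, L.
Qed.

Lemma decay_psi : exists M, (forall x, `|x ^+ 2 * phi x| <= M) /\
  (forall x, `|x ^+ 3 * psi x| <= M) /\ {ae mu, forall x, `|x ^+ 3 * rhs x| <= M}.
Proof.
have [tc [k1 [L1 [hk1 hL1 hxxpsi]]]] := decay_phi.
have [h1 h2 _] := hphi; have [h3 h4 _] := hpsi; have hh := L2_h.
have [_ hxphi] := tc; have [hx1 hx2 _] := hxphi.
have hxpsi := L2_xder tc.
have [mh _] := hil.
have spsi := summ_moment h3 hxpsi.
have Ipsi := H1_int0 hphi spsi.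
have [hxh cxh] := moment_cvg h3 hxpsi mh T_cvg.
(* The integral of [phi'] vanishes, so [x h] itself is the limit of the transforms of [x phi']; the
   next moment leaves the constant [k2]. *)
rewrite Ipsi mulr0 in hxh cxh.
have E0 : (fun x => x * h x + 0) = fun x => x * h x by apply/funext => x; rewrite addr0.
rewrite E0 in hxh.
have {}cxh : {ae mu, forall x, T n (fun x => x * psi x) x @[n --> \oo] --> x * h x}.
  by apply: aeS cxh => x; rewrite addr0.
have [hxxh _] := moment_cvg hxpsi hxxpsi (L2_mf hxh) cxh.
set k2 := pi^-1 * _ in hxxh.
have phiB x := H1_sup x hphi; have psiB x := H1_sup x hpsi.
have mphi := L2_mf h1.
have hphi2 : L2 (fun x => phi x * phi x) by exact: L2_bmul mphi phiB h1.
have hxphi2 : L2 (fun x => phi x * (x * phi x)) by exact: L2_bmul mphi phiB hx1.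
have hxxphi2 : L2 (fun x => x * (x * phi x) * phi x).
  by apply: L2_bmul _ hL1 h1; apply: measurable_xM; exact: measurable_xM.
have hxrhs : L2 (fun x => x * rhs x).
  have := L2B (L2B (L2Z c hx1) (L2Z gamma hxh)) (L2Z 2^-1 hxphi2).
  by congr L2; apply/funext => x; rewrite /rhs; ring.
pose v x := x * psi x; pose dv x := psi x + x * rhs x.
have hv : H1 v dv by split; [exact: hxpsi|exact: L2D|exact: AC_xM].
(* Multiplying the equation of [phi'] by [x] produces the source [- 2 phi'' - gamma h]; replacing
   [phi''] by [rhs] turns it into this combination, whose moments are known. *)
pose f x := phi x * phi x - 2 * c * phi x + gamma * h x.
have hf : L2 f by apply: L2D; [apply: L2B => //|]; exact: L2Z.
have hxf : L2 (fun x => x * f x).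
  have := L2D (L2B hxphi2 (L2Z (2 * c) hx1)) (L2Z gamma hxh).
  by congr L2; apply/funext => x; rewrite /f; ring.
(* [x^2 phi] tends to [k1] and [x^2 h] to [- k2] in the [L^2] sense, which gives the tail constant
   of [f]. *)
have hxxf : L2 (fun x => x * (x * f x) - (- (2 * c * k1) - gamma * k2)).
  have := L2D (L2B hxxphi2 (L2Z (2 * c) hk1)) (L2Z gamma hxxh).
  by congr L2; apply/funext => x; rewrite /f; ring.
have we : WE gamma c v dv (fun x => phi x * v x + f x).
  move=> w dw [hw _]; have [hw1 hw2 _] := hw; have [hv1 hv2 _] := hv.
  (* [x * rhs x] is this [H^1] function minus [gamma * x * h x]. Only the former is integrated by
     parts: the transform term stays paired with [dw], matching the limit obtained from
     [ip_cv_der]. *)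
  have hN := H1D (H1Z c hxphi) (H1Z (- 2^-1) (H1_bmul hphi psiB hxphi)).
  have i1 := H1_ibp hN hw; have i2 := H1_ibp hpsi hw.
  have hN1 : L2 (fun x => c * (x * phi x) + - 2^-1 * (phi x * (x * phi x))) by case: hN.
  have hN2 : L2 (fun x => c * (phi x + x * psi x) +
     - 2^-1 * (psi x * (x * phi x) + phi x * (phi x + x * psi x))) by case: hN.
  have E : ip (fun x => phi x * v x + f x) w = c * ip v w + ip dv dw - gamma * - ip (fun x => x * h x) dw.
    have e1 : ip dv dw = ip psi dw + ip (fun x => x * rhs x) dw by exact: ipDl.
    have e2 : ip (fun x => x * rhs x) dw =
       ip (fun x => c * (x * phi x) + - 2^-1 * (phi x * (x * phi x))) dw - gamma * ip (fun x => x * h x) dw.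
      rewrite -(ipZl gamma hxh hw2) -(ipBl hN1 (L2Z gamma hxh) hw2); congr (ip _ dw).
      by apply/funext => x; rewrite /rhs; ring.
    have e3 : ip (fun x => phi x * v x + f x) w = c * ip v w - ip rhs w -
        ip (fun x => c * (phi x + x * psi x) +
           - 2^-1 * (psi x * (x * phi x) + phi x * (phi x + x * psi x))) w.
      rewrite -(ipZl c hv1 hw1) -(ipBl (L2Z c hv1) h4 hw1) -(ipBl (L2B (L2Z c hv1) h4) hN2 hw1).
      by congr (ip _ w); apply/funext => x; rewrite /rhs /f /v; field.
    rewrite e3 e1 e2 i1 i2.
    set A := ip _ dw; set B := ip _ dw; set C := ip _ dw; set D := ip _ w.
    by ring.
  rewrite E /Bn.
  rewrite (_ : (fun n => _) = fun n => c * ip v w + ip dv dw - gamma * - ip (T n v) dw); last first.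
    by apply/funext => n; rewrite (ip_cv_der (tn_gt0 n) hv hw).
  apply: cvgB; first exact: cvg_cst.
  apply: cvgM; first exact: cvg_cst.
  by apply: cvgN; exact: weak_T hxpsi hxh hw2 cxh.
have [[_ hxv] [k [L [L0 _ bnd hxxdv lip]]]] := decay hc0 hc1 hphi hv hf hxf hxxf we.
have [hxv1 hxv2 _] := hxv.
have lD : loc (fun x => x * v x + x * (v x + x * dv x)).
  apply: loc_L2; have := L2D (L2Z 2 hxv1) hxxdv; congr L2; apply/funext => x; ring.
have ae := lip_ae lD (AC_xM hxv) lip.
pose S := nm (fun x => x * v x) + nm (fun x => v x + x * dv x).
have S0 : 0 <= S by rewrite addr_ge0 ?nm_ge0.
have xvS x : `|x * v x| <= S := H1_sup x hxv.
have L10 : 0 <= L1 by exact: le_trans (normr_ge0 _) (hL1 0).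
exists (L1 + L + 3 * S); split; [|split].
- move=> x; have := hL1 x; rewrite mulrA -expr2; lra.
- move=> x; have := bnd x; rewrite /v !mulrA -expr2 -exprSr; lra.
- apply: aeS ae => x hx.
  (* The bracket is the derivative of [x^2 v = x^3 phi'], bounded almost everywhere by its Lipschitz
     constant. *)
  have -> : x ^+ 3 * rhs x = (x * v x + x * (v x + x * dv x)) - 3 * (x * v x) by rewrite /dv /v; ring.
  apply: le_trans (ler_normB _ _) _; rewrite normrM ger0_norm//.
  have := xvS x; lra.
Qed.

End Equation.

Theorem proposition4p1 (R : realType) (gamma c : R)
  (hc0 : 0 <= gamma -> 0 < c) (hc1 : gamma < 0 -> gamma ^+ 2 / 4 < c)
  (phi : R -> R) (phi_H1 : in_H1 phi) (phi_even : even_ae phi)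
  (phi_sol : is_solution c gamma phi) :
  exists dphi ddphi : R -> R,
    [/\ weak_derivative phi dphi,
        weak_derivative dphi ddphi &
        in_Linfty (fun x : R => `|x ^+ 2 * phi x| + `|x ^+ 3 * dphi x|
                                + `|x ^+ 3 * ddphi x|)].
Proof.
have [phi2 [d0 d02 wd0]] := phi_H1; have [d1 [h [wd1 hil sol]]] := phi_sol.
have hphi := in_L2P phi2; have hd0 := in_L2P d02; have mphi := L2_mf hphi.
have [_ /locP ld1 wd1'] := wd1; have [md1 _] := ld1.
(* [is_solution] brings its own derivative [d1]; uniqueness of weak derivatives gives it the square
   integrability of [d0]. *)
have hd1 : L2 d1 := L2_ae md1 (weak_derivative_unique wd0 wd1) hd0.
have hh := hilbert_L2 hd1 hil; have mh := L2_mf hh.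
have [Phi [mPhi acPhi ePhi]] := weak_derivative_AC wd1.
have hPhi : H1 Phi d1 by split=> //; exact: L2_ae ePhi hphi.
have [hPhi1 _ _] := hPhi.
have hPhi2 : L2 (fun x => Phi x * Phi x) := L2_bmul mPhi (fun x => H1_sup x hPhi) hPhi1.
pose g := rhs gamma c Phi h.
have hg : L2 g.
  have := L2B (L2B (L2Z c hPhi1) (L2Z gamma hh)) (L2Z 2^-1 hPhi2).
  by congr L2; apply/funext => x; rewrite /g /rhs expr2.
(* The equation is solved for the distribution [phi'']: testing [d1] with [psi'] produces
   [- <phi, psi''>], which the equation expresses through square integrable functions. *)
have wdg : weak_derivative d1 g.
  split; [exact/locP|exact/locP/loc_L2|].
  move=> psi tp; have tp' := test_derive1 tp.
  have lp := loc_L2 hphi; have lP := loc_L2 hPhi1; have lh := loc_L2 hh; have lP2 := loc_L2 hPhi2.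
  have -> : distr_pairing g psi = c * distr_pairing Phi psi - gamma * distr_pairing h psi
      - 2^-1 * distr_pairing (fun x => Phi x * Phi x) psi.
    rewrite /distr_pairing -!I_Z; try exact: summ_test.
    rewrite -!I_B; try (by apply: summZ; exact: summ_test); last first.
      by apply: summB; apply: summZ; exact: summ_test.
    by apply: I_ext => x; rewrite /g /rhs; ring.
  have mpsi := test_measurable tp.
  have e1 : distr_pairing Phi psi = distr_pairing phi psi.
    apply: I_eq_ae; try exact: measurable_funM.
    by apply: aeS ePhi => x ->.
  have e2 : distr_pairing (fun x => Phi x * Phi x) psi = distr_pairing (fun x => phi x ^+ 2) psi.
    apply: I_eq_ae; try (by apply: measurable_funM => //; exact: measurable_sqr).
    by apply: aeS ePhi => x ->; rewrite expr2.
  rewrite e1 e2 -(sol _ tp) (wd1' _ tp').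
  have -> : derive1n 2 psi = derive1 (derive1 psi) by rewrite derive1nS derive1n1.
  by ring.
have [Psi [mPsi acPsi ePsi]] := weak_derivative_AC wdg.
have hPsi1 : L2 Psi := L2_ae mPsi ePsi hd1.
have hPsi : H1 Psi g by [].
(* The density of [Phi] must be the absolutely continuous representative [Psi], so that it can in
   turn be differentiated; the transform is then carried over from [d1] to [Psi]. *)
have hPhi' : H1 Phi Psi by split=> //; exact: AC_ae ePsi acPhi.
have hil' := hilbert_ae hd1 hPsi1 ePsi hil.
have [M [b1 [b2 b3]]] := decay_psi hc0 hc1 hPhi' hPsi hil'.
exists d1, g; split=> //; apply: (@in_Linfty_bounded _ _ (M + M + M)).
  have mx n : measurable_fun setT (fun x : R => x ^+ n).
    by apply: measurable_funX; exact: measurable_id.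
  apply: measurable_funD; first apply: measurable_funD;
    by apply: measurable_norm; apply: measurable_funM => //; exact: L2_mf.
have e := aeS2 (fun x (a1 : phi x = Phi x) (a2 : d1 x = Psi x) => conj a1 a2) ePhi ePsi.
apply: aeS2 e b3 => x [-> ->] h3.
rewrite ger0_norm; last by rewrite !addr_ge0.
by apply: lerD => //; apply: lerD.
Qed.
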